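(* Let $n\ge 1$ be an integer and let $\phi:\mathbb{R}^n\to\mathbb{C}$ be a test function (in the sense defined in the context) whose associated function $\Phi$ is supported in $\{\xi\in\mathbb{R}^n:\sum_{j=1}^n|\xi_j|<2\}$. For a positive integer $N$ and $U\in \mathrm{U}(N)$ define $C_n(U,\phi)$ as in the context. Then, as $N\to\infty$, $$\int_{\mathrm{U}(N)}C_n(U,\phi)\,dU=\Phi(0)+\sum_{m=1}^{\lfloor n/2\rfloor}\sum_{\{(\alpha_1,\beta_1),\dots,(\alpha_m,\beta_m)\}}\int_{\mathbb{R}^m}\Phi\Big(\sum_{j=1}^m\xi_j\mathbf{e}_{\alpha_j,\beta_j}\Big)\prod_{j=1}^m|\xi_j|\,d\xi_j+O(1/N),$$ where the inner sum is over all sets $\{(\alpha_1,\beta_1),\dots,(\alpha_m,\beta_m)\}$ of pairs of indices with $1\le\alpha_j<\beta_j\le n$ such that the $2m$ indices $\alpha_1,\beta_1,\dots,\alpha_m,\beta_m$ are pairwise distinct, and the implied constant in $O(1/N)$ may depend on $\phi$ (and $n$) but not on $N$.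
   Context: A test function is a smooth function $\phi:\mathbb{R}^n\to\mathbb{C}$ which is symmetric (invariant under every permutation of the variables), satisfies $\phi(x_1+t,\dots,x_n+t)=\phi(x_1,\dots,x_n)$ for all $t\in\mathbb{R}$, is a Schwartz function on the hyperplane $\sum x_j=0$, and can be written as $$\phi(x_1,\dots,x_n)=\int_{\mathbb{R}^n}\Phi(\xi_1,\dots,\xi_n)\,\delta(\xi_1+\dots+\xi_n)\,e^{2\pi i\sum_{j=1}^n\xi_jx_j}\,d\xi_1\cdots d\xi_n$$ for some Schwartz function $\Phi\in\mathcal{S}(\mathbb{R}^n)$, where $\delta$ is the Dirac delta (so the integral is over the hyperplane $\sum\xi_j=0$; only the values of $\Phi$ on this hyperplane matter). For $N\ge1$ the periodic test function with scaling factor $N$ is $\tilde\phi(x_1,\dots,x_n)=\sum_{u_1,\dots,u_{n-1}\in\mathbb{Z}}\phi(N(x_1+u_1),\dots,N(x_{n-1}+u_{n-1}),Nx_n)$, which has period 1 in each variable. For $U\in\mathrm{U}(N)$ (the group of $N\times N$ unitary matrices) with eigenvalues $e^{2\pi i\theta_1},\dots,e^{2\pi i\theta_N}$, $\theta_j\in\mathbb{R}$, set $C_n(U,\phi)=\frac1N\sum_{1\le j_1,\dots,j_n\le N}\tilde\phi(\theta_{j_1},\dots,\theta_{j_n})$ (well defined). Integration over $\mathrm{U}(N)$ is with respect to normalised Haar measure. $\mathbf{e}_i\in\mathbb{R}^n$ denotes the $i$-th standard basis vector and $\mathbf{e}_{i,k}=\mathbf{e}_i-\mathbf{e}_k$.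 *)

(* Defs.v *)
From HB Require Import structures.
From mathcomp Require Import all_boot all_order all_algebra all_fingroup.
From mathcomp Require Import spectral.
From mathcomp Require Import all_classical all_reals all_analysis.
From mathcomp Require Import complex.

Set Implicit Arguments.
Unset Strict Implicit.
Unset Printing Implicit Defensive.

Import Order.TTheory GRing.Theory Num.Theory.
Import numFieldNormedType.Exports.

Local Open Scope classical_set_scope.
Local Open Scope ring_scope.
Local Open Scope complex_scope.

Definition expi (R : realType) (t : R) : R[i] :=
  cos (2 * pi * t) +i* sin (2 * pi * t).

(* Real and imaginary parts are integrated separately; the value is meaningful
   only for integrable f. *)
Definition cintegral d (T : measurableType d) (R : realType)
    (mu : set T -> \bar R) (f : T -> R[i]) : R[i] :=
  fine (\int[mu]_x (complex.Re (f x))%:E)%E +i* fine (\int[mu]_x (complex.Im (f x))%:E)%E.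

(* Unordered sum; meaningful only for absolutely summable families. *)
Definition rsum (R : realType) (I : choiceType) (f : I -> R) : R :=
  fine (\esum_(i in setT) (EFin \o f)^\+ i)%E -
  fine (\esum_(i in setT) (EFin \o f)^\- i)%E.

Definition csum (R : realType) (I : choiceType) (f : I -> R[i]) : R[i] :=
  rsum (fun i => complex.Re (f i)) +i* rsum (fun i => complex.Im (f i)).

(* The m-fold product of mu, carried by m-tuples. *)
Section power_measure.
Context d (T : measurableType d) (R : realType).
Variable mu : {sigma_finite_measure set T -> \bar R}.
Local Open Scope ereal_scope.

Section step.
Variables (m : nat) (nu : {sigma_finite_measure set (m.-tuple T) -> \bar R}).

Let consp (p : (T * m.-tuple T)%type) : m.+1.-tuple T := [tuple of p.1 :: p.2].

Let measurable_consp : measurable_fun setT consp.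
Proof. exact: (measurable_cons measurable_fst measurable_snd). Qed.

Definition power_measure_step : set (m.+1.-tuple T) -> \bar R :=
  pushforward (mu \x nu) consp.

Let step0 : power_measure_step set0 = 0.
Proof. exact: measure0. Qed.

Let step_ge0 A : 0 <= power_measure_step A.
Proof. exact: measure_ge0. Qed.

Let step_sigma_additive : semi_sigma_additive power_measure_step.
Proof. exact: measure_semi_sigma_additive. Qed.

HB.instance Definition _ := isMeasure.Build _ _ _ power_measure_step
  step0 step_ge0 step_sigma_additive.

Let step_sigma_finite : sigma_finite setT power_measure_step.
Proof.
have /sigma_finiteP[F [FT ndF Foo]] := sigma_finiteT mu.
have /sigma_finiteP[G [GT ndG Goo]] := sigma_finiteT nu.
pose g (t : m.+1.-tuple T) : (T * m.-tuple T)%type :=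
  (thead t, [tuple of behead t]).
have mg : measurable_fun setT g.
  apply/measurable_fun_pairP; split => /=; first exact: measurable_tnth.
  exact: measurable_behead.
exists (fun k => g @^-1` (F k `*` G k)).
  rewrite predeqE => t; split => // _.
  have [i _ Fi] : (\bigcup_i F i) (thead t) by rewrite -FT.
  have [j _ Gj] : (\bigcup_i G i) [tuple of behead t] by rewrite -GT.
  exists (maxn i j) => //; split => /=.
  - by move: Fi; exact/subsetPset/ndF/leq_maxl.
  - by move: Gj; exact/subsetPset/ndG/leq_maxr.
move=> k; have [mF Fk] := Foo k; have [mG Gk] := Goo k; split.
  by rewrite -[X in measurable X]setTI; apply: mg => //; exact: measurableX.
rewrite /power_measure_step /pushforward -comp_preimage.
rewrite (_ : g \o consp = id); last first.
  by apply/funext => -[x t] /=; congr pair; exact/val_inj.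
by rewrite preimage_id product_measure1E// lte_mul_pinfty// ge0_fin_numE.
Qed.

HB.instance Definition _ := Measure_isSigmaFinite.Build _ _ _ power_measure_step
  step_sigma_finite.

End step.

Fixpoint power_measure (m : nat) :
    {sigma_finite_measure set (m.-tuple T) -> \bar R} :=
  match m with
  | 0 => \d_ ([tuple] : 0.-tuple T)
  | m'.+1 => power_measure_step (power_measure m')
  end.

End power_measure.

Definition lebesgue_tuple (R : realType) (m : nat) :
    {sigma_finite_measure set (m.-tuple (measurableTypeR R)) -> \bar R} :=
  power_measure lebesgue_measure m.

(* Algebraic alias under which the topology of complex matrices is inferred. *)
Definition Cplx (R : realType) : numClosedFieldType := R[i].

Definition unitary (R : realType) (N : nat) : Type :=
  set_type [set U : 'M[Cplx R]_N | U \is unitarymx].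

Section unitary_group.
Context {R : realType} {N : nat}.

HB.instance Definition _ := Topological.on (unitary R N).

Definition umx (U : unitary R N) : 'M[Cplx R]_N := set_val U.

Lemma umx_unitary (U : unitary R N) : umx U \is unitarymx.
Proof. exact: (set_valP U). Qed.

Definition Unitary (A : 'M[Cplx R]_N) (hA : A \is unitarymx) : unitary R N :=
  @exist _ _ A (mem_set hA).

Lemma unitarymx1 : (1%:M : 'M[Cplx R]_N) \is unitarymx.
Proof. by apply/unitarymxP; rewrite trmx1 map_mx1 mulmx1. Qed.

Definition unitary1 : unitary R N := Unitary unitarymx1.

Definition unitary_mul (U V : unitary R N) : unitary R N :=
  Unitary (mul_unitarymx (umx_unitary U) (umx_unitary V)).

HB.instance Definition _ := isPointed.Build (unitary R N) unitary1.

End unitary_group.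

(* U(N) with its Borel sigma-algebra. *)
Definition borel_unitary (R : realType) (N : nat) :=
  g_sigma_algebraType (@open (unitary R N)).

(* Normalisation is part of mu being a probability; left invariance then
   determines mu, the group being compact. *)
Definition haar_measure (R : realType) (N : nat)
    (mu : probability (borel_unitary R N) R) : Prop :=
  forall (V : unitary R N) (A : set (borel_unitary R N)), measurable A ->
    mu [set U | A (unitary_mul V U)] = mu A.

Section schwartz.
Context {R : realType} {n : nat}.
Implicit Types (f : 'rV[R]_n -> R) (g : 'rV[R]_n -> R[i]).

(* `|x| on 'rV[R]_n is the max norm, so the seminorms below are the usual ones
   up to equivalence. *)
Definition partials (s : seq 'I_n) f : 'rV[R]_n -> R :=
  foldr (fun i h => 'D_(delta_mx 0 i) h) f s.

Definition smoothR f : Prop := forall s : seq 'I_n,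
  continuous (partials s f) /\
  forall (i : 'I_n) (x : 'rV[R]_n), derivable (partials s f) x (delta_mx 0 i).

Definition schwartzR f : Prop :=
  smoothR f /\
  forall (k : nat) (s : seq 'I_n), exists M : R,
    forall x : 'rV[R]_n, `|x| ^+ k * `|partials s f x| <= M.

Definition smooth g : Prop :=
  smoothR (fun x => complex.Re (g x)) /\ smoothR (fun x => complex.Im (g x)).

Definition schwartz g : Prop :=
  schwartzR (fun x => complex.Re (g x)) /\
  schwartzR (fun x => complex.Im (g x)).

End schwartz.

Definition extend_row (T : Type) (n : nat) (y : 'rV[T]_n) (z : T) :
    'rV[T]_n.+1 :=
  \row_j (if unlift ord_max j is Some i then y 0 i else z).

(* The hyperplane of vectors with zero sum in R^(n+1), parametrised by the
   first n coordinates.  Since the delta function eliminates the last variable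
   with unit Jacobian, delta(xi_1 + ... + xi_(n+1)) dxi is the image of
   Lebesgue measure on R^n under this map. *)
Definition zero_sum (R : realType) (n : nat) (y : 'rV[R]_n) : 'rV[R]_n.+1 :=
  extend_row y (- \sum_i y 0 i).

Definition row_of_tuple (T : Type) (n : nat) (t : n.-tuple T) : 'rV[T]_n :=
  \row_i tnth t i.

Section test_function.
Context {R : realType} {n : nat}.
Implicit Types phi Phi : 'rV[R]_n.+1 -> R[i].

Definition associated Phi phi : Prop :=
  schwartz Phi /\
  forall x : 'rV[R]_n.+1,
    phi x = cintegral (lebesgue_tuple R n) (fun t =>
      let xi := zero_sum (row_of_tuple t) in
      Phi xi * expi (\sum_j xi 0 j * x 0 j)).

Record test_function phi : Prop := {
  test_smooth : smooth phi;
  test_symmetric : forall (s : 'S_n.+1) x, phi (col_perm s x) = phi x;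
  test_invariant : forall x (t : R), phi (x + const_mx t) = phi x;
  test_schwartz : schwartz (fun y : 'rV[R]_n => phi (zero_sum y));
  test_associated : exists Phi, associated Phi phi }.

(* The shift u ranges over Z^n: the last of the n.+1 variables is not shifted. *)
Definition periodize (N : nat) phi (x : 'rV[R]_n.+1) : R[i] :=
  csum (fun u : 'rV[int]_n =>
    phi (N%:R *: (x + map_mx intr (extend_row u 0)))).

End test_function.

(* Some theta such that U has eigenvalues expi (theta 0 j), with multiplicity;
   linear_stat below does not depend on the choice when phi is a test
   function. *)
Definition eigenangles (R : realType) (N : nat) (U : unitary R N) : 'rV[R]_N :=
  xget 0 [set theta : 'rV[R]_N |
    char_poly (umx U) =
      \prod_(j < N) ('X - (expi (theta 0 j) : Cplx R)%:P)].

(* C_n(U, phi), for phi a function of n.+1 variables. *)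
Definition linear_stat (R : realType) (n N : nat) (phi : 'rV[R]_n.+1 -> R[i])
    (U : unitary R N) : R[i] :=
  N%:R^-1 * \sum_(j : {ffun 'I_n.+1 -> 'I_N})
    periodize N phi (\row_i eigenangles U 0 (j i)).

(* Sets of pairs (alpha, beta), alpha < beta, with all entries distinct. *)
Definition pairing (n : nat) (S : {set 'I_n * 'I_n}) : bool :=
  [forall p in S, (p.1 < p.2)%N] &&
  uniq ([seq p.1 | p <- enum S] ++ [seq p.2 | p <- enum S]).

Definition e_pair (R : realType) (n : nat) (p : 'I_n * 'I_n) : 'rV[R]_n :=
  delta_mx 0 p.1 - delta_mx 0 p.2.

Definition pairing_integral (R : realType) (n : nat) (Phi : 'rV[R]_n -> R[i])
    (S : {set 'I_n * 'I_n}) : R[i] :=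
  cintegral (lebesgue_tuple R #|S|) (fun xi =>
    Phi (\sum_(j < #|S|) tnth xi j *: e_pair R (enum_val j)) *
    (\prod_(j < #|S|) `|tnth xi j|)%:C).

(* Main.v *)
Require Import Defs.
From mathcomp Require Import all_boot all_order all_algebra all_fingroup.
From mathcomp Require Import spectral.
From mathcomp Require Import all_classical all_reals all_analysis.
From mathcomp Require Import measurable_realfun complex ring lra zify.

Set Implicit Arguments.
Unset Strict Implicit.
Unset Printing Implicit Defensive.

Import Order.TTheory GRing.Theory Num.Theory.
Import numFieldNormedType.Exports.

Local Open Scope classical_set_scope.
Local Open Scope ring_scope.
Local Open Scope complex_scope.

(** The proof is Fourier expansion, exact Gaussian moments, and a Riemann sum. Everywhere [n.+1] is
    the number of variables.

    Poisson summation turns the periodised test function into a finite trigonometric polynomial,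
    because [Phi] has bounded support: N^-n times the sum, over integer vectors k of zero sum, of
    Phi(k/N) times the character k ([poisson_periodize]). Summed over all tuples of eigenangles,
    each character factors into traces of powers, so the linear statistic is N^-(n+1) times the sum
    over k of Phi(k/N) prod_j tr U^(k_j) ([linear_statE]).

    The support condition gives sum |k_j| < 2N, so the positive k_j add up to at most N. In this
    range the joint moments of the traces of nonzero powers are exactly those of independent complex
    Gaussians ([moment_wick], after Diaconis and Shahshahani). The argument here uses loop
    equations. Haar invariance, applied to infinitesimal left multiplications, gives linear
    relations between moments ([loop_equation]). The Gaussian values obey the same relations
    ([wick_loop]). On sequences whose positive part has sum K, the largest discrepancy D then
    satisfies N D <= (K - 1) D, so it is zero when K <= N.

    Wick's formula writes a Gaussian moment as a sum over perfect matchings of opposite entries,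
    weighted by the |k_i| ([wick_pairing]), and each zero k_j contributes tr 1 = N. Collecting the
    powers of N, the expectation is exactly a finite sum, over pairings S, of the Riemann sum of
    mesh 1/N for the integral attached to S ([expectation_pairings]). The integrands are Lipschitz
    with bounded support, so each Riemann sum is within O(1/N) of its integral ([riemann_pairing]).
    The empty pairing gives Phi(0).

    Poisson summation is proved through Cesaro means. A Cesaro mean of the lattice sum is an
    integral against a product of Fejer kernels, which concentrates on the grid of mesh 1/N
    ([fejer_limit]). This limit and the Riemann sums both follow from one quadrature estimate for
    product weights ([quadrature]). *)

(** * Real and imaginary parts *)

Section complex_parts.
Context {R : realType}.
Implicit Types (z w : R[i]) (x y : R).

Lemma ReD z w : complex.Re (z + w) = complex.Re z + complex.Re w.
Proof. by case: z w => [? ?] [? ?]. Qed.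
Lemma ImD z w : complex.Im (z + w) = complex.Im z + complex.Im w.
Proof. by case: z w => [? ?] [? ?]. Qed.
Lemma ReN z : complex.Re (- z) = - complex.Re z.
Proof. by case: z. Qed.
Lemma ImN z : complex.Im (- z) = - complex.Im z.
Proof. by case: z. Qed.
Lemma ReB z w : complex.Re (z - w) = complex.Re z - complex.Re w.
Proof. by rewrite ReD ReN. Qed.
Lemma ImB z w : complex.Im (z - w) = complex.Im z - complex.Im w.
Proof. by rewrite ImD ImN. Qed.
Lemma ReM z w :
  complex.Re (z * w) = complex.Re z * complex.Re w - complex.Im z * complex.Im w.
Proof. by case: z w => [? ?] [? ?]. Qed.
Lemma ImM z w :
  complex.Im (z * w) = complex.Re z * complex.Im w + complex.Im z * complex.Re w.
Proof. by case: z w => [? ?] [? ?]. Qed.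
Lemma Re_sum (I : Type) (r : seq I) (P : pred I) (F : I -> R[i]) :
  complex.Re (\sum_(i <- r | P i) F i) = \sum_(i <- r | P i) complex.Re (F i).
Proof. by apply: (big_morph _ ReD). Qed.
Lemma Im_sum (I : Type) (r : seq I) (P : pred I) (F : I -> R[i]) :
  complex.Im (\sum_(i <- r | P i) F i) = \sum_(i <- r | P i) complex.Im (F i).
Proof. by apply: (big_morph _ ImD). Qed.

Lemma eq_ReIm z w : complex.Re z = complex.Re w -> complex.Im z = complex.Im w -> z = w.
Proof. by case: z w => [? ?] [? ?] /= -> ->. Qed.

Lemma Re_mulCl x z : complex.Re (x%:C * z) = x * complex.Re z.
Proof. by rewrite ReM /= mul0r subr0. Qed.
Lemma Im_mulCl x z : complex.Im (x%:C * z) = x * complex.Im z.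
Proof. by rewrite ImM /= mul0r addr0. Qed.

Lemma normc_ge_Im z : `|complex.Im z|%:C <= `|z|.
Proof.
rewrite normc_def lecR -sqrtr_sqr; apply: ler_wsqrtr.
by rewrite lerDr sqr_ge0.
Qed.

Lemma normC_le_ReIm z : `|z| <= (`|complex.Re z| + `|complex.Im z|)%:C.
Proof.
rewrite [in leLHS](complexE z) (le_trans (ler_normD _ _))// normrM.
have n1 x : `|x%:C| = (`|x|)%:C :> R[i].
  by rewrite normc_def/= expr0n/= addr0 sqrtr_sqr.
have -> : `|'i%C| = 1 :> R[i] by rewrite normc_def/= expr0n/= expr1n add0r sqrtr1.
by rewrite mul1r !n1 rmorphD.
Qed.

Lemma ge0_complexRe z : 0 <= z -> z = (complex.Re z)%:C.
Proof. by move=> /ger0_Im; case: z => a b /= ->. Qed.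

End complex_parts.

(** * Linearity of the complex integral *)

Section cintegral.
Context d (T : measurableType d) {R : realType}.
Variable mu : {measure set T -> \bar R}.
Implicit Types f g : T -> R[i].

Definition cintegrable f :=
  mu.-integrable setT (EFin \o (fun x => complex.Re (f x))) /\
  mu.-integrable setT (EFin \o (fun x => complex.Im (f x))).

Lemma cintegralE f : cintegral mu f =
  (\int[mu]_x complex.Re (f x)) +i* (\int[mu]_x complex.Im (f x)).
Proof. by []. Qed.

Lemma cintegrableD f g : cintegrable f -> cintegrable g ->
  cintegrable (fun x => f x + g x).
Proof.
move=> [f1 f2] [g1 g2]; split.
- apply: eq_integrable (integrableD measurableT f1 g1) => //= x _.
  by rewrite ReD EFinD.
- apply: eq_integrable (integrableD measurableT f2 g2) => //= x _.
  by rewrite ImD EFinD.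
Qed.

Lemma cintegralD f g : cintegrable f -> cintegrable g ->
  cintegral mu (fun x => f x + g x) = cintegral mu f + cintegral mu g.
Proof.
move=> [f1 f2] [g1 g2]; rewrite !cintegralE.
apply: eq_ReIm => /=.
  by rewrite -(RintegralD measurableT f1 g1); apply: eq_Rintegral => x _; exact: ReD.
by rewrite -(RintegralD measurableT f2 g2); apply: eq_Rintegral => x _; exact: ImD.
Qed.

Lemma cintegrableZ (c : R[i]) f : cintegrable f -> cintegrable (fun x => c * f x).
Proof.
move=> [f1 f2]; split.
- apply: eq_integrable (integrableB measurableT
    (integrableZl measurableT (complex.Re c) f1)
    (integrableZl measurableT (complex.Im c) f2)) => //= x _.
  by rewrite ReM EFinB !EFinM.
- apply: eq_integrable (integrableD measurableT
    (integrableZl measurableT (complex.Re c) f2)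
    (integrableZl measurableT (complex.Im c) f1)) => //= x _.
  by rewrite ImM EFinD !EFinM.
Qed.

Lemma cintegralZ (c : R[i]) f : cintegrable f ->
  cintegral mu (fun x => c * f x) = c * cintegral mu f.
Proof.
move=> [f1 f2]; rewrite !cintegralE; apply: eq_ReIm => /=.
- rewrite ReM /= -(RintegralZl (complex.Re c) measurableT f1).
  rewrite -(RintegralZl (complex.Im c) measurableT f2).
  rewrite -(RintegralB measurableT (integrableZl measurableT (complex.Re c) f1)
    (integrableZl measurableT (complex.Im c) f2)).
  by apply: eq_Rintegral => x _; rewrite ReM.
- rewrite ImM /= -(RintegralZl (complex.Re c) measurableT f2).
  rewrite -(RintegralZl (complex.Im c) measurableT f1).
  rewrite -(RintegralD measurableT (integrableZl measurableT (complex.Re c) f2)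
    (integrableZl measurableT (complex.Im c) f1)).
  by apply: eq_Rintegral => x _; rewrite ImM.
Qed.

Lemma cintegrable0 : cintegrable (fun=> 0).
Proof. by split; exact: integrable0. Qed.

Lemma cintegral0 : cintegral mu (fun=> 0) = 0.
Proof. by rewrite /cintegral/= integral0. Qed.

Lemma cintegrable_sum (I : Type) (r : seq I) (P : pred I) (F : I -> T -> R[i]) :
  (forall i, P i -> cintegrable (F i)) ->
  cintegrable (fun x => \sum_(i <- r | P i) F i x).
Proof.
move=> h; elim: r => [|i r ih].
  rewrite (_ : (fun x => _) = fun=> 0); first exact: cintegrable0.
  by apply/funext => x; rewrite big_nil.
have [Pi|nPi] := boolP (P i); last first.
  by rewrite (_ : (fun x => _) = fun x => \sum_(i <- r | P i) F i x)//;
    apply/funext => x; rewrite big_cons (negbTE nPi).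
rewrite (_ : (fun x => _) = fun x => F i x + \sum_(i <- r | P i) F i x).
  by apply: cintegrableD => //; exact: h.
by apply/funext => x; rewrite big_cons Pi.
Qed.

Lemma cintegral_sum (I : Type) (r : seq I) (P : pred I) (F : I -> T -> R[i]) :
  (forall i, P i -> cintegrable (F i)) ->
  cintegral mu (fun x => \sum_(i <- r | P i) F i x) =
  \sum_(i <- r | P i) cintegral mu (F i).
Proof.
move=> h; elim: r => [|i r ih].
  rewrite (_ : (fun x => _) = fun=> 0) ?cintegral0 ?big_nil//.
  by apply/funext => x; rewrite big_nil.
rewrite big_cons; have [Pi|nPi] := boolP (P i); last first.
  by rewrite -ih; congr cintegral; apply/funext => x; rewrite big_cons (negbTE nPi).
rewrite -ih -(cintegralD (h _ Pi) (cintegrable_sum r h)).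
by congr cintegral; apply/funext => x; rewrite big_cons Pi.
Qed.

Lemma eq_cintegral f g : f =1 g -> cintegral mu f = cintegral mu g.
Proof. by move=> fg; congr cintegral; exact/funext. Qed.

End cintegral.

(** * Measurability and Haar expectation on the unitary group *)

Section unitary_measurability.
Context {R : realType} {N : nat}.
Implicit Types (U V : unitary R N).

Lemma continuous_borel_measurable (g : unitary R N -> R) :
  continuous g -> measurable_fun setT (g : borel_unitary R N -> R).
Proof.
move=> cg; apply: (measurability _ (RGenOInfty.measurableE R)).
move=> _ [_ [x ->] <-]; rewrite setTI.
apply: sub_sigma_algebra; apply: open_comp; last exact: interval_open.
by move=> U _; exact: cg.
Qed.

Lemma continuous_Re : continuous (fun z : Cplx R => complex.Re z).
Proof.
move=> z; apply/(@cvgrPdist_le _ _ _ (nbhs (z : Cplx R)) (nbhs_filter (z : Cplx R))) => e e0.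
apply/(@nbhs_ballP (Cplx R)); exists (e%:C : Cplx R); first by rewrite /= ltcR.
move=> w zw; rewrite -lecR -ReB (le_trans (normc_ge_Re _))//.
exact: ltW.
Qed.

Lemma continuous_Im : continuous (fun z : Cplx R => complex.Im z).
Proof.
move=> z; apply/(@cvgrPdist_le _ _ _ (nbhs (z : Cplx R)) (nbhs_filter (z : Cplx R))) => e e0.
apply/(@nbhs_ballP (Cplx R)); exists (e%:C : Cplx R); first by rewrite /= ltcR.
move=> w zw; rewrite -lecR -ImB (le_trans (normc_ge_Im _))//.
exact: ltW.
Qed.

Lemma umx_continuous : continuous (@umx R N).
Proof. exact: initial_continuous. Qed.

Lemma umx_entry_continuous (a b : 'I_N) : continuous (fun U => umx U a b).
Proof.
move=> U; apply: (@continuous_comp _ _ _ (@umx R N) (fun M : 'M[Cplx R]_N => M a b) U).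
  exact: umx_continuous.
exact: coord_continuous.
Qed.

End unitary_measurability.

Section left_translation.
Context {R : realType} {N : nat}.

Lemma continuous_to_matrix (T : topologicalType) m n (F : T -> 'M[Cplx R]_(m, n)) :
  (forall i j, continuous (fun x => F x i j)) -> continuous F.
Proof.
move=> cF x A [P nP sPA].
have : \forall y \near x, forall i j, P i j (F y i j).
  apply: filter_forall => i; apply: filter_forall => j.
  exact: (cF i j x _ (nP i j)).
by apply: filterS => y Hy; exact: sPA.
Qed.

Lemma mulmx_continuous (V : 'M[Cplx R]_N) : continuous (fun M : 'M[Cplx R]_N => V *m M).
Proof.
apply: continuous_to_matrix => i j.
rewrite (_ : (fun _ => _) = fun M : 'M[Cplx R]_N => \sum_k V i k * M k j); last first.
  by apply/funext => M; rewrite mxE.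
elim: (index_enum _) => [|k r ih].
  rewrite (_ : (fun _ => _) = fun=> 0); last by apply/funext => M; rewrite big_nil.
  exact: cst_continuous.
rewrite (_ : (fun _ => _) = fun M : 'M[Cplx R]_N =>
  V i k * M k j + \sum_(k <- r) V i k * M k j); last first.
  by apply/funext => M; rewrite big_cons.
move=> M; apply: (@cvgD (Cplx R) (Cplx R) _ (nbhs M)); last exact: ih.
apply: (@continuous_comp _ _ _ (fun M : 'M[Cplx R]_N => M k j)
  (fun z : Cplx R => V i k * z)).
  exact: coord_continuous.
exact: mulrl_continuous.
Qed.

Lemma measurable_unitary_mul (V : unitary R N) :
  measurable_fun setT (unitary_mul V : borel_unitary R N -> borel_unitary R N).
Proof.
apply: (@measurability _ _ (borel_unitary R N) (borel_unitary R N) _ _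
  (@open (unitary R N))); first by [].
move=> _ [A oA <-]; rewrite setTI; apply: sub_sigma_algebra.
have [B oB BA] := oA; exists ((fun M => umx V *m M) @^-1` B).
  by apply: open_comp => // M _; exact: mulmx_continuous.
by rewrite -BA.
Qed.

End left_translation.

Section unitary_expectation.
Context {R : realType} {N : nat}.
Implicit Types (f g : unitary R N -> R[i]).

Definition bounded_by (C : R) f := forall U, `|f U| <= C%:C.

(** These functions form an algebra that contains the matrix entries and is stable under left
    translation, so every expectation below exists and is invariant. *)
Definition bmeas f :=
  [/\ measurable_fun setT ((fun U => complex.Re (f U)) : borel_unitary R N -> R),
      measurable_fun setT ((fun U => complex.Im (f U)) : borel_unitary R N -> R) &
      exists C, bounded_by C f].

Lemma bmeas_cst (c : R[i]) : bmeas (fun=> c).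
Proof.
split; [exact: measurable_cst|exact: measurable_cst|].
exists (complex.Re `|c|) => U; rewrite -ge0_complexRe//.
Qed.

Lemma bmeasD f g : bmeas f -> bmeas g -> bmeas (fun U => f U + g U).
Proof.
move=> [f1 f2 [C fC]] [g1 g2 [D gD]]; split.
- by under eq_fun do rewrite ReD; exact: measurable_funD.
- by under eq_fun do rewrite ImD; exact: measurable_funD.
- by exists (C + D) => U; rewrite rmorphD (le_trans (ler_normD _ _))// lerD.
Qed.

Lemma bmeasM f g : bmeas f -> bmeas g -> bmeas (fun U => f U * g U).
Proof.
move=> [f1 f2 [C fC]] [g1 g2 [D gD]]; split.
- by under eq_fun do rewrite ReM; apply: measurable_funB; exact: measurable_funM.
- by under eq_fun do rewrite ImM; apply: measurable_funD; exact: measurable_funM.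
- by exists (C * D) => U; rewrite rmorphM normrM ler_pM.
Qed.

Lemma bmeasZ c f : bmeas f -> bmeas (fun U => c * f U).
Proof. by move=> bf; apply: bmeasM => //; exact: bmeas_cst. Qed.

Lemma bmeas_sum (I : Type) (r : seq I) (P : pred I) (F : I -> unitary R N -> R[i]) :
  (forall i, P i -> bmeas (F i)) -> bmeas (fun U => \sum_(i <- r | P i) F i U).
Proof.
move=> h; elim: r => [|i r ih].
  rewrite (_ : (fun _ => _) = fun=> 0); first exact: bmeas_cst.
  by apply/funext => U; rewrite big_nil.
have [Pi|nPi] := boolP (P i); last first.
  by under eq_fun do rewrite big_cons (negbTE nPi).
by under eq_fun do rewrite big_cons Pi; apply: bmeasD => //; exact: h.
Qed.

(** The rows of a unitary matrix are unit vectors. *)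
Lemma umx_entry_le1 (U : unitary R N) a b : `|(umx U a b : R[i])| <= 1.
Proof.
have /unitarymxP/matrixP/(_ a a) := umx_unitary U.
rewrite !mxE eqxx => h.
rewrite -(@ler_pXn2r _ 2)// ?nnegrE// expr1n.
have -> : (1 : R[i]) = \sum_j `|(umx U a j : R[i])| ^+ 2.
  by rewrite -[LHS]h; apply: eq_bigr => j _; rewrite !mxE sqr_normc.
rewrite (bigD1 b)//= lerDl; apply: sumr_ge0 => j _; exact: exprn_ge0.
Qed.

Lemma bmeas_entry a b : bmeas (fun U => umx U a b).
Proof.
split.
- apply: continuous_borel_measurable => U.
  apply: (@continuous_comp _ (Cplx R) _ (fun U => umx U a b) (fun z : Cplx R => complex.Re z)).
    exact: umx_entry_continuous.
  exact: continuous_Re.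
- apply: continuous_borel_measurable => U.
  apply: (@continuous_comp _ (Cplx R) _ (fun U => umx U a b) (fun z : Cplx R => complex.Im z)).
    exact: umx_entry_continuous.
  exact: continuous_Im.
- by exists 1 => U; exact: umx_entry_le1.
Qed.

Lemma bmeas_conj f : bmeas f -> bmeas (fun U => (f U)^*%C).
Proof.
move=> [f1 f2 [C fC]]; split.
- by under eq_fun => U do have -> : complex.Re ((f U)^*%C) = complex.Re (f U)
    by case: (f U).
- under eq_fun => U do have -> : complex.Im ((f U)^*%C) = - complex.Im (f U)
    by case: (f U).
  exact: measurableT_comp.
- by exists C => U; rewrite normcJ.
Qed.

Lemma bmeas_mul V f : bmeas f -> bmeas (fun U => f (unitary_mul V U)).
Proof.
move=> [f1 f2 [C fC]]; split; last by exists C => U.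
- exact: (measurableT_comp f1 (measurable_unitary_mul V)).
- exact: (measurableT_comp f2 (measurable_unitary_mul V)).
Qed.

Variable mu : probability (borel_unitary R N) R.

Lemma bmeas_real_integrable (h : borel_unitary R N -> R) C :
  measurable_fun setT h -> (forall U, `|h U| <= C) -> mu.-integrable setT (EFin \o h).
Proof.
move=> mh hC; apply: measurable_bounded_integrable => //.
  by rewrite (le_lt_trans (probability_le1 mu measurableT))// ltry.
exists C; split; first exact: num_real.
by move=> x Cx U _ /=; rewrite (le_trans (hC U))// ltW.
Qed.

Lemma bounded_by_Re C f : bounded_by C f -> forall U, `|complex.Re (f U)| <= C.
Proof. by move=> fC U; rewrite -lecR (le_trans (normc_ge_Re _)). Qed.

Lemma bounded_by_Im C f : bounded_by C f -> forall U, `|complex.Im (f U)| <= C.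
Proof. by move=> fC U; rewrite -lecR (le_trans (normc_ge_Im _)). Qed.

Lemma bmeas_cintegrable f : bmeas f -> cintegrable mu f.
Proof.
move=> [f1 f2 [C fC]]; split.
  exact: (bmeas_real_integrable f1 (bounded_by_Re fC)).
exact: (bmeas_real_integrable f2 (bounded_by_Im fC)).
Qed.

Lemma Rintegral_le_bound (h : borel_unitary R N -> R) C :
  measurable_fun setT h -> (forall U, `|h U| <= C) -> `| \int[mu]_x h x | <= C.
Proof.
move=> mh hC; have ih := bmeas_real_integrable mh hC.
have -> : C = \int[mu]_(x in setT) (cst C x).
  rewrite Rintegral_cst// -[LHS]mulr1; congr (_ * _).
  exact/esym/(congr1 fine (@probability_setT _ _ _ mu)).
rewrite (le_trans (le_normr_Rintegral _ ih))//.
apply: le_Rintegral => //.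
- by apply: (@bmeas_real_integrable (fun x => `|h x|) C) => [|U];
    [exact: measurableT_comp|rewrite normr_id].
- exact: finite_measure_integrable_cst.
Qed.

(** The factor 2 comes from bounding the real and imaginary parts separately. *)
Lemma cintegral_bound C f : bmeas f -> bounded_by C f ->
  `|cintegral mu f| <= (2 * C)%:C.
Proof.
move=> [f1 f2 _] fC; rewrite (le_trans (normC_le_ReIm _))// lecR mulrDl !mul1r.
by apply: lerD; apply: Rintegral_le_bound => // U;
  [exact: bounded_by_Re|exact: bounded_by_Im].
Qed.

Hypothesis haar : haar_measure mu.

Lemma Rintegral_haar V (h : borel_unitary R N -> R) C :
  measurable_fun setT h -> (forall U, `|h U| <= C) ->
  \int[mu]_U h (unitary_mul V U) = \int[mu]_U h U.
Proof.
move=> mh hC; congr fine.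
have mV := measurable_unitary_mul V.
transitivity (\int[pushforward mu (unitary_mul V : borel_unitary R N -> borel_unitary R N)]_x (h x)%:E)%E.
  rewrite (@integral_pushforward _ _ _ _ _ _ mV _ setT)//.
    exact/measurable_EFinP.
  rewrite preimage_setT; apply: (@bmeas_real_integrable (h \o unitary_mul V) C) => [|U].
    exact: measurableT_comp.
  exact: hC.
apply: eq_measure_integral.
by move=> A mA _; exact: haar.
Qed.

Lemma cintegral_haar V f : bmeas f ->
  cintegral mu (fun U => f (unitary_mul V U)) = cintegral mu f.
Proof.
move=> [f1 f2 [C fC]]; apply: eq_ReIm => /=.
  exact: (Rintegral_haar V f1 (bounded_by_Re fC)).
exact: (Rintegral_haar V f2 (bounded_by_Im fC)).
Qed.

End unitary_expectation.

(** * First-order expansions along complex reflections *)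

Section first_order_expansion.
Context {R : realType} {n : nat}.
Local Notation C := (Cplx R).
Local Notation M := 'M[Cplx R]_n.+1.
Local Notation UN := (unitary R n.+1).

Variable P : M.
Hypotheses (PP : P *m P = P) (PH : map_mx Num.conj P^T = P).

(* The complex reflection multiplying the range of P by z. *)
Definition reflection_mx (z : C) : M := 1%:M + (z - 1) *: P.

Lemma reflection_unitary z : `|z| = 1 -> reflection_mx z \is unitarymx.
Proof.
move=> z1; apply/unitarymxP; rewrite /reflection_mx.
rewrite [in X in _ *m X]linearD/= [in X in _ *m X]linearZ/= map_mxD map_mxZ/= PH.
rewrite trmx1 map_mx1 mulmxDl mul1mx mulmxDr mulmx1 -scalemxAl -scalemxAr PP.
rewrite -[X in _ = X]addr0 -!addrA; congr (_ + _).
rewrite scalerA -!scalerDl rmorphB rmorph1.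
have zz : z * z^* = 1 by rewrite -normCK z1 expr1n.
rewrite mulrBl mulrBr zz mul1r mulr1 [X in X *: _](_ : _ = 0) ?scale0r//.
by ring.
Qed.

Definition reflection (z : C) : UN :=
  if `|z| =P 1 is ReflectT h then Unitary (reflection_unitary h) else unitary1.

Lemma reflectionE z : `|z| = 1 -> umx (reflection z) = reflection_mx z.
Proof. by rewrite /reflection; case: eqP. Qed.

(** Stands for differentiation on the group: [g] is the derivative of [f] along left multiplication
    by [P], with a remainder that is quadratic in z - 1 uniformly on the unit circle. *)
Definition jet (f g : UN -> C) : Prop :=
  [/\ bmeas f, bmeas g & exists H : C -> UN -> C, exists B : C,
    (forall z U, `|z| = 1 -> `|H z U| <= B) /\
    (forall z U, `|z| = 1 ->
       f (unitary_mul (reflection z) U) = f U + (z - 1) * g U + (z - 1) ^+ 2 * H z U)].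

Lemma jet_cst c : jet (fun=> c) (fun=> 0).
Proof.
split; [exact: bmeas_cst|exact: bmeas_cst|exists (fun _ _ => 0), 0; split => *].
  by rewrite normr0.
by rewrite !mulr0 !addr0.
Qed.

Lemma jetD f g f' g' : jet f g -> jet f' g' ->
  jet (fun U => f U + f' U) (fun U => g U + g' U).
Proof.
move=> [bf bg [H [B [HB fH]]]] [bf' bg' [H' [B' [HB' fH']]]]; split.
- exact: bmeasD.
- exact: bmeasD.
exists (fun z U => H z U + H' z U), (B + B'); split=> z U z1.
  by rewrite (le_trans (ler_normD _ _))// lerD// ?HB ?HB'.
by rewrite fH// fH'//; ring.
Qed.

Lemma jetM f g f' g' : jet f g -> jet f' g' ->
  jet (fun U => f U * f' U) (fun U => g U * f' U + f U * g' U).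
Proof.
move=> [bf bg [H [B [HB fH]]]] [bf' bg' [H' [B' [HB' fH']]]]; split.
- exact: bmeasM.
- by apply: bmeasD; exact: bmeasM.
have [_ _ [c fc]] := bf; have [_ _ [d gd]] := bg.
have [_ _ [c' fc']] := bf'; have [_ _ [d' gd']] := bg'.
(* The terms of the expanded product that contain (z - 1)^2, divided by it. The bound [D] uses |z -
   1| <= 2. *)
exists (fun z U => g U * g' U + H z U * f' U + f U * H' z U +
   (z - 1) * (g U * H' z U + H z U * g' U) + (z - 1) ^+ 2 * (H z U * H' z U)).
pose D : C := d%:C * d'%:C + B * c'%:C + c%:C * B' + 2 * (d%:C * B' + B * d'%:C) +
   2 ^+ 2 * (B * B').
exists D; split=> z U z1; last by rewrite fH// fH'//; ring.
have t2 : `|z - 1| <= 2.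
  by rewrite (le_trans (ler_normB _ _))// z1 normr1.
have hz := HB z U z1; have hz' := HB' z U z1.
have bM (x y a b : C) : `|x| <= a -> `|y| <= b -> `|x * y| <= a * b.
  by move=> xa yb; rewrite normrM ler_pM.
have bD (x y a b : C) : `|x| <= a -> `|y| <= b -> `|x + y| <= a + b.
  by move=> xa yb; rewrite (le_trans (ler_normD _ _))// lerD.
have bX : `|(z - 1) ^+ 2| <= 2 ^+ 2 by rewrite normrX lerXn2r// nnegrE.
have fU := fc U; have fU' := fc' U; have gU := gd U; have gU' := gd' U.
apply: (bD _ _ _ _ _ (bM _ _ _ _ bX (bM _ _ _ _ hz hz'))).
apply: (bD _ _ _ _ _ (bM _ _ _ _ t2
  (bD _ _ _ _ (bM _ _ _ _ gU hz') (bM _ _ _ _ hz gU')))).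
apply: (bD _ _ _ _ _ (bM _ _ _ _ fU hz')).
exact: (bD _ _ _ _ (bM _ _ _ _ gU gU') (bM _ _ _ _ hz fU')).
Qed.

Lemma jet_sum (I : Type) (r : seq I) (Q : pred I) (F G : I -> UN -> C) :
  (forall i, Q i -> jet (F i) (G i)) ->
  jet (fun U => \sum_(i <- r | Q i) F i U) (fun U => \sum_(i <- r | Q i) G i U).
Proof.
move=> h; elim: r => [|i r ih].
  rewrite (_ : (fun U => _) = fun=> 0); last by apply/funext => U; rewrite big_nil.
  rewrite [X in jet _ X](_ : _ = fun=> 0); last by apply/funext => U; rewrite big_nil.
  exact: jet_cst.
have [Qi|nQi] := boolP (Q i).
  under eq_fun do rewrite big_cons Qi.
  under [X in jet _ X]eq_fun do rewrite big_cons Qi.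
  exact: jetD (h _ Qi) ih.
under eq_fun do rewrite big_cons (negbTE nQi).
by under [X in jet _ X]eq_fun do rewrite big_cons (negbTE nQi).
Qed.

Definition mjet (F G : UN -> M) : Prop :=
  forall a b, jet (fun U => F U a b) (fun U => G U a b).

Lemma mjetM F G F' G' : mjet F G -> mjet F' G' ->
  mjet (fun U => F U *m F' U) (fun U => G U *m F' U + F U *m G' U).
Proof.
move=> h h' a b; under eq_fun do rewrite mxE.
under [X in jet _ X]eq_fun do rewrite !mxE -big_split.
apply: (@jet_sum _ _ _ (fun k U => F U a k * F' U k b)) => k _.
exact: jetM (h a k) (h' k b).
Qed.

Lemma mjet_cst A : mjet (fun=> A) (fun=> 0).
Proof.
move=> a b; rewrite (_ : (fun _ => (0 : M) a b) = fun=> 0); first exact: jet_cst.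
by apply/funext => U; rewrite mxE.
Qed.

(** The remainder is zero because the reflection is affine in z. *)
Lemma mjet_umx : mjet (@umx R n.+1) (fun U => P *m umx U).
Proof.
move=> a b; split; first exact: bmeas_entry.
  under eq_fun do rewrite mxE.
  by apply: bmeas_sum => k _; apply: bmeasZ; exact: bmeas_entry.
exists (fun _ _ => 0), 0; split => z U z1; first by rewrite normr0.
have -> : umx (unitary_mul (reflection z) U) = umx U + (z - 1) *: (P *m umx U).
  rewrite -[LHS]/(umx (reflection z) *m umx U) reflectionE// mulmxDl mul1mx.
  by rewrite -scalemxAl.
by rewrite mulr0 addr0 2!mxE.
Qed.

Lemma umx_unit (U : UN) : umx U \is a GRing.unit.
Proof. exact: (unitarymx_unit (umx_unitary U)). Qed.

Lemma umx_inv (U : UN) : (umx U)^-1 = map_mx Num.conj (umx U)^T.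
Proof. exact: (invmx_unitary (umx_unitary U)). Qed.

(** The inverse reflection is 1 + (conj z - 1) P, and on the unit circle conj z - 1 = -(z - 1) + (z
    - 1)^2 conj z. *)
Lemma mjet_inv : mjet (fun U => (umx U)^-1) (fun U => - ((umx U)^-1 *m P)).
Proof.
have bi a b : bmeas (fun U : UN => (umx U)^-1 a b).
  under eq_fun do rewrite umx_inv !mxE.
  exact: (bmeas_conj (bmeas_entry b a)).
have bP a b : bmeas (fun U : UN => ((umx U)^-1 *m P) a b).
  under eq_fun do rewrite mxE.
  by apply: bmeas_sum => k _; apply: bmeasM => //; exact: bmeas_cst.
move=> a b; split => //.
  under eq_fun do rewrite mxE -mulN1r.
  exact: bmeasZ.
have [_ _ [B hB]] := bP a b.
exists (fun z U => z^* * ((umx U)^-1 *m P) a b), B%:C; split => z U z1.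
  by rewrite normrM norm_conjC z1 mul1r; exact: hB.
rewrite umx_inv -[umx _]/(umx (reflection z) *m umx U) trmx_mul map_mxM -umx_inv.
rewrite reflectionE// linearD/= linearZ/= map_mxD map_mxZ/= PH trmx1 map_mx1.
rewrite mulmxDr mulmx1 -scalemxAr !mxE rmorphB rmorph1.
have zz : z * z^* = 1 by rewrite -normCK z1 expr1n.
rewrite -addrA; congr (_ + _); set X := (\sum_ _ _).
have -> : (z - 1) ^+ 2 * (z^* * X) = (z * (z * z^*) - 2 * (z * z^*) + z^*) * X by ring.
by rewrite zz; ring.
Qed.

(* For an exponent k, X |-> dpow X k U is the derivative of U^k in the direction XU. *)
Definition dpow (X : M) (k : int) (U : UN) : M :=
  match k with
  | Posz m => \sum_(j < m) umx U ^+ j * X * umx U ^+ (m - j)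
  | Negz m => - \sum_(j < m.+1) (umx U)^-1 ^+ j.+1 * X * (umx U)^-1 ^+ (m - j)
  end.

Lemma mjet_pow (k : int) : mjet (fun U => umx U ^ k) (dpow P k).
Proof.
case: k => m /=.
  elim: m => [|m ih].
    rewrite [X in mjet _ X](_ : _ = fun=> 0); last by apply/funext => U; rewrite /dpow big_ord0.
    exact: mjet_cst.
  rewrite [X in mjet _ X](_ : _ = fun U =>
      P *m umx U *m (umx U ^+ m) + umx U *m \sum_(j < m) umx U ^+ j * P * umx U ^+ (m - j)).
    rewrite [X in mjet X](_ : _ = fun U => umx U *m umx U ^+ m); last first.
      by apply/funext => U; rewrite -[LHS]/(umx U ^+ m.+1) exprS.
    exact: (mjetM mjet_umx ih).
  apply/funext => U; rewrite /dpow big_ord_recl expr0 mul1r subn0; congr (_ + _).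
    by rewrite exprS mulrA.
  rewrite -[RHS]/(umx U * _) mulr_sumr; apply: eq_bigr => j _.
  by rewrite exprS !mulrA subSS.
have h l : mjet (fun U => (umx U)^-1 ^+ l)
   (fun U => - \sum_(j < l) (umx U)^-1 ^+ j.+1 * P * (umx U)^-1 ^+ (l.-1 - j)).
  elim: l => [|l ih].
    rewrite [X in mjet _ X](_ : _ = fun=> 0).
      exact: mjet_cst.
    by apply/funext => U; rewrite big_ord0 oppr0.
  rewrite [X in mjet X](_ : _ = fun U => (umx U)^-1 *m (umx U)^-1 ^+ l); last first.
    by apply/funext => U; rewrite exprS.
  rewrite [X in mjet _ X](_ : _ = fun U => - ((umx U)^-1 *m P) *m (umx U)^-1 ^+ l +
    (umx U)^-1 *m - \sum_(j < l) (umx U)^-1 ^+ j.+1 * P * (umx U)^-1 ^+ (l.-1 - j)).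
    exact: (mjetM mjet_inv ih).
  apply/funext => U; rewrite big_ord_recl opprD expr1 subn0 mulNmx mulmxN; congr (_ - _).
  rewrite -[RHS]/(_ * _) mulr_sumr; apply: eq_bigr => j _.
  by rewrite [in LHS]exprS !mulrA /= /bump leq0n add1n; case: l j {ih} => [[]//|l j].
rewrite [X in mjet X](_ : _ = fun U => (umx U)^-1 ^+ m.+1); last first.
  by apply/funext => U; rewrite exprVn.
exact: h.
Qed.

End first_order_expansion.

(** * Infinitesimal Haar invariance *)

Section jet_expectation.
Context {R : realType} {n : nat}.
Local Notation C := (Cplx R).
Local Notation UN := (unitary R n.+1).
Variable mu : probability (borel_unitary R n.+1) R.
Hypothesis haar : haar_measure mu.

(** The Cayley transform (1 + is)/(1 - is) has modulus 1 and differs from 1 by 2is/(1 - is). *)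
Lemma small_rotation (s : R) : 0 < s ->
  exists z : R[i], [/\ `|z| = 1, z != 1 & `|z - 1| <= (2 * s)%:C].
Proof.
move=> s0; pose w : R[i] := 1 +i* s; pose v : R[i] := 1 -i* s.
have w0 : 0 < Num.sqrt (1 ^+ 2 + s ^+ 2) :> R.
  by rewrite sqrtr_gt0 expr1n ltr_pwDl// sqr_ge0.
have nv : `|v| = (Num.sqrt (1 ^+ 2 + s ^+ 2))%:C by rewrite normc_def/= sqrrN.
have nw : `|w| = (Num.sqrt (1 ^+ 2 + s ^+ 2))%:C by rewrite normc_def.
have v0 : v != 0 by rewrite -normr_eq0 nv gt_eqF// ltcR.
have e : w / v - 1 = (0 +i* (2 * s)) / v.
  apply: (mulIf v0); rewrite mulrBl !divfK// mul1r.
  by apply: eq_ReIm; rewrite /= ?ReB ?ImB/=; ring.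
exists (w / v); split.
- by rewrite normrM normfV nv nw divff// gt_eqF// ltcR.
- rewrite -subr_eq0 e mulf_neq0 ?invr_eq0//.
  by rewrite eq_complex/= eqxx/= mulf_neq0// gt_eqF.
- have -> : `|w / v - 1| = (2 * s)%:C / (Num.sqrt (1 ^+ 2 + s ^+ 2))%:C.
    rewrite e normrM normfV nv; congr (_ / _).
    by rewrite normc_def/= expr0n/= add0r sqrtr_sqr ger0_norm// mulr_ge0// ltW.
  rewrite ler_pdivrMr ?ltcR// -rmorphM lecR ler_peMr ?mulr_ge0// 1?ltW//.
  by rewrite -{1}sqrtr1 ltr_sqrt expr1n ?ltrDl ?ltr_wpDr ?exprn_gt0// sqr_ge0.
Qed.

(** By invariance the expectation of f is unchanged by the reflection, so (z - 1) E g is minus the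
    expectation of a remainder of size |z - 1|^2. Divide by |z - 1| and let z tend to 1. *)
Lemma jet_expect (P : 'M[Cplx R]_n.+1) (PP : P *m P = P)
  (PH : map_mx Num.conj P^T = P) (f g : UN -> C) : jet PP PH f g -> cintegral mu g = 0.
Proof.
move=> [bf bg [H [B [HB fH]]]].
have B0 : 0 <= B by rewrite (le_trans _ (HB 1 unitary1 (normr1 _))).
have BE := ge0_complexRe B0; set b := complex.Re B in BE.
have b0 : 0 <= b by rewrite -lecR -BE.
set e := cintegral mu g.
have key s : 0 < s -> `|e| <= (4 * s * b)%:C.
  move=> s0; have [z [z1 zn1 zs]] := small_rotation s0.
  have t0 : 0 < `|z - 1| by rewrite normr_gt0 subr_eq0.
  (* This is (z - 1)^2 H, written through [f] and [g] so that its measurability is visible. *)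
  pose h U := f (unitary_mul (reflection PP PH z) U) + (- 1 * f U + - (z - 1) * g U).
  have bh : bmeas h.
    apply: bmeasD; first exact: bmeas_mul.
    by apply: bmeasD; exact: bmeasZ.
  have Eh : cintegral mu h = - (z - 1) * e.
    rewrite /h cintegralD; last 2 first.
    - by apply: bmeas_cintegrable; exact: bmeas_mul.
    - by apply: bmeas_cintegrable; apply: bmeasD; exact: bmeasZ.
    rewrite cintegral_haar// cintegralD; last 2 first.
    - by apply: bmeas_cintegrable; exact: bmeasZ.
    - by apply: bmeas_cintegrable; exact: bmeasZ.
    rewrite !cintegralZ; last 2 first.
    - exact: bmeas_cintegrable.
    - exact: bmeas_cintegrable.
    by rewrite mulN1r addrA subrr add0r.
  have tE := ge0_complexRe (ltW t0); set t := complex.Re _ in tE.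
  have tBE : (t ^+ 2 * b)%:C = `|z - 1| ^+ 2 * B.
    by rewrite tE BE rmorphM rmorphXn.
  have hb : bounded_by (t ^+ 2 * b) h.
    move=> U; rewrite /h fH// tBE (_ : _ + _ = (z - 1) ^+ 2 * H z U); last by ring.
    by rewrite normrM normrX ler_wpM2l ?exprn_ge0// HB.
  have := cintegral_bound mu bh hb.
  have -> : (2 * (t ^+ 2 * b))%:C = `|z - 1| * (2 * `|z - 1| * B).
    by rewrite rmorphM/= tBE rmorph_nat; ring.
  rewrite Eh normrM normrN.
  rewrite ler_pM2l// => /le_trans; apply.
  have -> : (4 * s * b)%:C = 2 * (2 * s)%:C * B.
    by rewrite BE !rmorphM !rmorph_nat; ring.
  by rewrite ler_wpM2r// ler_wpM2l.
have eE := ge0_complexRe (normr_ge0 e); set r := complex.Re _ in eE.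
suff r0 : r = 0 by apply/eqP; rewrite -normr_eq0 eE r0.
have r0 : 0 <= r by have := normr_ge0 e; rewrite eE ler0c.
apply/eqP; rewrite eq_le r0 andbT; apply/ler_addgt0Pr => x x0; rewrite add0r.
have d0 : 0 < 4 * (b + 1) by rewrite mulr_gt0// ltr_wpDl.
have := key (x / (4 * (b + 1))) (divr_gt0 x0 d0); rewrite eE lecR => /le_trans; apply.
have y0 := divr_gt0 x0 d0; rewrite -[leRHS](divfK (lt0r_neq0 d0) x).
by move: y0; set y := x / _ => y0; nra.
Qed.

End jet_expectation.

(** * Loop equations for moments of power traces *)

Section loop_equation.
Context {R : realType} {n : nat}.
Local Notation C := (Cplx R).
Local Notation M := 'M[Cplx R]_n.+1.
Local Notation UN := (unitary R n.+1).
Implicit Types (s : seq int) (k : int) (X Y : M).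

Definition power_trace k (U : UN) : C := \tr (umx U ^ k).

Definition trace_monomial s (U : UN) : C := \prod_(x <- s) power_trace x U.

(** The Leibniz rule for the derivative of [trace_monomial s] in the direction XU; [rem] deletes the
    differentiated factor. *)
Definition d_trace_monomial X s (U : UN) : C :=
  \sum_(x <- s) x%:~R * \tr (X *m umx U ^ x) * trace_monomial (rem x s) U.

(** Cyclicity of the trace makes all summands of [dpow] contribute equally. *)
Lemma trace_dpow X k U : \tr (dpow X k U) = k%:~R * \tr (X *m umx U ^ k).
Proof.
have tr3 (A B : M) : \tr (A * X * B) = \tr (X *m (B * A)).
  by rewrite mxtrace_mulC -[B *m _]/(B * (A * X)) mulrA mxtrace_mulC.
have trD (A : M) i j : \tr (A ^+ i * X * A ^+ j) = \tr (X *m A ^+ (j + i)).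
  by rewrite tr3 exprD.
case: k => m; rewrite /dpow.
  rewrite raddf_sum/= (eq_bigr (fun=> \tr (X *m umx U ^+ m))) => [|j _].
    by rewrite sumr_const card_ord -mulr_natl.
  by rewrite trD subnK// ltnW.
have trN (A : M) : \tr (- A) = - \tr A by rewrite -scaleN1r mxtraceZ mulN1r.
have trS l (F : 'I_l -> M) : \tr (\sum_j F j) = \sum_j \tr (F j).
  by rewrite (big_morph _ (@mxtraceD _ _) (@mxtrace0 _ _)).
apply: etrans (trN _) _; apply: etrans (congr1 -%R (trS _ _)) _.
rewrite (eq_bigr (fun=> \tr (X *m umx U ^ Negz m))) => [|j _].
  by rewrite sumr_const card_ord -mulr_natl -mulNr.
have := trD (umx U)^-1 j.+1 (m - j)%N; rewrite addnS subnK -1?ltnS// => ->.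
by rewrite exprVn.
Qed.

Lemma perm_trace_monomial s s' U : perm_eq s s' -> trace_monomial s U = trace_monomial s' U.
Proof. by move=> ss'; apply: perm_big. Qed.

Section projection.
Variable P : M.
Hypotheses (PP : P *m P = P) (PH : map_mx Num.conj P^T = P).

Lemma jet_power_trace k :
  jet PP PH (power_trace k) (fun U => k%:~R * \tr (P *m umx U ^ k)).
Proof.
rewrite [X in jet _ _ _ X](_ : _ = fun U => \tr (dpow P k U)); last first.
  by apply/funext => U; rewrite trace_dpow.
apply: (@jet_sum _ _ _ PP PH _ _ _ (fun i U => (umx U ^ k) i i)) => i _.
exact: mjet_pow.
Qed.

Lemma jet_trace_monomial s : jet PP PH (trace_monomial s) (d_trace_monomial P s).
Proof.
elim: s => [|y s ih].
  rewrite (_ : trace_monomial _ = fun=> 1); last first.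
    by apply/funext => U; rewrite /trace_monomial big_nil.
  rewrite (_ : d_trace_monomial _ _ = fun=> 0); first exact: jet_cst.
  by apply/funext => U; rewrite /d_trace_monomial big_nil.
rewrite (_ : trace_monomial _ = fun U => power_trace y U * trace_monomial s U); last first.
  by apply/funext => U; rewrite /trace_monomial big_cons.
rewrite (_ : d_trace_monomial _ _ = fun U =>
    y%:~R * \tr (P *m umx U ^ y) * trace_monomial s U + power_trace y U * d_trace_monomial P s U).
  exact: jetM (jet_power_trace y) ih.
apply/funext => U; rewrite /d_trace_monomial big_cons /= eqxx; congr (_ + _).
rewrite mulr_sumr; apply: eq_big_seq => x xs.
rewrite [RHS]mulrCA /=; congr (_ * _).
have [yx|yx] := eqVneq y x; first subst y.
  by rewrite ?eqxx (perm_trace_monomial U (perm_to_rem xs)) /trace_monomial big_cons.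
by rewrite ?(negbTE yx) /trace_monomial big_cons.
Qed.

End projection.

(** A jet along the projection 0 still records that its function is bounded and measurable, which is
    how the facts below are read off. *)
Let zero_idem : (0 : M) *m (0 : M) = 0. Proof. exact: mul0mx. Qed.
Let zero_herm : map_mx Num.conj (0 : M)^T = 0.
Proof. by rewrite trmx0 map_mx0. Qed.

Lemma bmeas_pow k a b : bmeas (fun U : UN => (umx U ^ k) a b).
Proof. by have [] := mjet_pow zero_idem zero_herm k a b. Qed.

Lemma bmeas_trace_monomial s : bmeas (trace_monomial s).
Proof. by have [] := jet_trace_monomial zero_idem zero_herm s. Qed.

Lemma bmeas_trace_mul X k : bmeas (fun U : UN => \tr (X *m umx U ^ k)).
Proof.
rewrite (_ : (fun U => _) = fun U => \sum_i \sum_j X i j * (umx U ^ k) j i).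
  apply: bmeas_sum => i _; apply: bmeas_sum => j _; apply: bmeasZ; exact: bmeas_pow.
by apply/funext => U; apply: eq_bigr => i _; rewrite mxE.
Qed.

Lemma bmeas_d_trace_monomial X s : bmeas (d_trace_monomial X s).
Proof.
apply: bmeas_sum => x _; apply: bmeasM; last exact: bmeas_trace_monomial.
by apply: bmeasZ; exact: bmeas_trace_mul.
Qed.

Lemma bmeas_dpow X (m : nat) a b : bmeas (fun U => dpow X m U a b).
Proof.
have bX j a' b' : bmeas (fun U : UN => (umx U ^+ j * X) a' b').
  under eq_fun do rewrite mxE.
  apply: bmeas_sum => i _; apply: bmeasM; last exact: bmeas_cst.
  exact: (bmeas_pow j).
under eq_fun do rewrite summxE.
apply: bmeas_sum => j _; under eq_fun do rewrite mxE.
apply: bmeas_sum => i _; apply: bmeasM; [exact: bX|exact: (bmeas_pow (m - j)%N)].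
Qed.

(** The derivative in the direction XU of the (a, b) entry of U^m times the trace monomial. It is
    complex linear in X, which allows the passage from projections to arbitrary matrices. *)
Definition loop_integrand X (m : nat) a b s (U : UN) : C :=
  dpow X m U a b * trace_monomial s U + (umx U ^+ m) a b * d_trace_monomial X s U.

Lemma bmeas_loop_integrand X m a b s : bmeas (loop_integrand X m a b s).
Proof.
apply: bmeasD; apply: bmeasM.
- exact: bmeas_dpow.
- exact: bmeas_trace_monomial.
- exact: (bmeas_pow m).
- exact: bmeas_d_trace_monomial.
Qed.

Lemma loop_integrandD (c : C) X Y m a b s U :
  loop_integrand (c *: X + Y) m a b s U =
  c * loop_integrand X m a b s U + loop_integrand Y m a b s U.
Proof.
have d1 : dpow (c *: X + Y) m U = c *: dpow X m U + dpow Y m U.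
  rewrite /dpow scaler_sumr -big_split; apply: eq_bigr => j _ /=.
  by rewrite mulrDr mulrDl -scalerAr -scalerAl.
have d2 : d_trace_monomial (c *: X + Y) s U =
    c * d_trace_monomial X s U + d_trace_monomial Y s U.
  rewrite /d_trace_monomial mulr_sumr -big_split; apply: eq_bigr => x _ /=.
  by rewrite mulmxDl -scalemxAl mxtraceD mxtraceZ; ring.
by rewrite /loop_integrand d1 d2 !mxE; ring.
Qed.

Variable mu : probability (borel_unitary R n.+1) R.
Hypothesis haar : haar_measure mu.

Definition moment s : C := cintegral mu (trace_monomial s).

Lemma loop_integrand_lin m a b s (c : C) X Y :
  cintegral mu (loop_integrand X m a b s) = 0 ->
  cintegral mu (loop_integrand Y m a b s) = 0 ->
  cintegral mu (loop_integrand (c *: X + Y) m a b s) = 0.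
Proof.
move=> X0 Y0; rewrite (_ : loop_integrand _ _ _ _ _ = fun U =>
  c * loop_integrand X m a b s U + loop_integrand Y m a b s U); last first.
  by apply/funext => U; rewrite loop_integrandD.
rewrite cintegralD.
- by rewrite cintegralZ ?X0 ?Y0 ?mulr0 ?addr0//; apply: bmeas_cintegrable; exact: bmeas_loop_integrand.
- by apply: bmeas_cintegrable; apply: bmeasZ; exact: bmeas_loop_integrand.
- by apply: bmeas_cintegrable; exact: bmeas_loop_integrand.
Qed.

Lemma loop_integrand_proj m a b s (P : M) : P *m P = P -> map_mx Num.conj P^T = P ->
  cintegral mu (loop_integrand P m a b s) = 0.
Proof.
move=> PP PH; apply: (jet_expect haar (PP := PP) (PH := PH)
  (f := fun U => (umx U ^ m) a b * trace_monomial s U)).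
exact: jetM (mjet_pow PP PH m a b) (jet_trace_monomial PP PH s).
Qed.

(** For c != d and |w| = 1, the orthogonal projection onto the line of e_c + w e_d. *)
Definition pair_projection (c d : 'I_n.+1) (w : C) : M :=
  2^-1 *: ((delta_mx c 0 + w *: delta_mx d 0 : 'cV_n.+1) *m
           (delta_mx 0 c + w^* *: delta_mx 0 d : 'rV_n.+1)).

Lemma pair_projectionE c d w : w * w^* = 1 ->
  pair_projection c d w = 2^-1 *: (delta_mx c c + w^* *: delta_mx c d +
    w *: delta_mx d c + delta_mx d d).
Proof.
move=> ww; rewrite /pair_projection mulmxDl !mulmxDr -!scalemxAl -!scalemxAr.
by rewrite !mul_delta_mx scalerA ww scale1r !addrA.
Qed.

Lemma pair_projection_idem c d w : c != d -> w * w^* = 1 ->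
  pair_projection c d w *m pair_projection c d w = pair_projection c d w.
Proof.
move=> cd ww; rewrite /pair_projection -scalemxAl -scalemxAr; congr (_ *: _).
pose u : 'cV[C]_n.+1 := delta_mx c 0 + w *: delta_mx d 0.
pose t : 'rV[C]_n.+1 := delta_mx 0 c + w^* *: delta_mx 0 d.
rewrite -/u -/t.
have tu : t *m u = 2%:M.
  rewrite /t /u mulmxDl !mulmxDr -!scalemxAl -!scalemxAr !mul_delta_mx_cond.
  rewrite !eqxx (negbTE cd) eq_sym (negbTE cd) !mulr0n !scaler0 addr0 add0r.
  rewrite scalerA [X in X *: _](_ : _ = 1) ?scale1r; last by rewrite mulrC.
  apply/matrixP => i j; rewrite !mxE !ord1 !eqxx; ring.
by rewrite mulmxA -(mulmxA u) tu mul_mx_scalar -scalemxAl scalerA mulVf ?scale1r.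
Qed.

Lemma pair_projection_herm c d w :
  map_mx Num.conj (pair_projection c d w)^T = pair_projection c d w.
Proof.
rewrite /pair_projection linearZ/= map_mxZ fmorphV/= rmorph_nat; congr (_ *: _).
rewrite trmx_mul map_mxM; congr (_ *m _).
  by rewrite linearD/= linearZ/= map_mxD map_mxZ/= !trmx_delta !map_delta_mx conjCK.
by rewrite linearD/= linearZ/= map_mxD map_mxZ/= !trmx_delta !map_delta_mx.
Qed.

(** Orthogonal projections of rank one span all matrices over the complex numbers, and for each of
    them the expectation vanishes by invariance. *)
Lemma loop_integrand_delta m a b s (c d : 'I_n.+1) :
  cintegral mu (loop_integrand (delta_mx c d) m a b s) = 0.
Proof.
have diag i : cintegral mu (loop_integrand (delta_mx i i) m a b s) = 0.
  apply: loop_integrand_proj; first by rewrite mul_delta_mx.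
  by rewrite trmx_delta map_delta_mx.
have [->//|cd] := eqVneq c d.
have Q w : w * w^* = 1 ->
    cintegral mu (loop_integrand (pair_projection c d w) m a b s) = 0.
  move=> ww; apply: loop_integrand_proj; first exact: pair_projection_idem.
  exact: pair_projection_herm.
have ii : 'i * 'i^* = 1 :> C by rewrite conjCi mulrN -expr2 sqrCi opprK.
have one1 : 1 * 1^* = 1 :> C by rewrite rmorph1 mulr1.
(* Polarisation: in i P_i + P_1 the (d, c) terms cancel, the (c, d) terms add up to 1, and the
   diagonal terms (1 + i)/2 are removed. *)
have -> : delta_mx c d = 'i *: pair_projection c d 'i + (- ((1 + 'i) / 2) *: delta_mx c c +
    (- ((1 + 'i) / 2) *: delta_mx d d + pair_projection c d 1)) :> M.
  rewrite !pair_projectionE// conjCi rmorph1.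
  apply/matrixP => i j.
  have addE (A B : M) : (A + B) i j = A i j + B i j by rewrite mxE.
  have sclE x (A : M) : (x *: A) i j = x * A i j by rewrite mxE.
  rewrite !(addE, sclE).
  move: (delta_mx c c i j) (delta_mx c d i j) (delta_mx d c i j) (delta_mx d d i j).
  move=> p q r t; have i2 : 'i * 'i = -1 :> C by rewrite -expr2 sqrCi.
  have -> : 'i * (2^-1 * (p + - 'i * q + 'i * r + t)) =
    2^-1 * ('i * p + - ('i * 'i) * q + ('i * 'i) * r + 'i * t) :> C by ring.
  by rewrite i2; field.
exact: (loop_integrand_lin _ (Q _ ii) (loop_integrand_lin _ (diag c)
  (loop_integrand_lin _ (diag d) (Q _ one1)))).
Qed.

(** Choosing X to be the (a, b) matrix unit and summing over a and b closes the open indices. The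
    derivative of U^m splits it into two traces; the derivative of a trace merges it with U^m. *)
Lemma sum_loop_integrand (m : nat) s U :
  \sum_a \sum_b loop_integrand (delta_mx a b) m a b s U =
  \sum_(j < m) trace_monomial [:: j%:Z, (m - j)%N%:Z & s] U +
  \sum_(x <- s) x%:~R * trace_monomial ((m%:Z + x) :: rem x s) U.
Proof.
have dE (A B : M) a b c d : (A * delta_mx a b * B) c d = A c a * B b d.
  rewrite -[_ * _ * _]/(A *m delta_mx a b *m B) mxE (bigD1 b)//= big1 ?addr0.
    rewrite mxE (bigD1 a)//= big1 ?addr0 => [|i ia].
      by rewrite mxE !eqxx mulr1.
    by rewrite mxE (negbTE ia) mulr0.
  move=> i ib; rewrite mxE big1 ?mul0r// => l _.
  by rewrite mxE (negbTE ib) andbF mulr0.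
rewrite /loop_integrand; under eq_bigr do rewrite big_split/=.
rewrite big_split/=; congr (_ + _).
  under eq_bigr do under eq_bigr do rewrite /dpow summxE mulr_suml.
  under eq_bigr do rewrite exchange_big/=.
  rewrite exchange_big/=; apply: eq_bigr => j _.
  under eq_bigr do under eq_bigr do rewrite dE.
  rewrite /trace_monomial !big_cons mulrA; under eq_bigr do rewrite -mulr_suml.
  rewrite -mulr_suml; congr (_ * _).
  rewrite /power_trace /mxtrace mulr_suml; apply: eq_bigr => a _.
  by rewrite mulr_sumr.
rewrite /d_trace_monomial.
under eq_bigr do under eq_bigr do rewrite mulr_sumr.
under eq_bigr do rewrite exchange_big/=.
rewrite exchange_big/=; apply: eq_bigr => x _.
rewrite /trace_monomial big_cons mulrA.
under eq_bigr do under eq_bigr do rewrite mulrA.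
under eq_bigr do rewrite -mulr_suml.
rewrite -mulr_suml; congr (_ * _).
under eq_bigr do under eq_bigr do rewrite mulrCA.
under eq_bigr do rewrite -mulr_sumr.
rewrite -mulr_sumr; congr (_ * _).
rewrite /power_trace exprzDr ?umx_unit//; apply: eq_bigr => a _.
rewrite mxE; apply: eq_bigr => b _; congr (_ * _).
rewrite /mxtrace (bigD1 a)//= big1 ?addr0 => [|i ia].
  rewrite mxE (bigD1 b)//= big1 ?addr0 => [|i ib].
    by rewrite mxE !eqxx mul1r.
  by rewrite mxE (negbTE ib) andbF mul0r.
by rewrite mxE big1// => l _; rewrite mxE (negbTE ia) mul0r.
Qed.

(** For m > 0 the splitting j = 0 contains tr 1 = N, so this expresses N times the moment of m :: s
    through other moments. *)
Lemma loop_equation (m : nat) s :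
  \sum_(j < m) moment [:: j%:Z, (m - j)%N%:Z & s] +
  \sum_(x <- s) x%:~R * moment ((m%:Z + x) :: rem x s) = 0.
Proof.
have bt t : cintegrable mu (trace_monomial t).
  by apply: bmeas_cintegrable; exact: bmeas_trace_monomial.
under [X in _ + X]eq_bigr do rewrite -cintegralZ//.
rewrite -cintegral_sum// -cintegral_sum => [|x _]; last exact: cintegrableZ.
rewrite -cintegralD; last 2 first.
- exact: cintegrable_sum.
- by apply: cintegrable_sum => x _; exact: cintegrableZ.
under eq_cintegral do rewrite -sum_loop_integrand.
have bl a b : cintegrable mu (loop_integrand (delta_mx a b) m a b s).
  by apply: bmeas_cintegrable; exact: bmeas_loop_integrand.
rewrite cintegral_sum => [|a _]; last exact: cintegrable_sum.
rewrite big1// => a _; rewrite cintegral_sum// big1// => b _.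
exact: loop_integrand_delta.
Qed.

Lemma pow_unitary k (U : UN) : umx U ^ k \is unitarymx.
Proof.
have h (A : M) m : A \is unitarymx -> A ^+ m \is unitarymx.
  move=> uA; elim: m => [|m ih]; first by rewrite expr0; exact: unitarymx1.
  by rewrite exprS; exact: mul_unitarymx.
case: k => m; first exact: h (umx_unitary U).
rewrite (_ : umx U ^ Negz m = (umx U)^-1 ^+ m.+1); last by rewrite exprVn.
by apply: h; rewrite umx_inv trmxC_unitary umx_unitary.
Qed.

Lemma power_trace_le k (U : UN) : `|power_trace k U| <= n.+1%:R.
Proof.
rewrite (le_trans (ler_norm_sum _ _ _))//.
rewrite (le_trans (ler_sum _ (fun i _ => umx_entry_le1 (Unitary (pow_unitary k U)) i i)))//.
by rewrite sumr_const card_ord.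
Qed.

Lemma trace_monomial_le s (U : UN) : `|trace_monomial s U| <= n.+1%:R ^+ size s.
Proof.
elim: s => [|x s ih]; rewrite /trace_monomial ?big_nil ?normr1//= big_cons.
by rewrite normrM exprS ler_pM// power_trace_le.
Qed.

Lemma perm_moment s s' : perm_eq s s' -> moment s = moment s'.
Proof. by move=> ss'; apply: eq_cintegral => U; exact: perm_trace_monomial. Qed.

Lemma moment_nil : moment [::] = 1.
Proof.
rewrite /moment (_ : trace_monomial _ = cst 1); last first.
  by apply/funext => U; rewrite /trace_monomial big_nil.
have P1 : fine (mu setT) = 1 by rewrite (@probability_setT _ _ _ mu).
rewrite cintegralE; apply: eq_ReIm => /=.
  by rewrite Rintegral_cst// P1 mulr1.
by rewrite Rintegral_cst// mul0r.
Qed.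

Lemma moment_0 s : moment (0 :: s) = n.+1%:R * moment s.
Proof.
rewrite /moment -cintegralZ; last first.
  by apply: bmeas_cintegrable; exact: bmeas_trace_monomial.
apply: eq_cintegral => U; rewrite /trace_monomial big_cons; congr (_ * _).
by rewrite /power_trace expr0z mxtrace1.
Qed.

Lemma moment_le s : `|moment s| <= 2 * n.+1%:R ^+ size s.
Proof.
have : bounded_by (n.+1%:R ^+ size s : R) (trace_monomial s).
  by move=> U; rewrite rmorphXn/= rmorph_nat trace_monomial_le.
move=> /(cintegral_bound mu (bmeas_trace_monomial s)).
by rewrite rmorphM rmorph_nat rmorphXn/= rmorph_nat.
Qed.

End loop_equation.

(** * Gaussian moments and their loop equations *)

Section wick.
Implicit Types (s t : seq int) (x y : int).

(* The Gaussian (Wick) value of the moment of power sums: independent complex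
   Gaussians Z_a with E|Z_a|^2 = a, where Z_(-a) is the conjugate of Z_a. *)
Definition wick_factor s (a : nat) : nat :=
  if count_mem a%:Z s == count_mem (- a%:Z) s
  then (a ^ count_mem a%:Z s * (count_mem a%:Z s)`!)%N else 0%N.

(** Only entries of absolute value between 1 and [A] are seen, so [A] has to dominate the entries of
    [s]. *)
Definition wick (A : nat) s : nat := (\prod_(a < A) wick_factor s a.+1)%N.

Lemma perm_wick A s t : perm_eq s t -> wick A s = wick A t.
Proof.
move=> st; apply: eq_bigr => a _; rewrite /wick_factor.
by have /seq.permP e := st; rewrite !e.
Qed.

Lemma count_memN s x : count_mem x (map -%R s) = count_mem (- x) s.
Proof. by rewrite count_map; apply: eq_count => y /=; rewrite eqr_oppLR. Qed.

Lemma wickN A s : wick A (map -%R s) = wick A s.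
Proof.
apply: eq_bigr => a _; rewrite /wick_factor !count_memN opprK eq_sym.
by case: eqP => // ->.
Qed.

Lemma count_mem_cons x y s : count_mem y (x :: s) = ((x == y) + count_mem y s)%N.
Proof. by []. Qed.

(** Gaussian integration by parts: Z_k is contracted with one of the copies of Z_(-k), with
    covariance k. *)
Lemma wick_cons A (k : nat) s : (0 < k <= A)%N ->
  wick A (k%:Z :: s) = (k * count_mem (- k%:Z) s * wick A (rem (- k%:Z) s))%N.
Proof.
case: k => // k /= kA.
have [ks|ks] := boolP (- k.+1%:Z \in s); last first.
  rewrite (count_memPn ks) muln0 mul0n /wick (bigD1 (Ordinal kA))//=.
  rewrite /wick_factor.
  have -> : count_mem (- k.+1%:Z) (k.+1%:Z :: s) = 0%N.
    by apply/count_memPn; rewrite inE negb_or ks andbT; lia.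
  by rewrite /= eqxx.
have st := perm_to_rem ks; set s' := rem _ s in st *.
rewrite (@perm_wick A (k.+1%:Z :: s) [:: k.+1%:Z, - k.+1%:Z & s']); last first.
  by rewrite perm_cons.
have /seq.permP -> := st; rewrite count_mem_cons eqxx add1n.
rewrite /wick (bigD1 (Ordinal kA))//= [in RHS](bigD1 (Ordinal kA))//= mulnA.
congr muln; last first.
  apply: eq_bigr => a ak; rewrite /wick_factor !count_mem_cons.
  have /negbTE ne1 : k.+1%:Z != a.+1%:Z.
    by apply: contra ak => /eqP[ka]; apply/eqP/val_inj => /=.
  have ne2 : (- k.+1%:Z == a.+1%:Z) = false by lia.
  have ne3 : (k.+1%:Z == - a.+1%:Z) = false by lia.
  have ne4 : (- k.+1%:Z == - a.+1%:Z) = false by rewrite eqr_opp.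
  by rewrite ne1 ne2 ne3 ne4.
rewrite /wick_factor !count_mem_cons !eqxx.
have ne2 : (- k.+1%:Z == k.+1%:Z) = false by lia.
have ne3 : (k.+1%:Z == - k.+1%:Z) = false by lia.
rewrite ne2 ne3 !add0n !add1n eqSS; case: eqP => [e|]; last by rewrite muln0.
by rewrite -e expnS factS; ring.
Qed.

Variable K : comNzRingType.

Lemma sum_mem_rem (F : seq int -> K) s x :
  \sum_(y <- s | y == x) F (rem y s) = (count_mem x s)%:R * F (rem x s).
Proof.
rewrite (eq_bigr (fun=> F (rem x s))) => [|y /eqP->//].
by rewrite big_const_seq iter_addr_0 mulr_natl.
Qed.

Definition wickr A s : K := (wick A s)%:R.

Lemma wickr_pos A (k : nat) s : (0 < k <= A)%N ->
  wickr A (k%:Z :: s) = k%:R * \sum_(y <- s | y == - k%:Z) wickr A (rem y s).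
Proof.
by move=> kA; rewrite (sum_mem_rem (wickr A)) /wickr wick_cons// !natrM mulrA.
Qed.

Lemma map_rem_opp s x : map -%R (rem x s) = rem (- x) (map -%R s).
Proof. by elim: s => //= y s ih; rewrite eqr_opp; case: eqP => //= _; rewrite ih. Qed.

Lemma wickr_neg A (k : nat) s : (0 < k <= A)%N ->
  wickr A (- k%:Z :: s) = k%:R * \sum_(y <- s | y == k%:Z) wickr A (rem y s).
Proof.
move=> kA; rewrite (sum_mem_rem (wickr A)) /wickr -wickN /= opprK wick_cons//.
by rewrite count_memN opprK -map_rem_opp wickN !natrM mulrA.
Qed.

Lemma rem_rem s x y : rem x (rem y s) = rem y (rem x s).
Proof.
have [->//|xy] := eqVneq x y.
elim: s => //= z s ih; have [zy|zy] := eqVneq z y; have [zx|zx] := eqVneq z x => /=.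
- by rewrite -zy -zx eqxx in xy.
- by rewrite zy eqxx.
- by rewrite zx eqxx.
- by rewrite (negbTE zy) (negbTE zx) ih.
Qed.

(** Both sides run over ordered pairs of distinct positions: the full double sum minus the
    diagonal. *)
Lemma exchange_rem (F : int -> int -> K) s :
  \sum_(x <- s) \sum_(y <- rem x s) F x y = \sum_(y <- s) \sum_(x <- rem y s) F x y.
Proof.
have h (G : int -> int -> K) : \sum_(x <- s) \sum_(y <- rem x s) G x y =
    \sum_(x <- s) \sum_(y <- s) G x y - \sum_(x <- s) G x x.
  rewrite -sumrB; apply: eq_big_seq => x xs.
  by rewrite [in RHS](big_rem x)//= addrAC subrr add0r.
by rewrite h (h (fun y x => F x y)) exchange_big.
Qed.

(* The Wick value solves the loop equations with the terms of index 0 removed: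
   the terms with -k < x < 0 cancel the splittings of k, and those with x > 0
   cancel those with x < -k. *)
Lemma wick_loop A (k : nat) s : (0 < k <= A)%N -> 0 \notin s ->
  (forall x, x \in s -> 0 < x -> x + k%:Z <= A%:Z) ->
  (forall x, x \in s -> x < - k%:Z -> - (k%:Z + x) <= A%:Z) ->
  \sum_(1 <= j < k) wickr A [:: j%:Z, (k - j)%N%:Z & s] +
  \sum_(x <- s | x != - k%:Z) x%:~R * wickr A ((k%:Z + x) :: rem x s) = 0.
Proof.
move=> /andP[k0 kA] s0 Apos Aneg.
(* Contracting the part j with an entry y = -j leaves k - j = k + y, which is what merging y with k
   produces. *)
have split1 : \sum_(1 <= j < k) wickr A [:: j%:Z, (k - j)%N%:Z & s] =
    \sum_(y <- s | (- k%:Z < y) && (y < 0)) - y%:~R * wickr A ((k%:Z + y) :: rem y s).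
  transitivity (\sum_(1 <= j < k) \sum_(y <- s | y == - j%:Z)
      - y%:~R * wickr A ((k%:Z + y) :: rem y s)).
    apply: eq_big_nat => j /andP[j1 jk].
    rewrite wickr_pos ?j1 ?(leq_trans (ltnW jk))// big_cons.
    rewrite (_ : (_ == _) = false); last by lia.
    rewrite mulr_sumr; apply: eq_bigr => y /eqP ->.
    rewrite mulrNz opprK /= (_ : ((k - j)%N%:Z == - j%:Z) = false); last by lia.
    by rewrite -subzn// ltnW.
  rewrite (exchange_big_dep xpredT)//= [RHS]big_mkcond; apply: eq_bigr => y _.
  case: ifPn => hy; last first.
    rewrite big_nat_cond big1// => j /andP[/andP[j1 jk] /eqP yj].
    by move: hy; rewrite yj; lia.
  have [m mE] : exists m : nat, y = - m%:Z by exists `|y|%N; lia.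
  rewrite (big_nat_widenl _ 0)//= big_mkord.
  have mk : (m < k)%N by lia.
  rewrite (bigD1 (Ordinal mk))/=; last by rewrite mE eqxx; lia.
  rewrite big1 ?addr0// => j /andP[/andP[/eqP jE _]]; apply: contraNeq => _.
  by apply/eqP/val_inj => /=; lia.
rewrite split1 [X in _ + X](bigID (fun x : int => (- k%:Z < x) && (x < 0)))/=.
rewrite [X in _ + (X + _)](eq_bigl (fun x : int => (- k%:Z < x) && (x < 0))); last by move=> x; lia.
rewrite addrA -big_split/= big1 ?add0r => [|x _]; last by rewrite mulNr addNr.
rewrite (bigID (fun x : int => 0 < x))/=.
(* Merging x > 0 with k and contracting the result with y = -(k + x) gives [F x y]. Merging that y
   with k and contracting with x gives the same with the opposite sign. *)
pose F (x y : int) : K :=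
  if (0 < x) && (y == - (k%:Z + x)) then - (x * y)%:~R * wickr A (rem y (rem x s)) else 0.
have e1 : \sum_(x <- s | (x != - k%:Z) && ~~ ((- k%:Z < x) && (x < 0)) && (0 < x))
    x%:~R * wickr A ((k%:Z + x) :: rem x s) = \sum_(x <- s) \sum_(y <- rem x s) F x y.
  rewrite big_mkcond; apply: eq_big_seq => x xs; case: ifPn => hx; last first.
    by rewrite big1// => y _; rewrite /F; case: ifPn => //; move: hx; lia.
  have [m mE] : exists m : nat, k%:Z + x = m%:Z by exists `|(k%:Z + x)%R|%N; lia.
  have := Apos x xs; rewrite mE wickr_pos => [hA|]; last by have := Apos x xs; lia.
  rewrite big_mkcond/= !mulr_sumr; apply: eq_bigr => y _.
  rewrite /F mE; case: ifPn => [/eqP yE|ny]; last by rewrite !mulr0 andbF.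
  rewrite andbT ifT; last by lia.
  by rewrite yE mulrA mulrN mulrNz opprK intrM.
have e2 : \sum_(x <- s | (x != - k%:Z) && ~~ ((- k%:Z < x) && (x < 0)) && ~~ (0 < x))
    x%:~R * wickr A ((k%:Z + x) :: rem x s) = - \sum_(y <- s) \sum_(x <- rem y s) F x y.
  rewrite -sumrN big_mkcond; apply: eq_big_seq => y ys; case: ifPn => hy; last first.
    rewrite big1 ?oppr0// => x _; rewrite /F; case: ifPn => //.
    by move: hy; lia.
  have y0 : y != 0 by apply: contraNneq s0 => <-.
  have [m mE] : exists m : nat, k%:Z + y = - m%:Z by exists `|(k%:Z + y)%R|%N; lia.
  rewrite mE wickr_neg; last by have := Aneg y ys; lia.
  rewrite big_mkcond/= !mulr_sumr -sumrN; apply: eq_bigr => x _.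
  rewrite /F; case: ifPn => [/eqP xE|nx]; last first.
    rewrite !mulr0 ifF ?oppr0//; move: nx; lia.
  rewrite ifT; last by lia.
  rewrite rem_rem mulNr opprK xE mulrA; congr (_ * _).
  by rewrite mulrC intrM.
by rewrite e1 e2 exchange_rem subrr.
Qed.

End wick.

(** * Positive part of a zero-sum sequence *)

Section positive_part.
Implicit Types (s : seq int) (x : int).

Definition pos_sum s : int := \sum_(x <- s | 0 < x) x.

Definition total s : int := \sum_(x <- s) x.

Lemma total_cons x s : total (x :: s) = x + total s.
Proof. by rewrite /total big_cons. Qed.

Lemma pos_sum_cons x s : pos_sum (x :: s) = (if 0 < x then x else 0) + pos_sum s.
Proof. by rewrite /pos_sum big_cons; case: ifPn => // _; rewrite add0r. Qed.

Lemma pos_sum_rem s x : x \in s ->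
  pos_sum s = (if 0 < x then x else 0) + pos_sum (rem x s).
Proof.
by move=> xs; rewrite -pos_sum_cons; apply: perm_big; exact: perm_to_rem.
Qed.

Lemma total_rem s x : x \in s -> total s = x + total (rem x s).
Proof. by move=> xs; rewrite /total (big_rem x). Qed.

Lemma pos_sum_ge0 s : 0 <= pos_sum s.
Proof. by apply: sumr_ge0 => x; exact: ltW. Qed.

Lemma pos_sum_ge s : total s <= pos_sum s.
Proof.
rewrite /total /pos_sum (bigID (fun x : int => 0 < x))/= gerDl; apply: sumr_le0 => x.
by rewrite -leNgt.
Qed.

Lemma zero_sum_entry s x : total s = 0 -> x \in s -> - pos_sum s <= x <= pos_sum s.
Proof.
move=> s0 xs; have := pos_sum_rem xs; have := total_rem xs.
have := pos_sum_ge (rem x s); have := pos_sum_ge0 (rem x s).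
by case: ifPn; lia.
Qed.

Lemma size_le_pos_sum s : 0 \notin s -> total s = 0 -> (size s)%:Z <= 2 * pos_sum s.
Proof.
move=> s0 sum0; have : (size s)%:Z + total s <= 2 * pos_sum s.
  elim: s s0 {sum0} => [|x s ih].
    by rewrite /total /pos_sum !big_nil.
  rewrite inE negb_or => /andP[x0 /ih]; rewrite pos_sum_cons total_cons /=.
  by case: ifPn; lia.
by rewrite sum0 addr0.
Qed.

(** A crude bound; only its uniformity over sequences of bounded length matters, as the start of the
    contraction argument. *)
Lemma wick_le A s m : (0 < A)%N -> (size s <= m)%N -> (wick A s <= (A ^ m * m`!) ^ A)%N.
Proof.
move=> A0 sm; rewrite -[X in (_ <= _ ^ X)%N]card_ord -prod_nat_const.
apply: leq_prod => a _; rewrite /wick_factor; case: ifPn => // _.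
set c := count_mem _ _; have cm : (c <= m)%N by rewrite (leq_trans (count_size _ _)).
apply: leq_mul; last by rewrite leq_fact.
apply: (@leq_trans (A ^ c)%N); last by rewrite leq_pexp2l.
by case: c {cm} => // c; rewrite leq_exp2r.
Qed.

Lemma rem0_notin s x : 0 \notin s -> 0 \notin rem x s.
Proof. by apply: contra => /mem_rem. Qed.

End positive_part.

(** * Trace moments equal Gaussian moments *)

Section moment_wick.
Context {R : realType} {n : nat}.
Local Notation C := (Cplx R).
Local Notation N := n.+1.
Variable mu : probability (borel_unitary R n.+1) R.
Hypothesis haar : haar_measure mu.
Implicit Types s : seq int.

Let D s : C := moment mu s - wickr C N s.

Let valid s := [/\ 0 \notin s, total s = 0 & pos_sum s <= N%:Z].

Let perm_valid s t : perm_eq s t -> valid s -> valid t.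
Proof.
move=> st [h1 h2 h3]; split.
- by rewrite -(perm_mem st).
- by rewrite /total -(perm_big _ st).
- by rewrite /pos_sum -(perm_big _ st).
Qed.

Let perm_D s t : perm_eq s t -> D s = D t.
Proof. by move=> st; rewrite /D (perm_moment _ st) /wickr (perm_wick _ st). Qed.

(** The difference of [loop_equation] and [wick_loop]. The terms of index 0 (j = 0 and x = -k) carry
    a factor N, and for Wick values they match by [wickr_pos]. *)
Let D_loop (k : nat) s : (0 < k)%N -> valid (k%:Z :: s) ->
  N%:R * D (k%:Z :: s) = - \sum_(1 <= j < k) D [:: j%:Z, (k - j)%N%:Z & s]
   - \sum_(x <- s | x != - k%:Z) x%:~R * D ((k%:Z + x) :: rem x s)
   + k%:R * N%:R * \sum_(x <- s | x == - k%:Z) D (rem x s).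
Proof.
move=> k0 vks; have [ks0 ks_sum ksN] := vks.
have kA : (0 < k <= N)%N.
  rewrite k0/=; have := zero_sum_entry ks_sum (mem_head _ _); lia.
have ent x : x \in s -> - N%:Z <= x <= N%:Z.
  move=> xs; have xks : x \in k%:Z :: s by rewrite inE xs orbT.
  have := zero_sum_entry ks_sum xks; lia.
have s0 : 0 \notin s by move: ks0; rewrite inE negb_or => /andP[].
have Wl : \sum_(1 <= j < k) wickr C N [:: j%:Z, (k - j)%N%:Z & s] +
  \sum_(x <- s | x != - k%:Z) x%:~R * wickr C N ((k%:Z + x) :: rem x s) = 0.
  apply: wick_loop => //.
  - move=> x xs x0; move: ksN; rewrite pos_sum_cons (pos_sum_rem xs) x0.
    have := pos_sum_ge0 (rem x s); case: ifPn; lia.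
  - by move=> x xs xk; have := ent x xs; lia.
have Ml := loop_equation haar k s.
have Wk := wickr_pos C s kA.
have Mk : \sum_(j < k) moment mu [:: j%:Z, (k - j)%N%:Z & s] = N%:R * moment mu (k%:Z :: s) +
    \sum_(1 <= j < k) moment mu [:: j%:Z, (k - j)%N%:Z & s].
  rewrite -(big_mkord xpredT (fun j : nat => moment mu [:: j%:Z, (k - j)%N%:Z & s])).
  by rewrite big_ltn// moment_0 subn0.
rewrite Mk (bigID (fun x => x == - k%:Z))/= in Ml.
have Mx : \sum_(x <- s | x == - k%:Z) x%:~R * moment mu ((k%:Z + x) :: rem x s) =
    - (k%:R * N%:R * \sum_(x <- s | x == - k%:Z) moment mu (rem x s)).
  rewrite mulr_sumr -sumrN; apply: eq_bigr => x /eqP ->.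
  by rewrite addrN moment_0 mulrNz mulNr mulrA.
rewrite Mx in Ml; rewrite /D !sumrB.
under [X in _ = _ - X + _]eq_bigr do rewrite mulrBr.
rewrite sumrB mulrBr Wk.
set a := N%:R * moment mu _ in Ml *; set b := \sum_(1 <= j < k) moment _ _ in Ml *.
set c := k%:R * N%:R * _ in Ml; rewrite mulrBr -/c.
set d := \sum_(x <- s | _) _ * moment _ _ in Ml *.
move: Wl; set b' := \sum_(1 <= j < k) _; set d' := \sum_(x <- s | _) _ * wickr _ _ _ => Wl.
have -> : a = c - b - d by apply/eqP; rewrite -subr_eq0 -Ml; apply/eqP; ring.
have -> : d' = - b' by apply/eqP; rewrite -addr_eq0 addrC Wl.
by ring.
Qed.

(** Apply [D_loop] to a positive entry k. Contracting with x = -k, or merging k with another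
    negative x, lowers the positive sum, so these terms vanish by [IH]. The k - 1 splittings and the
    mergers with x > 0, weighted by x, keep the sum K; their total weight is (k - 1) + (K - k) = K -
    1. *)
Let D_contract (K : nat) (B : C) : 0 <= B ->
  (forall t, valid t -> pos_sum t < K%:Z -> D t = 0) ->
  (forall t, valid t -> pos_sum t = K%:Z -> `|D t| <= B) ->
  forall t, valid t -> pos_sum t = K%:Z -> (0 < K)%N -> N%:R * `|D t| <= (K.-1)%:R * B.
Proof.
move=> B0 IH HB t vt tK K0.
have [k kt k0] : exists2 k, k \in t & 0 < k.
  apply/hasP/negPn/negP => /hasPn h.
  suff : pos_sum t = 0 by rewrite tK; lia.
  by rewrite /pos_sum big_seq_cond big1// => x /andP[/h/negP].
have pt := perm_to_rem kt; set s := rem k t in pt.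
rewrite (perm_D pt); have vks := perm_valid pt vt.
have ksK : pos_sum (k :: s) = K%:Z by rewrite -tK /pos_sum (perm_big _ pt).
have [m mE] : exists m : nat, k = m%:Z by exists `|k|%N; lia.
move: vks ksK; rewrite mE => vks ksK; have m0 : (0 < m)%N by lia.
have [ks0 ks_sum ksN] := vks.
have s0 : 0 \notin s by move: ks0; rewrite inE negb_or => /andP[].
have s_sum : m%:Z + total s = 0 by move: ks_sum; rewrite total_cons.
have s_pos : m%:Z + pos_sum s = K%:Z.
  by rewrite -ksK pos_sum_cons ifT//; lia.
rewrite -normr_nat -normrM D_loop//.
have Dm : \sum_(x <- s | x == - m%:Z) D (rem x s) = 0.
  rewrite big_seq_cond big1// => x /andP[xs /eqP xE]; apply: IH; last first.
    by have := pos_sum_rem xs; rewrite ifF; lia.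
  split; first exact: rem0_notin.
    by have := total_rem xs; lia.
  by have := pos_sum_rem xs; rewrite ifF; lia.
rewrite Dm mulr0 addr0.
have D1 : `| - \sum_(1 <= j < m) D [:: j%:Z, (m - j)%N%:Z & s]| <= m.-1%:R * B.
  rewrite normrN (le_trans (ler_norm_sum _ _ _))//.
  rewrite [leRHS](_ : _ = \sum_(1 <= j < m) B); last first.
    by rewrite sumr_const_nat subn1 mulr_natl.
  rewrite big_nat_cond [leRHS]big_nat_cond; apply: ler_sum => j /andP[/andP[j1 jm] _].
  have Epos : pos_sum [:: j%:Z, (m - j)%N%:Z & s] = K%:Z.
    by rewrite !pos_sum_cons !ifT; lia.
  apply: HB => //; split; last by rewrite Epos -ksK.
  - by rewrite !inE !negb_or s0 andbT; apply/andP; split; lia.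
  - by rewrite !total_cons; lia.
have D2 : `| \sum_(x <- s | x != - m%:Z) x%:~R * D ((m%:Z + x) :: rem x s)| <=
    (pos_sum s)%:~R * B.
  rewrite /pos_sum rmorph_sum/= mulr_suml.
  rewrite [leRHS]big_mkcond [X in `|X|]big_mkcond (le_trans (ler_norm_sum _ _ _))//.
  rewrite big_seq [leRHS]big_seq; apply: ler_sum => x xs.
  have x0 : x != 0 by apply: contraNneq s0 => <-.
  have sr := total_rem xs; have pr := pos_sum_rem xs.
  have valid_t : x != - m%:Z -> (if 0 < x then 0 else 1) + pos_sum ((m%:Z + x) :: rem x s) <= K%:Z ->
      valid ((m%:Z + x) :: rem x s).
    move=> xm h; split.
    - by rewrite inE negb_or rem0_notin// andbT; lia.
    - by rewrite total_cons; lia.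
    - by move: h; case: ifPn; lia.
  have [xm|xm] := eqVneq x (- m%:Z) => /=.
    rewrite normr0; case: ifPn => xp; last by rewrite lexx.
    by apply: mulr_ge0 => //; rewrite ler0z ltW.
  move: pr valid_t; case: ifPn => xp pr valid_t.
    have Epos : pos_sum ((m%:Z + x) :: rem x s) = K%:Z by rewrite pos_sum_cons ifT; lia.
    have xr : 0 <= x%:~R :> C by rewrite ler0z ltW.
    rewrite normrM (ger0_norm xr) ler_wpM2l//.
    by apply: HB => //; apply: valid_t => //; rewrite Epos; lia.
  have Epos : pos_sum ((m%:Z + x) :: rem x s) < K%:Z.
    by rewrite pos_sum_cons; case: ifPn; lia.
  rewrite IH ?mulr0 ?normr0//; apply: valid_t => //; lia.
rewrite (le_trans (ler_normB _ _))// (le_trans (lerD D1 D2))// -mulrDl.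
rewrite ler_wpM2r// -[m.-1%:R]/(m.-1%:Z%:~R) -intrD.
by rewrite -[K.-1%:R]/(K.-1%:Z%:~R) ler_int; lia.
Qed.

Let D_bound (K : nat) : exists B : R, 0 <= B /\
  forall t, valid t -> pos_sum t = K%:Z -> `|D t| <= B%:C.
Proof.
exists (2 * N%:R ^+ (2 * K) + ((N ^ (2 * K) * (2 * K)`!) ^ N)%N%:R); split.
  by rewrite addr_ge0// mulr_ge0// exprn_ge0.
move=> t [t0 tsum tN] tK.
have st : (size t <= 2 * K)%N by have := size_le_pos_sum t0 tsum; lia.
rewrite (le_trans (ler_normB _ _))// rmorphD lerD//.
  rewrite rmorphM rmorphXn/= !rmorph_nat (le_trans (moment_le _ _))//.
  by rewrite ler_wpM2l// ler_weXn2l// ler1n.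
by rewrite /wickr normr_nat rmorph_nat ler_nat wick_le.
Qed.

(** Strong induction on K = [pos_sum s]. All discrepancies at level K share a bound B; iterating
    [D_contract] multiplies it by q = (K - 1)/N < 1, so they vanish. At level 0 the sequence is
    empty. *)
Lemma moment_wick s : 0 \notin s -> total s = 0 -> pos_sum s <= N%:Z ->
  moment mu s = wickr C N s.
Proof.
move=> s0 ssum sN; apply/eqP; rewrite -subr_eq0 -/(D s); apply/eqP.
have [K KE] : exists K : nat, pos_sum s = K%:Z.
  by exists `|pos_sum s|%N; have := pos_sum_ge0 s; lia.
have : valid s by [].
elim/ltn_ind: K s KE {s0 ssum sN} => K ih s KE vs.
have IH t : valid t -> pos_sum t < K%:Z -> D t = 0.
  move=> vt tK; apply: (ih `|pos_sum t|%N) => //; have := pos_sum_ge0 t; lia.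
have [K0|K0] := posnP K.
  have [s0 ssum _] := vs; have := size_le_pos_sum s0 ssum.
  rewrite KE K0; case: (s) => //= _.
  by rewrite /D moment_nil /wickr /wick big1 ?subrr.
have [B [B0 HB]] := D_bound K.
have N0 : 0 < N%:R :> R by rewrite ltr0n.
pose q : R := K.-1%:R / N%:R.
have q0 : 0 <= q by rewrite divr_ge0.
have KN : (K <= N)%N by have [_ _] := vs; rewrite KE; lia.
have q1 : q < 1 by rewrite ltr_pdivrMr// mul1r ltr_nat; lia.
have iter_bound m t : valid t -> pos_sum t = K%:Z -> `|D t| <= (q ^+ m * B)%:C.
  elim: m t => [|m ihm] t vt tK; first by rewrite expr0 mul1r; exact: HB.
  have B1 : 0 <= (q ^+ m * B)%:C :> C by rewrite ler0c mulr_ge0// exprn_ge0.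
  have := D_contract B1 IH ihm vt tK K0.
  rewrite -ler_pdivlMl ?ltr0n// => /le_trans; apply.
  rewrite [leRHS](_ : _ = N%:R^-1 * (K.-1%:R * (q ^+ m * B)%:C))//.
  rewrite exprS -mulrA rmorphM/= {1}/q rmorphM/= fmorphV !rmorph_nat mulrA.
  by rewrite [K.-1%:R / _]mulrC -mulrA.
have rE := ge0_complexRe (normr_ge0 (D s)); set r := complex.Re _ in rE.
have r0 : 0 <= r by have := normr_ge0 (D s); rewrite rE ler0c.
suff r0' : r = 0 by apply/eqP; rewrite -normr_eq0 rE r0'.
have rq m : r <= q ^+ m * B by have := iter_bound m s vs KE; rewrite rE lecR.
apply/eqP; rewrite eq_le r0 andbT.
have cq : (fun m => q ^+ m * B) @ \oo --> (0 : R).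
  rewrite -(mul0r B); apply: cvgMl; apply: cvg_expr; rewrite ger0_norm//.
by apply: (cvgr_to_ge cq); exact: nearW.
Qed.

End moment_wick.

(** * Pairings and Wick's formula *)

Section pairings.
Local Notation set0 := finset.set0.
Context {p : nat}.
Implicit Types (S : {set 'I_p * 'I_p}) (A : {set 'I_p}) (q : 'I_p * 'I_p).

Definition supp S : {set 'I_p} := [set i | [exists q in S, (i == q.1) || (i == q.2)]].

Lemma suppP S i : reflect (exists2 q, q \in S & (i == q.1) || (i == q.2)) (i \in supp S).
Proof. by rewrite inE; exact: exists_inP. Qed.

Lemma supp0 : supp set0 = set0.
Proof. by apply/setP => i; rewrite inE finset.in_set0; apply/exists_inP => -[q]; rewrite inE. Qed.

Lemma supp_eq0 S : supp S = set0 -> S = set0.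
Proof.
move=> S0; apply/setP => q; rewrite finset.in_set0; apply/negbTE/negP => qS.
have : q.1 \in supp S by apply/suppP; exists q; rewrite ?eqxx.
by rewrite S0 inE.
Qed.

Lemma suppU1 q S : supp (q |: S) = q.1 |: (q.2 |: supp S).
Proof.
apply/setP => i; rewrite !in_setU1; apply/suppP/idP => [[q']|].
  rewrite in_setU1 => /predU1P[->|q'S].
    by case/orP => ->; rewrite ?orbT.
  by move=> h; have -> : i \in supp S; [apply/suppP; exists q'|rewrite !orbT].
case/or3P => [iq|iq|/suppP[q' q'S h]].
- by exists q; rewrite ?setU11 ?iq.
- by exists q; rewrite ?setU11 ?iq ?orbT.
- by exists q' => //; rewrite in_setU1 q'S orbT.
Qed.

Lemma pairingU1 q S : q \notin S ->
  pairing (q |: S) = [&& (q.1 < q.2)%N, q.1 \notin supp S, q.2 \notin supp S & pairing S].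
Proof.
move=> qS; rewrite /pairing.
have pe : perm_eq (enum (q |: S)) (q :: enum S).
  apply: uniq_perm; rewrite /= ?enum_uniq ?mem_enum ?qS//.
  by move=> x; rewrite inE !mem_enum in_setU1.
have -> : [forall q0 in q |: S, (q0.1 < q0.2)%N] =
    (q.1 < q.2)%N && [forall q0 in S, (q0.1 < q0.2)%N].
  apply/forall_inP/andP => [h|[h1 /forall_inP h2] x].
    split; first by apply: h; rewrite setU11.
    by apply/forall_inP => x xS; apply: h; rewrite in_setU1 xS orbT.
  by rewrite in_setU1 => /predU1P[->|] //; exact: h2.
have suppE i : (i \in supp S) = (i \in [seq q0.1 | q0 <- enum S] ++ [seq q0.2 | q0 <- enum S]).
  rewrite mem_cat; apply/suppP/orP => [[x xS /orP[/eqP->|/eqP->]]|[/mapP|/mapP][x xS ->]].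
  - by left; apply: map_f; rewrite mem_enum.
  - by right; apply: map_f; rewrite mem_enum.
  - by exists x; rewrite ?eqxx// -mem_enum.
  - by exists x; rewrite ?eqxx ?orbT// -mem_enum.
rewrite (perm_uniq (perm_cat (perm_map fst pe) (perm_map snd pe))) /=.
set s1 := map _ _; set s2 := map _ _.
have -> : uniq (s1 ++ q.2 :: s2) = uniq (q.2 :: (s1 ++ s2)).
  by apply: perm_uniq; rewrite -cat1s perm_catCA.
have -> : (q.1 \in s1 ++ q.2 :: s2) = (q.1 == q.2) || (q.1 \in s1 ++ s2).
  by rewrite !mem_cat inE orbCA.
rewrite /= -!suppE negb_or; have [q12|] := ltnP q.1 q.2; last by rewrite !andFb.
rewrite -[q.1 == q.2]/(val q.1 == val q.2) (ltn_eqF q12) /=.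
by rewrite andbCA; congr (_ && _); rewrite andbCA.
Qed.

Lemma pairing0 : pairing (set0 : {set 'I_p * 'I_p}).
Proof.
rewrite /pairing; have -> : enum (set0 : {set 'I_p * 'I_p}) = [::].
  by apply/size0nil; rewrite -cardE cards0.
by rewrite andbT; apply/forall_inP => q; rewrite inE.
Qed.

Lemma pairingD1 q S : q \in S -> pairing S ->
  [/\ (q.1 < q.2)%N, q.1 \notin supp (S :\ q), q.2 \notin supp (S :\ q) & pairing (S :\ q)].
Proof.
move=> qS pS; have : pairing (q |: S :\ q) by rewrite finset.setD1K.
by rewrite pairingU1 ?setD11// => /and4P[].
Qed.

Variable k : 'I_p -> int.

Definition matched S := [forall q in S, k q.2 == - k q.1].

Lemma matchedU1 q S : matched (q |: S) = (k q.2 == - k q.1) && matched S.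
Proof.
apply/forall_inP/andP => [h|[h1 /forall_inP h2] x].
  split; first by apply: h; rewrite setU11.
  by apply/forall_inP => x xS; apply: h; rewrite in_setU1 xS orbT.
by rewrite in_setU1 => /predU1P[->|] //; exact: h2.
Qed.

Lemma matched0 : matched set0.
Proof. by apply/forall_inP => q; rewrite inE. Qed.

Variable K : comNzRingType.

Definition pairing_sum A : K :=
  \sum_(S | [&& pairing S, supp S == A & matched S]) \prod_(q in S) (`|k q.1|%N)%:R.

Lemma pairing_sum0 : pairing_sum set0 = 1.
Proof.
rewrite /pairing_sum (big_pred1 set0) ?big_set0// => S /=.
apply/and3P/eqP => [[_ /eqP/supp_eq0 -> _]//|->].
by rewrite pairing0 supp0 matched0.
Qed.

(** The least index of A is necessarily the first entry of its pair. Choose its partner j and match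
    what remains. *)
Lemma pairing_sum_rec A i : i \in A -> (forall j, j \in A -> (i <= j)%N) ->
  pairing_sum A = (`|k i|%N)%:R *
    \sum_(j in A :\ i | k j == - k i) pairing_sum (A :\ i :\ j).
Proof.
move=> iA imin.
transitivity (\sum_(S | [&& pairing S, supp S == A & matched S])
    \sum_(j in A :\ i | (i, j) \in S) \prod_(q in S) (`|k q.1|%N)%:R : K).
  apply: eq_bigr => S /and3P[pS /eqP sS _].
  have /suppP[q qS iq] : i \in supp S by rewrite sS.
  have q1A : q.1 \in A by rewrite -sS; apply/suppP; exists q; rewrite ?eqxx.
  have q2A : q.2 \in A by rewrite -sS; apply/suppP; exists q; rewrite ?eqxx ?orbT.
  have [q12 q1S q2S _] := pairingD1 qS pS.
  have iq1 : i = q.1.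
    case/orP: iq => /eqP// iq; have := imin _ q1A; rewrite iq.
    by rewrite leqNgt q12.
  rewrite (big_pred1 q.2) // => j /=; apply/idP/eqP => [/andP[jA ijS]|->].
    apply/eqP; apply: contraNT q1S => jq; apply/suppP; exists (i, j).
      by rewrite in_setD1 ijS andbT; apply: contraNN jq => /eqP <-.
    by rewrite /= -iq1 eqxx.
  rewrite in_setD1 q2A iq1 andbT -surjective_pairing qS andbT.
  by apply/eqP => q21; rewrite q21 ltnn in q12.
rewrite (exchange_big_dep (fun j => j \in A :\ i))/=; last by move=> S j _ /andP[].
rewrite [RHS]mulr_sumr [RHS]big_mkcondr/=; apply: eq_bigr => j jA.
have [ji jA'] := setD1P jA.
have ij : (i < j)%N by rewrite ltn_neqAle imin// andbT eq_sym.
pose q := (i, j).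
rewrite (eq_bigl (fun S => [&& pairing S, supp S == A & matched S] && (q \in S))); last first.
  by move=> S; rewrite jA.
rewrite (reindex_onto (fun S => q |: S) (fun S => S :\ q)); last first.
  by move=> S /andP[_ qS]; rewrite finset.setD1K.
have cond S : ([&& pairing (q |: S), supp (q |: S) == A & matched (q |: S)] && (q \in q |: S)
      && ((q |: S) :\ q == S)) =
    (k j == - k i) && [&& pairing S, supp S == A :\ i :\ j & matched S].
  rewrite setU11 andbT matchedU1 /=; have [qS|qS] := boolP (q \in S).
    have -> : ((q |: S) :\ q == S) = false.
      by apply/eqP => /setP/(_ q); rewrite setD11 qS.
    have iS : i \in supp S by apply/suppP; exists q; rewrite ?eqxx.
    have -> : (supp S == A :\ i :\ j) = false.
      by apply/eqP => sE; move: iS; rewrite sE !inE eqxx andbF.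
    by rewrite !andbF.
  rewrite finset.setU1K// eqxx andbT pairingU1//= ij suppU1 /=.
  apply/idP/idP => [/and4P[/and3P[iS jS ->] /eqP sE -> ->]|/and4P[-> -> /eqP sE ->]].
    rewrite -sE finset.setU1K ?finset.setU1K ?eqxx//.
    by rewrite in_setU1 negb_or iS andbT eq_sym.
  rewrite sE !inE !eqxx !andbF /= finset.setD1K; last by rewrite !inE ji.
  by rewrite finset.setD1K// eqxx.
rewrite (eq_bigl _ _ cond); case: ifPn => kij; last by rewrite big_pred0.
rewrite (eq_bigl (fun S => [&& pairing S, supp S == A :\ i :\ j & matched S])); last first.
  by [].
rewrite /pairing_sum mulr_sumr; apply: eq_bigr => S /and3P[pS /eqP sE _].
rewrite big_setU1//=; apply/negP => qS.
have : i \in supp S by apply/suppP; exists q; rewrite ?eqxx.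
by rewrite sE !inE eqxx andbF.
Qed.

Lemma wickr_abs (M : nat) (x : int) s : x != 0 -> (`|x| <= M)%N ->
  wickr K M (x :: s) = (`|x|%N)%:R * \sum_(y <- s | y == - x) wickr K M (rem y s).
Proof.
case: x => x x0 xM; first by rewrite wickr_pos//; lia.
by rewrite NegzE wickr_neg ?opprK ?abszN//; lia.
Qed.

(** Contracting the entry at the least index of A gives both sides the same recursion. *)
Lemma wick_pairing (M : nat) A : (forall i, i \in A -> k i != 0) ->
  (forall i, i \in A -> (`|k i| <= M)%N) ->
  wickr K M [seq k i | i <- enum A] = pairing_sum A.
Proof.
have [m] := ubnP #|A|; elim: m A => // m ih A; rewrite ltnS => Am kA0 kAM.
have [->|/set0Pn[i0 i0A]] := eqVneq A set0.
  rewrite pairing_sum0 (_ : enum _ = [::]); last by apply/size0nil; rewrite -cardE cards0.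
  by rewrite /wickr /wick big1.
have [i iA' imin] := arg_minnP (fun i : 'I_p => val i) i0A.
have iA : i \in A := iA'.
rewrite (pairing_sum_rec iA imin).
have peA (B : {set 'I_p}) j : j \in B -> perm_eq (enum B) (j :: enum (B :\ j)).
  move=> jB; apply: uniq_perm; rewrite /= ?enum_uniq ?mem_enum ?setD11//.
  by move=> x; rewrite inE !mem_enum in_setD1; case: eqVneq => [->|].
rewrite /wickr (perm_wick _ (perm_map k (peA A i iA))) /= -/(wickr _ _ _).
rewrite wickr_abs ?kA0 ?kAM//; congr (_ * _).
rewrite big_map big_enum_cond; apply: eq_bigr => j /andP[jA _].
rewrite -ih => [|||].
- rewrite /wickr; congr (_%:R); apply: perm_wick.
  rewrite -(perm_cons (k j)) perm_sym.
  apply: perm_trans (perm_to_rem _); last by apply: map_f; rewrite mem_enum.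
  by rewrite perm_sym -map_cons; apply: perm_map; exact: peA.
- by move: Am; rewrite (cardsD1 i) iA (cardsD1 j) jA; exact: ltnW.
- by move=> l; rewrite !inE => /and3P[_ _]; exact: kA0.
- by move=> l; rewrite !inE => /and3P[_ _]; exact: kAM.
Qed.

End pairings.

(** * Measurability of Lipschitz functions on tuples *)

Section lipschitz_tuple.
Context {R : realType}.
Local Notation RT m := (m.-tuple (measurableTypeR R)).

Definition dist1 m (s t : m.-tuple R) : R := \sum_(i < m) `|tnth s i - tnth t i|.

Definition lip m (L : R) (h : m.-tuple R -> R) : Prop :=
  forall s t, `|h s - h t| <= L * dist1 s t.

Lemma floor_approx (N : nat) (x : R) :
  `|(Num.floor (N.+1%:R * x))%:~R / N.+1%:R - x| <= N.+1%:R^-1.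
Proof.
have N0 : 0 < N.+1%:R :> R by rewrite ltr0n.
rewrite -(ler_pM2l N0) divff ?gt_eqF// -[X in X * _]ger0_norm ?ltW// -normrM.
rewrite mulrBr mulrCA divff ?gt_eqF// mulr1.
have /andP[h1 h2] := floor_itv (N.+1%:R * x).
by move: h1 h2; rewrite intrD => h1 h2; rewrite ler0_norm; lra.
Qed.

(** [h] is the pointwise limit of its compositions with rounding down to the grid of mesh 1/(N+1),
    and these take countably many values on measurable boxes. *)
Lemma measurable_lip m L (h : RT m -> R) : lip L h -> measurable_fun setT h.
Proof.
move=> hL.
pose fl N (t : RT m) : m.-tuple int := [tuple Num.floor (N.+1%:R * tnth t i) | i < m].
pose g N (q : m.-tuple int) : m.-tuple R := [tuple (tnth q i)%:~R / N.+1%:R | i < m].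
apply: (measurable_fun_cvg (h := fun N t => h (g N (fl N t)))).
  move=> N _ Y mY; rewrite setTI.
  rewrite (_ : _ @^-1` Y = \bigcup_(q : m.-tuple int)
      (if h (g N q) \in Y then [set t | fl N t = q] else set0)).
    apply: countable_bigcupT_measurable; first exact: countableP.
    move=> q; case: ifPn => // _.
    rewrite (_ : [set t | _] = \bigcap_(i in [set: 'I_m])
       ((fun t : RT m => tnth t i) @^-1` [set x | Num.floor (N.+1%:R * x) = tnth q i])).
      apply: fin_bigcap_measurable => [|i _]; first exact: finite_finset.
      rewrite -[X in measurable X]setTI; apply: measurable_tnth => //.
      have N0 : 0 < N.+1%:R :> R by rewrite ltr0n.
      rewrite (_ : [set x | _] = `[(tnth q i)%:~R / N.+1%:R, (tnth q i + 1)%:~R / N.+1%:R[%classic).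
        exact: measurable_itv.
      apply/seteqP; split => x /=.
        move=> <-; rewrite in_itv/= ler_pdivrMr// ltr_pdivlMr// (mulrC x).
        exact: floor_itv.
      rewrite in_itv/= ler_pdivrMr// ltr_pdivlMr// (mulrC x); exact: floor_def.
    apply/seteqP; split => [t /= tq i _|t /= ti].
      by rewrite /= -tq tnth_mktuple.
    by apply: eq_from_tnth => i; rewrite tnth_mktuple ti.
  apply/seteqP; split => [t Yt|t [q _]] /=.
    by exists (fl N t) => //; rewrite mem_set.
  by case: ifPn => //=; rewrite inE => Yq ->.
move=> t _; apply/cvgrPdist_le => e e0.
have L0 : 0 <= `|L| * m%:R by rewrite mulr_ge0.
near=> N.
rewrite distrC (le_trans (hL _ _))//.
rewrite (@le_trans _ _ (`|L| * m%:R / N.+1%:R))//.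
  rewrite -mulrA (le_trans (ler_wpM2r _ (ler_norm L)))//.
    by apply: sumr_ge0 => i _.
  rewrite ler_wpM2l// /dist1 -[m in m%:R]card_ord -sumr_const mulr_suml.
  apply: ler_sum => i _; rewrite !tnth_mktuple mul1r; exact: floor_approx.
rewrite ler_pdivrMr ?ltr0n// [leRHS]mulrC -ler_pdivrMr//.
near: N; exists (Num.truncn (`|L| * m%:R / e)) => // N /= hN.
apply: (le_trans (ltW (truncnS_gt (`|L| * m%:R / e)))).
by rewrite ler_nat ltnS.
Unshelve. all: by end_near. Qed.

End lipschitz_tuple.

(** * Iterated integrals over tuples *)

Section tuple_integral.
Context {R : realType}.
Local Notation RT m := (m.-tuple (measurableTypeR R)).
Local Notation leb := (@lebesgue_measure R).

Let consp m (p : (measurableTypeR R * RT m)%type) : RT m.+1 := [tuple of p.1 :: p.2].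

Let measurable_consp m : measurable_fun setT (@consp m).
Proof. exact: (measurable_cons measurable_fst measurable_snd). Qed.

Lemma ge0_integral_lebesgue_tupleS m (f : RT m.+1 -> \bar R) :
  measurable_fun setT f -> (forall t, (0 <= f t)%E) ->
  (\int[lebesgue_tuple R m.+1]_t f t =
   \int[leb]_x \int[lebesgue_tuple R m]_t f [tuple of x :: t])%E.
Proof.
move=> mf f0.
transitivity (\int[(leb \x lebesgue_tuple R m)%E]_z (f \o @consp m) z)%E.
  rewrite -[LHS]/(\int[pushforward (leb \x lebesgue_tuple R m)%E (@consp m)]_t f t)%E.
  by apply: (ge0_integral_pushforward (@measurable_consp m) (leb \x lebesgue_tuple R m)%E
    measurableT mf) => t _; exact: f0.
rewrite fubini_tonelli1//; last by move=> z; exact: f0.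
exact: (measurableT_comp mf (@measurable_consp m)).
Qed.

Lemma integral_lebesgue_tupleS m (f : RT m.+1 -> \bar R) :
  (lebesgue_tuple R m.+1).-integrable setT f ->
  (\int[lebesgue_tuple R m.+1]_t f t =
   \int[leb]_x \int[lebesgue_tuple R m]_t f [tuple of x :: t])%E.
Proof.
move=> intf; have mf := measurable_int _ intf.
have intfc : (leb \x lebesgue_tuple R m)%E.-integrable setT (f \o @consp m).
  apply/integrableP; split; first exact: (measurableT_comp mf (@measurable_consp m)).
  move/integrableP : intf => [_]; apply: le_lt_trans.
  rewrite ge0_integral_lebesgue_tupleS//; last exact: measurableT_comp.
  rewrite fubini_tonelli1//.
  apply: measurableT_comp => //; exact: (measurableT_comp mf (@measurable_consp m)).
transitivity (\int[(leb \x lebesgue_tuple R m)%E]_z (f \o @consp m) z)%E.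
  rewrite -[LHS]/(\int[pushforward (leb \x lebesgue_tuple R m)%E (@consp m)]_t f t)%E.
  exact: (integral_pushforward (@measurable_consp m) (mu := (leb \x lebesgue_tuple R m)%E)
    (D := setT) mf intfc measurableT).
by rewrite -integral12_prod_meas1.
Qed.

End tuple_integral.

(** * Integration against product weights *)

Section product_weight.
Context {R : realType}.
Local Notation RT m := (m.-tuple (measurableTypeR R)).
Local Notation leb := (@lebesgue_measure R).

Variable w : R -> R.
Hypotheses (w0 : forall x, 0 <= w x)
  (mw : measurable_fun setT (w : measurableTypeR R -> R))
  (iw : leb.-integrable setT (EFin \o w)).

Let W := \int[leb]_x w x.

Lemma weight_ge0 : 0 <= W.
Proof. by apply: Rintegral_ge0. Qed.

Definition prod_weight m (t : m.-tuple R) : R := \prod_(i < m) w (tnth t i).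

Lemma prod_weight_ge0 m (t : m.-tuple R) : 0 <= prod_weight t.
Proof. by apply: prodr_ge0. Qed.

Lemma prod_weightS m x (t : m.-tuple R) :
  prod_weight [tuple of x :: t] = w x * prod_weight t.
Proof.
rewrite /prod_weight big_ord_recl tnth0; congr (_ * _).
by apply: eq_bigr => i _; rewrite tnthS.
Qed.

Lemma measurable_prod_weight m : measurable_fun setT (@prod_weight m : RT m -> R).
Proof.
apply: measurable_prod => i _; apply: (measurableT_comp mw).
exact: measurable_tnth.
Qed.

Lemma integral_prod_weight m :
  (\int[lebesgue_tuple R m]_t (prod_weight t)%:E = (W ^+ m)%:E)%E.
Proof.
elim: m => [|m ih].
  rewrite integral_dirac//; last by apply/measurable_EFinP; exact: measurable_prod_weight.
  by rewrite diracT mul1e /prod_weight big_ord0.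
rewrite ge0_integral_lebesgue_tupleS; last 2 first.
- by apply/measurable_EFinP; exact: measurable_prod_weight.
- by move=> t; rewrite lee_fin prod_weight_ge0.
transitivity (\int[leb]_x ((w x)%:E * (W ^+ m)%:E))%E.
  apply: eq_integral => x _; rewrite -ih -ge0_integralZl//.
  - by apply: eq_integral => t _; rewrite prod_weightS EFinM.
  - by apply/measurable_EFinP; exact: measurable_prod_weight.
  - by move=> t _; rewrite lee_fin prod_weight_ge0.
  - by rewrite lee_fin.
rewrite ge0_integralZr//.
- by rewrite exprS EFinM /W /Rintegral fineK// integrable_fin_num.
- exact/measurable_EFinP.
- by move=> x _; rewrite lee_fin.
- by rewrite lee_fin exprn_ge0// weight_ge0.
Qed.

Lemma integrable_weighted m (h : RT m -> R) C : measurable_fun setT h ->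
  (forall t, `|h t| <= C) ->
  (lebesgue_tuple R m).-integrable setT (EFin \o (fun t => h t * prod_weight t)).
Proof.
move=> mh hC; apply/integrableP; split.
  by apply/measurable_EFinP; apply: measurable_funM => //; exact: measurable_prod_weight.
have mp : measurable_fun setT (fun t : RT m => (prod_weight t)%:E).
  by apply/measurable_EFinP; exact: measurable_prod_weight.
apply: (@le_lt_trans _ _ (\int[lebesgue_tuple R m]_t (`|C|%:E * (prod_weight t)%:E))%E).
  apply: ge0_le_integral => //.
  - apply: measurableT_comp => //; apply/measurable_EFinP.
    by apply: measurable_funM => //; exact: measurable_prod_weight.
  - exact: measurable_funeM.
  - move=> t _ /=; rewrite -EFinM lee_fin normrM (ger0_norm (prod_weight_ge0 t)).
    by rewrite ler_wpM2r ?prod_weight_ge0// (le_trans (hC t))// ler_norm.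
rewrite ge0_integralZl//.
- by rewrite integral_prod_weight -EFinM ltry.
- by move=> t _; rewrite lee_fin prod_weight_ge0.
Qed.

Definition wint m (h : m.-tuple R -> R) : R :=
  \int[lebesgue_tuple R m]_t (h t * prod_weight t).

Lemma wint0 (h : 0.-tuple R -> R) : wint h = h [tuple].
Proof.
rewrite /wint /Rintegral integral_dirac//.
  by rewrite diracT mul1e /= /prod_weight big_ord0 mulr1.
apply/measurable_EFinP => _ Y mY; rewrite setTI.
have [hY|hY] := pselect (Y (h [tuple] * prod_weight [tuple])).
  rewrite (_ : _ @^-1` Y = setT)//; apply/seteqP; split => // t _ /=.
  by rewrite (tuple0 t).
rewrite (_ : _ @^-1` Y = set0)//; apply/seteqP; split => // t /=.
by rewrite (tuple0 t) => /hY.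
Qed.

Lemma wintB m L L' C C' (h g : RT m -> R) : lip L h -> lip L' g ->
  (forall t, `|h t| <= C) -> (forall t, `|g t| <= C') ->
  wint h - wint g = wint (fun t => h t - g t).
Proof.
move=> lh lg hC gC; rewrite /wint.
rewrite -(RintegralB measurableT (integrable_weighted (measurable_lip lh) hC)
  (integrable_weighted (measurable_lip lg) gC)).
by apply: eq_Rintegral => t _; rewrite mulrBl.
Qed.

Lemma wint_le m (h : RT m -> R) C : measurable_fun setT h ->
  (forall t, `|h t| <= C) -> `|wint h| <= C * W ^+ m.
Proof.
move=> mh hC; have ih := integrable_weighted mh hC.
have WE : C * W ^+ m = \int[lebesgue_tuple R m]_t (C * prod_weight t).
  rewrite RintegralZl//; last first.
    apply: eq_integrable (integrable_weighted (h := fun=> 1) (C := 1) _ _) => //=.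
    - by move=> t _; rewrite mul1r.
    - by move=> t; rewrite normr1.
  by rewrite /Rintegral integral_prod_weight.
rewrite WE (le_trans (le_normr_Rintegral _ ih))//.
apply: le_Rintegral => //.
- apply: eq_integrable (integrable_norm ih) => //.
- apply: (@integrable_weighted _ (fun=> C) `|C|) => // t.
- move=> t _; rewrite normrM (ger0_norm (prod_weight_ge0 t)).
  by rewrite ler_wpM2r ?prod_weight_ge0.
Qed.

Lemma dist1_cons m x y (s t : m.-tuple R) :
  dist1 [tuple of x :: s] [tuple of y :: t] = `|x - y| + dist1 s t.
Proof.
rewrite /dist1 big_ord_recl !tnth0; congr (_ + _).
by apply: eq_bigr => i _; rewrite !tnthS.
Qed.

Lemma dist1xx m (t : m.-tuple R) : dist1 t t = 0.
Proof. by rewrite /dist1 big1// => i _; rewrite subrr normr0. Qed.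

Lemma lip_slice m L (h : m.+1.-tuple R -> R) x : lip L h ->
  lip L (fun t : m.-tuple R => h [tuple of x :: t]).
Proof.
by move=> hL s t; rewrite (le_trans (hL _ _))// dist1_cons subrr normr0 add0r.
Qed.

Lemma wintS m L C (h : RT m.+1 -> R) : lip L h -> (forall t, `|h t| <= C) ->
  wint h = \int[leb]_x (wint (fun t => h [tuple of x :: t]) * w x).
Proof.
move=> hL hC; rewrite {1}/wint {1}/Rintegral.
rewrite integral_lebesgue_tupleS; last exact: integrable_weighted (measurable_lip hL) hC.
congr fine; apply: eq_integral => x _.
have ix := integrable_weighted (measurable_lip (lip_slice x hL)) (fun t => hC [tuple of x :: t]).
rewrite mulrC EFinM /wint /Rintegral fineK; last exact: integrable_fin_num.
rewrite -integralZl//; apply: eq_integral => t _.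
by rewrite /= prod_weightS -EFinM; congr EFin; ring.
Qed.

(** Integrating out all variables but the first keeps the function Lipschitz, so the one-dimensional
    rule applies to it. *)
Lemma lip_wint m L C (h : RT m.+1 -> R) : 0 <= L -> lip L h -> (forall t, `|h t| <= C) ->
  forall x y, `|wint (fun t => h [tuple of x :: t]) - wint (fun t => h [tuple of y :: t])|
    <= L * W ^+ m * `|x - y|.
Proof.
move=> L0 hL hC x y.
rewrite (wintB (lip_slice x hL) (lip_slice y hL) (fun t => hC _) (fun t => hC _)).
rewrite mulrAC; apply: wint_le.
  apply: measurable_funB.
    exact: (measurable_lip (lip_slice x hL)).
  exact: (measurable_lip (lip_slice y hL)).
by move=> t; rewrite (le_trans (hL _ _))// dist1_cons dist1xx addr0.
Qed.

End product_weight.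

(** * Quadrature in several variables from one variable *)

Section quadrature.
Context {R : realType} {I : finType}.
Local Notation leb := (@lebesgue_measure R).

Variables (w : R -> R) (c : I -> R) (a d : R).
Hypotheses (w0 : forall x, 0 <= w x)
  (mw : measurable_fun setT (w : measurableTypeR R -> R))
  (iw : leb.-integrable setT (EFin \o w)).
Hypotheses (a0 : 0 <= a) (d0 : 0 <= d).
Hypothesis W_total : \int[leb]_x w x = a * #|I|%:R.
Hypothesis quadrature1 : forall (f : R -> R) L C, 0 <= L ->
  (forall x y, `|f x - f y| <= L * `|x - y|) -> (forall x, `|f x| <= C) ->
  `|\int[leb]_x (f x * w x) - a * \sum_i f (c i)| <= L * d.

Lemma sum_tupleS m (V : nmodType) (F : m.+1.-tuple I -> V) :
  \sum_t F t = \sum_i \sum_(t : m.-tuple I) F [tuple of i :: t].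
Proof.
rewrite pair_big/=.
rewrite (reindex (fun p : I * m.-tuple I => [tuple of p.1 :: p.2])) //=.
exists (fun t => (thead t, [tuple of behead t])).
  by move=> [i t] _ /=; congr pair; exact/val_inj.
by move=> t _; exact/esym/tuple_eta.
Qed.

(** Use the one-dimensional rule in the first variable, at cost L W^m d, and the induction
    hypothesis on the slice at each node, at cost W times the previous error. The base 1 + W absorbs
    both. *)
Theorem quadrature m (h : m.-tuple R -> R) L C : 0 <= L -> lip L h ->
  (forall t, `|h t| <= C) ->
  `|wint w h - a ^+ m * \sum_(t : m.-tuple I) h (map_tuple c t)|
    <= L * d * m%:R * (1 + a * #|I|%:R) ^+ m.
Proof.
have W0 : 0 <= a * #|I|%:R by rewrite mulr_ge0.
move WE : (a * #|I|%:R) W0 => W W0.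
elim: m h => [|m ih] h L0 hL hC.
  rewrite wint0 expr0 mul1r (big_pred1 [tuple]) => [|t]; last by rewrite (tuple0 t) /= eqxx.
  rewrite (_ : map_tuple _ _ = [tuple]) ?subrr ?normr0 ?mulr0 ?mul0r//.
  exact: val_inj.
pose G x := wint w (fun t : m.-tuple R => h [tuple of x :: t]).
have GL := lip_wint w0 mw iw L0 hL hC.
have GC x : `|G x| <= C * W ^+ m.
  rewrite -WE -W_total; apply: wint_le => //.
  exact: (measurable_lip (lip_slice x hL)).
have LW0 : 0 <= L * W ^+ m by rewrite mulr_ge0// exprn_ge0.
rewrite W_total WE in GL.
have q1 := quadrature1 LW0 GL GC.
rewrite (wintS w0 mw iw hL hC) -/(G _) sum_tupleS.
have e1 : `|a * (\sum_i G (c i)) -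
    a ^+ m.+1 * (\sum_i \sum_(t : m.-tuple I) h (map_tuple c [tuple of i :: t]))| <=
    W * (L * d * m%:R * (1 + W) ^+ m).
  rewrite exprS -mulrA -mulrBr mulr_sumr -sumrB normrM (ger0_norm a0).
  rewrite [leRHS](_ : _ = a * \sum_(i : I) (L * d * m%:R * (1 + W) ^+ m)); last first.
    by rewrite sumr_const -[X in a * X]mulr_natl (_ : #|xpredT| = #|I|)// -WE; ring.
  apply: ler_wpM2l => //; rewrite (le_trans (ler_norm_sum _ _ _))//.
  apply: ler_sum => i _.
  have := ih _ L0 (lip_slice (c i) hL) (fun t => hC _).
  rewrite /G (eq_bigr (fun t : m.-tuple I => h (map_tuple c [tuple of i :: t])))// => t _.
  by congr h; exact: val_inj.
rewrite -[X in `|X|](subrKA (a * \sum_i G (c i))) (le_trans (ler_normD _ _))//.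
rewrite (le_trans (lerD q1 e1))//.
rewrite (_ : L * W ^+ m * d + _ = L * d * (W ^+ m + m%:R * (W * (1 + W) ^+ m))); last by ring.
rewrite -!mulrA !ler_wpM2l// exprS -natr1 mulrDl mul1r addrC.
have W1 : W ^+ m <= (1 + W) ^+ m by rewrite lerXn2r// ?nnegrE ?addr_ge0// lerDr.
have p1 : 0 <= (1 + W) ^+ m by rewrite exprn_ge0// addr_ge0.
apply: lerD.
  by rewrite ler_wpM2l// ler_wpM2r// lerDr.
rewrite (le_trans W1)// ler_peMl// lerDl//.
Qed.

End quadrature.

(** * One-dimensional quadrature on cells *)

Section cells.
Context {R : realType} {I : finType}.
Local Notation RR := (measurableTypeR R).
Local Notation leb := (@lebesgue_measure R).
Variables (D : I -> set RR) (c : I -> R) (u : R -> R) (Cu a d : R).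
Hypotheses (mD : forall i, measurable (D i)) (finD : forall i, (leb (D i) < +oo)%E)
  (mu : measurable_fun setT (u : RR -> R)) (u0 : forall x, 0 <= u x)
  (uC : forall x, `|u x| <= Cu) (Dc : forall i x, D i x -> `|x - c i| <= 1).
Hypotheses (Du : forall i, \int[leb]_(x in D i) u x = a)
  (Dd : forall i, \int[leb]_(x in D i) (`|x - c i| * u x) <= d).

(** A sum of restrictions, so that integrals split over [I] at once. For the disjoint cells of a
    grid it is [u] cut off to their union. *)
Definition cell_weight (x : R) : R := \sum_i (u \_ (D i)) x.

Lemma cell_weight_ge0 x : 0 <= cell_weight x.
Proof. by apply: sumr_ge0 => i _; rewrite /patch; case: ifP. Qed.

Lemma lip_measurable L (f : R -> R) : (forall x y, `|f x - f y| <= L * `|x - y|) ->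
  measurable_fun setT (f : RR -> R).
Proof.
move=> fL; apply: continuous_measurable_fun => x; apply/cvgrPdist_lt => e e0.
near=> y; rewrite (le_lt_trans (fL _ _))//.
rewrite (@le_lt_trans _ _ ((`|L| + 1) * `|x - y|))//.
  by rewrite ler_wpM2r// (le_trans (ler_norm _))// lerDl.
rewrite -ltr_pdivlMl ?ltr_wpDl//.
near: y; apply: cvgr_dist_lt => //.
by rewrite mulr_gt0// invr_gt0 ltr_wpDl.
Unshelve. all: by end_near. Qed.

Lemma bounded_integrable_cell i (f : R -> R) C : measurable_fun setT (f : RR -> R) ->
  (forall x, D i x -> `|f x| <= C) -> leb.-integrable (D i) (EFin \o f).
Proof.
move=> mf fC; apply: measurable_bounded_integrable => //.
- exact: finD.
- exact: measurable_funTS.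
exists C; split; first exact: num_real.
by move=> x Cx y Dy /=; rewrite (le_trans (fC _ Dy))// ltW.
Qed.

Lemma integrable_mul_cell i (f : R -> R) C : measurable_fun setT (f : RR -> R) ->
  (forall x, `|f x| <= C) -> leb.-integrable (D i) (EFin \o (fun x => f x * u x)).
Proof.
move=> mf fC; apply: (@bounded_integrable_cell _ _ (C * Cu)).
  exact: measurable_funM.
by move=> x _; rewrite normrM ler_pM.
Qed.

Lemma integrable_mul_weight (f : R -> R) C : measurable_fun setT (f : RR -> R) ->
  (forall x, `|f x| <= C) ->
  leb.-integrable setT (EFin \o (fun x => f x * cell_weight x)) /\
  \int[leb]_x (f x * cell_weight x) = \sum_i \int[leb]_(x in D i) (f x * u x).
Proof.
move=> mf fC.
have iI i : leb.-integrable setT (EFin \o ((fun x => f x * u x) \_ (D i))).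
  have := integrable_mul_cell i mf fC.
  by rewrite (integrable_mkcond _ (mD i)); apply: eq_integrable => // x _;
    rewrite /= /patch; case: ifP.
have fE : (fun x => f x * cell_weight x) = fun x => \sum_i ((fun x => f x * u x) \_ (D i)) x.
  apply/funext => x; rewrite mulr_sumr; apply: eq_bigr => i _.
  by rewrite /patch; case: ifP; rewrite ?mulr0.
rewrite fE; elim: (index_enum I) => [|i r [ih1 ih2]].
  split; first by apply: eq_integrable (integrable0 _ _) => //= x _; rewrite big_nil.
  rewrite big_nil -[RHS](Rintegral_set0 leb (fun=> 0)) [RHS]Rintegral_mkcond.
  by apply: eq_Rintegral => x _; rewrite big_nil /patch; case: ifP.
split.
  apply: eq_integrable (integrableD measurableT (iI i) ih1) => //= x _.
  by rewrite big_cons EFinD.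
rewrite big_cons Rintegral_mkcond -ih2 -(RintegralD measurableT (iI i) ih1).
by apply: eq_Rintegral => x _; rewrite big_cons.
Qed.

Lemma measurable_cell_weight : measurable_fun setT (cell_weight : RR -> R).
Proof.
apply: measurable_sum => i; apply/(measurable_restrictT _ (mD i)).
exact: measurable_funTS.
Qed.

Lemma integrable_cell_weight : leb.-integrable setT (EFin \o cell_weight).
Proof.
have n1 (x : R) : `|1 : R| <= 1 by rewrite normr1.
have [h _] := @integrable_mul_weight (fun=> 1) 1 (measurable_cst _) n1.
by apply: eq_integrable h => //= x _; rewrite mul1r.
Qed.

Lemma cell_weight_total : \int[leb]_x cell_weight x = a * #|I|%:R.
Proof.
have n1 (x : R) : `|1 : R| <= 1 by rewrite normr1.
have [_ h] := @integrable_mul_weight (fun=> 1) 1 (measurable_cst _) n1.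
under eq_Rintegral do rewrite -[cell_weight _]mul1r.
rewrite h (eq_bigr (fun=> a)) => [|i _]; first by rewrite sumr_const mulr_natr.
by rewrite -(Du i); apply: eq_Rintegral => x _; rewrite mul1r.
Qed.

(** Replacing f by its value at the node of a cell costs L |x - c i|, whose weighted integral is at
    most L d. *)
Lemma cell_quadrature (f : R -> R) L C : 0 <= L ->
  (forall x y, `|f x - f y| <= L * `|x - y|) -> (forall x, `|f x| <= C) ->
  `|\int[leb]_x (f x * cell_weight x) - a * \sum_i f (c i)| <= L * (#|I|%:R * d).
Proof.
move=> L0 fL fC; have mf := lip_measurable fL.
have [_ ->] := integrable_mul_weight mf fC.
rewrite mulr_sumr -sumrB (le_trans (ler_norm_sum _ _ _))//.
rewrite [leRHS](_ : _ = \sum_(i : I) L * d); last first.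
  by rewrite sumr_const -[RHS]mulr_natl mulrCA.
apply: ler_sum => i _.
have iu : leb.-integrable (D i) (EFin \o (fun x => f (c i) * u x)).
  exact: (@integrable_mul_cell _ (fun=> f (c i)) `|f (c i)|).
have idu : leb.-integrable (D i) (EFin \o (fun x => `|x - c i| * u x)).
  apply: (@bounded_integrable_cell _ _ Cu).
    apply: measurable_funM => //; apply: measurableT_comp => //.
    exact: measurable_funB.
  by move=> x Dx; rewrite normrM normr_id -[leRHS]mul1r ler_pM// Dc.
have -> : a * f (c i) = \int[leb]_(x in D i) (f (c i) * u x).
  rewrite RintegralZl//; first by rewrite Du mulrC.
  apply: (@bounded_integrable_cell _ _ Cu) => //.
rewrite -(RintegralB (mD i) (integrable_mul_cell i mf fC) iu).
have ifu : leb.-integrable (D i) (EFin \o (fun x => f x * u x - f (c i) * u x)).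
  apply: eq_integrable (integrableB (mD i) (integrable_mul_cell i mf fC) iu) => //.
rewrite (le_trans (le_normr_Rintegral (mD i) ifu))//.
rewrite (@le_trans _ _ (\int[leb]_(x in D i) (L * (`|x - c i| * u x))))//.
  apply: le_Rintegral => //.
  - exact: integrable_norm ifu.
  - exact: integrableZl idu.
  - move=> x _; rewrite -mulrBl normrM (ger0_norm (u0 x)) mulrA.
    by rewrite ler_wpM2r.
by rewrite RintegralZl// ler_wpM2l.
Qed.

End cells.

(** * Cosine integrals and a lower bound for the sine *)

Section trigonometry.
Context {R : realType}.
Implicit Types x y : R.

Lemma FTC_half_open (F f : R -> R) (a b : R) : a < b ->
  (forall x, is_derive x 1 F (f x)) -> continuous f ->
  \int[lebesgue_measure]_(x in `[a, b[) f x = F b - F a.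
Proof.
move=> ab dF cf.
have wf : {within `[a, b], continuous f} by apply: continuous_subspaceT.
have cF x : {for x, continuous F}.
  by apply: differentiable_continuous; apply/derivable1_diffP; have [] := dF x.
have intf : lebesgue_measure.-integrable `[a, b] (EFin \o f).
  by apply: continuous_compact_integrable => //; exact: segment_compact.
rewrite Rintegral_itv_bndo_bndc; last first.
  apply: (integrableS _ _ _ intf) => //.
  exact: subset_itv_co_cc.
rewrite /Rintegral (continuous_FTC2 ab wf (F := F)) ?fineB//.
- split.
  + by move=> x _; have [] := dF x.
  + exact: cvg_at_right_filter (cF a).
  + exact: cvg_at_left_filter (cF b).
- by move=> x _; rewrite derive1E; have [_] := dF x.
Qed.

Lemma integral_cos_period (k c r : R) : k != 0 -> 0 < r -> sin (k * (c - r)) = sin (k * (c + r)) ->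
  \int[lebesgue_measure]_(x in `[c - r, c + r[) cos (k * x) = 0.
Proof.
move=> k0 r0 per.
transitivity (k^-1 * sin (k * (c + r)) - k^-1 * sin (k * (c - r))); last by rewrite per subrr.
apply: (@FTC_half_open (fun x => k^-1 * sin (k * x))).
- by rewrite ltrD2l gtrN.
- move=> x; have dk : is_derive x 1 (fun x : R => k * x) k.
    by have := is_deriveZ k (is_derive_id x (1 : R)); rewrite /GRing.scale/= mulr1.
  have := is_deriveZ k^-1 (is_derive1_comp (is_derive_sin (k * x)) dk).
  by rewrite /GRing.scale/= mulrCA mulVf// mulr1.
- move=> x; apply: continuous_comp; first exact: mulrl_continuous.
  exact: continuous_cos.
Qed.

(** With y = 2z the mean value theorem gives sin z >= z cos(pi/4), so sin 2z = 2 sin z cos z >= 2z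
    cos(pi/4)^2 = z. *)
Lemma sin_lower y : 0 <= y <= pi / 2 -> y / 2 <= sin y.
Proof.
move=> /andP[y0 yp].
set z := y / 2; have z0 : 0 <= z by rewrite divr_ge0.
have zp : z <= pi / 4 by rewrite /z; lra.
have yE : y = z *+ 2 by rewrite /z -mulr_natr divfK.
have p0 := pi_gt0 R.
have c4 : cos (pi / 4) ^+ 2 = 1 / 2 :> R.
  have := cos_mulr2n (pi / 4 : R); rewrite (_ : pi / 4 *+ 2 = pi / 2); last by lra.
  by rewrite cos_pihalf; lra.
have c40 : 0 <= cos (pi / 4) :> R by apply: cos_ge0_pihalf; lra.
have cz (t : R) : 0 <= t -> t <= pi / 4 -> cos (pi / 4) <= cos t.
  by move=> t0 tp; rewrite leNgt ltr_cos -?leNgt// in_itv/=; apply/andP; split; lra.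
have sz : z * cos (pi / 4) <= sin z.
  have sd x : x \in `]0, z[%R -> is_derive x 1 (@sin R) (cos x).
    by move=> _; exact: is_derive_sin.
  have sc : {within `[0, z], continuous (@sin R)}.
    by apply: continuous_subspaceT => x; exact: continuous_sin.
  have [x xz] := MVT_segment z0 sd sc.
  rewrite sin0 !subr0 => ->; rewrite mulrC ler_wpM2r//.
  by move: xz; rewrite in_itv/= => /andP[x0 xz]; apply: cz => //; exact: le_trans zp.
rewrite yE sin_mulr2n -mulr_natl.
have h1 := cz z z0 zp.
have : cos (pi / 4) * (z * cos (pi / 4)) <= cos z * sin z.
  by rewrite ler_pM// mulr_ge0.
rewrite mulrCA -expr2 c4; lra.
Qed.

End trigonometry.

(** * Symmetric integer ranges *)

Section centered.
(* 'I_(2B+1) indexes the integers of [-B, B] through i |-> i - B. *)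
Definition centered (B : nat) (i : 'I_(B.*2.+1)) : int := i%:Z - B%:Z.

Lemma centered_rev B (i : 'I_(B.*2.+1)) : centered (rev_ord i) = - centered i.
Proof. by have := ltn_ord i; rewrite /centered /=; lia. Qed.

Lemma centered_inj B : injective (@centered B).
Proof. by move=> i j; rewrite /centered => /addIr[] /val_inj. Qed.

Lemma centered_le B (i : 'I_(B.*2.+1)) : `|centered i| <= B%:Z.
Proof. by have := ltn_ord i; rewrite /centered; lia. Qed.

Lemma centered_ex B (v : int) : `|v| <= B%:Z -> exists i : 'I_(B.*2.+1), centered i = v.
Proof.
move=> vB; have h : (`|(v + B%:Z)%R|%N < B.*2.+1)%N by lia.
by exists (Ordinal h); rewrite /centered /=; lia.
Qed.

Lemma sum_centeredS (V : nmodType) (G : int -> V) B :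
  \sum_(i < B.+1.*2.+1) G (centered i) =
  (G (- B.+1%:Z) + \sum_(i < B.*2.+1) G (centered i) + G B.+1%:Z)%R.
Proof.
rewrite big_ord_recl big_ord_recr /= addrA; congr (_ + _ + _).
- by congr G; rewrite /centered /=; lia.
- apply: eq_bigr => i _; congr G; rewrite /centered /= /bump leq0n add1n.
  by move: (nat_of_ord i) => k; lia.
- by congr G; rewrite /centered /= /bump leq0n add1n -/(double B); lia.
Qed.

End centered.

(** * The Fejer kernel *)

Section fejer_kernel.
Context {R : realType}.
Implicit Types (s x y : R) (M : nat).

Definition fejer_coef M (v : int) : R := 1 - `|v|%:~R / M.+1%:R.

Definition fejer M s : R :=
  \sum_(i < M.*2.+1) fejer_coef M (centered i) * cos (2 * pi * ((centered i)%:~R * s)).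

Lemma fejer_coef_ge0 M (i : 'I_(M.*2.+1)) : 0 <= fejer_coef M (centered i).
Proof.
rewrite subr_ge0 ler_pdivrMr ?ltr0n// mul1r -[M.+1%:R]/(M.+1%:Z%:~R) ler_int.
by have := centered_le i; lia.
Qed.

Lemma fejer_coef_le1 M v : fejer_coef M v <= 1.
Proof. by rewrite gerBl divr_ge0// ler0z. Qed.

Lemma dirichlet_sin M x :
  (\sum_(i < M.*2.+1) cos ((centered i)%:~R * (x *+ 2))) * sin x = sin (M.*2.+1%:R * x).
Proof.
elim: M => [|M ih].
  by rewrite big_ord1 /centered subrr mul0r cos0 !mul1r.
rewrite (sum_centeredS (fun v : int => cos (v%:~R * (x *+ 2)))).
rewrite [LHS]mulrDl [X in X + _ = _]mulrDl ih.
rewrite mulrNz mulNr cosN.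
have -> : sin (M.+1.*2.+1%:R * x) = sin (M.+1%:R * (x *+ 2) + x).
  by congr sin; rewrite -mulr_natl doubleS -!natr1 -muln2 natrM; ring.
have -> : sin (M.*2.+1%:R * x) = sin (M.+1%:R * (x *+ 2) + - x).
  by congr sin; rewrite -mulr_natl -!natr1 -muln2 natrM; ring.
rewrite !sinD cosN sinN -[M.+1%:Z%:~R]/(M.+1%:R); ring.
Qed.

(** Passing from M to M + 1 adds a Dirichlet kernel, and sin(a + b) sin(a - b) = sin(a)^2 - sin(b)^2
    makes the closed forms telescope. *)
Lemma fejer_sin M x :
  (\sum_(i < M.*2.+1) (M.+1%:R - `|centered i|%:~R) * cos ((centered i)%:~R * (x *+ 2)))
    * sin x ^+ 2 = sin (M.+1%:R * x) ^+ 2.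
Proof.
elim: M => [|M ih].
  by rewrite big_ord1 /centered subrr mul0r cos0 normr0 subr0 !mul1r.
pose G (v : int) : R := (M.+2%:R - `|v|%:~R) * cos (v%:~R * (x *+ 2)).
rewrite -[X in X * _]/(\sum_(i < M.+1.*2.+1) G (centered i)).
have e : \sum_(i < M.+1.*2.+1) G (centered i) =
   \sum_(i < M.*2.+1) (M.+1%:R - `|centered i|%:~R) * cos ((centered i)%:~R * (x *+ 2)) +
   \sum_(i < M.+1.*2.+1) cos ((centered i)%:~R * (x *+ 2)).
  rewrite (sum_centeredS G) (sum_centeredS (fun v : int => cos (v%:~R * (x *+ 2)))).
  rewrite /G normrN ger0_norm//.
  have -> : M.+2%:R - M.+1%:Z%:~R = 1 :> R by rewrite -[M.+1%:Z%:~R]/(M.+1%:R) -natr1 addrC addKr.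
  rewrite !mul1r [RHS]addrA; congr (_ + _); rewrite [RHS]addrCA; congr (_ + _).
  by rewrite -big_split; apply: eq_bigr => i _; rewrite -natr1 /=; ring.
rewrite e mulrDl ih expr2 mulrA dirichlet_sin.
have key a b : sin (a + b) * sin (a - b) = sin a ^+ 2 - sin b ^+ 2 :> R.
  rewrite !sinD cosN sinN; have := sin2cos2 a; have := sin2cos2 b.
  move: (sin a) (sin b) (cos a) (cos b) => sa sb ca cb hb ha.
  rewrite (_ : _ * _ = sa ^+ 2 * cb ^+ 2 - ca ^+ 2 * sb ^+ 2); last by ring.
  by rewrite ha hb; ring.
have xE : x = M.+2%:R * x - M.+1%:R * x by rewrite -mulrBl -natrB// subSnn mul1r.
have -> : M.+1.*2.+1%:R * x = M.+2%:R * x + M.+1%:R * x.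
  by rewrite -mulrDl -natrD; congr (_%:R * _); lia.
by rewrite [X in _ + _ * sin X]xE key addrC subrK.
Qed.

Lemma sin_mul_eq0 x m : sin x = 0 -> sin (m%:R * x) = 0.
Proof.
move=> s0; elim: m => [|m ih]; first by rewrite mul0r sin0.
by rewrite -natr1 mulrDl mul1r sinD ih s0 mul0r mulr0 addr0.
Qed.

Lemma fejer_sin2 M s :
  fejer M s * sin (pi * s) ^+ 2 = sin (M.+1%:R * (pi * s)) ^+ 2 / M.+1%:R.
Proof.
rewrite -fejer_sin mulrAC; congr (_ * _); rewrite mulr_suml; apply: eq_bigr => i _.
rewrite /fejer_coef [RHS]mulrAC [in RHS]mulrBl divff ?pnatr_eq0//; congr (_ * cos _).
by rewrite -mulr_natl; ring.
Qed.

(** Clear from the closed form unless sin(pi s) = 0, where every cosine in the sum equals 1. *)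
Lemma fejer_ge0 M s : 0 <= fejer M s.
Proof.
have [s0|s0] := eqVneq (sin (pi * s)) 0; last first.
  rewrite -(@pmulr_lge0 _ (sin (pi * s) ^+ 2)) ?fejer_sin2 ?divr_ge0 ?sqr_ge0//.
  by rewrite exprn_even_gt0.
apply: sumr_ge0 => i _; apply: mulr_ge0; first exact: fejer_coef_ge0.
have -> : 2 * pi * ((centered i)%:~R * s) = ((centered i)%:~R * (pi * s)) *+ 2.
  by rewrite -mulr_natl; ring.
rewrite cos_mulr2n cos2sin2.
suff -> : sin ((centered i)%:~R * (pi * s)) = 0 by rewrite expr0n/= subr0 mulr2n addrK.
case: (centered i) => m; first exact: sin_mul_eq0.
by rewrite NegzE mulrNz mulNr sinN -[X in - sin (X * _)]/(m.+1%:R) sin_mul_eq0// oppr0.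
Qed.

Lemma fejer_le M s : `|fejer M s| <= M.*2.+1%:R.
Proof.
rewrite (le_trans (ler_norm_sum _ _ _))// -[X in _ <= X%:R]card_ord -sumr_const.
apply: ler_sum => i _; rewrite normrM ger0_norm ?fejer_coef_ge0//.
rewrite -[leRHS]mul1r ler_pM ?fejer_coef_ge0 ?fejer_coef_le1//.
by rewrite ler_norml cos_geN1 cos_le1.
Qed.

(** By [sin_lower], |sin(pi s)| = sin(pi |y|) >= pi |y| / 2 >= |y|; multiply the closed form
    accordingly. *)
Lemma fejer_decay M s y (k : int) : s = k%:~R + y -> `|y| <= 1 / 2 ->
  y ^+ 2 * fejer M s <= M.+1%:R^-1.
Proof.
move=> sE yh; have p2 := pi_ge2 R; have p0 := pi_gt0 R.
have ysin : y ^+ 2 <= sin (pi * s) ^+ 2.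
  have per (m : nat) (z : R) : sin (z + pi * m%:R) ^+ 2 = sin z ^+ 2.
    elim: m => [|m ih]; first by rewrite mulr0 addr0.
    by rewrite -natr1 mulrDr mulr1 addrA sinDpi sqrrN ih.
  have -> : sin (pi * s) ^+ 2 = sin (pi * `|y|) ^+ 2.
    have -> : sin (pi * `|y|) ^+ 2 = sin (pi * y) ^+ 2.
      by have [//|_] := ger0P y; rewrite mulrN sinN sqrrN.
    rewrite sE mulrDr addrC; case: k {sE} => m; first exact: per.
    by rewrite -(per m.+1) NegzE mulrNz mulrN subrK.
  rewrite -[y ^+ 2]real_normK ?num_real// ler_sqr ?nnegrE//; last first.
    by apply: sin_ge0_pi; rewrite mulr_ge0 ?(ltW p0)//=; nra.
  have h : 0 <= pi * `|y| <= pi / 2.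
    by rewrite mulr_ge0 ?(ltW p0)//=; nra.
  by apply: le_trans (sin_lower h); have := normr_ge0 y; nra.
rewrite (le_trans (ler_wpM2r (fejer_ge0 M s) ysin))// mulrC fejer_sin2.
rewrite ler_pdivrMr ?ltr0n// mulVf ?pnatr_eq0//.
Qed.

End fejer_kernel.

(** * Riemann sums and Fejer limits on the grid of mesh 1/N *)

Section grid.
Context {R : realType} (N B : nat).
Hypothesis N_gt0 : (0 < N)%N.
Local Notation RR := (measurableTypeR R).
Local Notation RT m := (m.-tuple RR).
Local Notation leb := (@lebesgue_measure R).
Local Notation I := 'I_(B.*2.+1).

Let N0 : 0 < N%:R :> R. Proof. by rewrite ltr0n. Qed.

Definition node (i : I) : R := (centered i)%:~R / N%:R.
Definition radius : R := (2 * N%:R)^-1.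
Definition cell (i : I) : set RR := `[node i - radius, node i + radius[%classic.

Let r0 : 0 < radius. Proof. by rewrite invr_gt0 mulr_gt0. Qed.

Let Nr : N%:R * radius = 1 / 2.
Proof. by rewrite /radius invfM mulrCA divff ?gt_eqF// mul1r mulr1. Qed.

Let mcell i : measurable (cell i). Proof. exact: measurable_itv. Qed.

Let leb_cell i : leb (cell i) = (N%:R^-1)%:E.
Proof.
rewrite /cell lebesgue_measure_itv/= lte_fin ltrD2l gtrN// -EFinD; congr EFin.
apply: (mulfI (lt0r_neq0 N0)); rewrite divff ?gt_eqF//.
by rewrite opprD opprK addrACA subrr add0r mulrDr Nr; lra.
Qed.

Let fin_cell i : (leb (cell i) < +oo)%E.
Proof. by rewrite leb_cell ltry. Qed.

Lemma cell_dist i x : cell i x -> `|x - node i| <= radius.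
Proof. by rewrite /cell /= in_itv/= => /andP[h1 h2]; rewrite ler_norml; lra. Qed.

Let cell_dist1 i x : cell i x -> `|x - node i| <= 1.
Proof.
move=> /cell_dist /le_trans; apply; rewrite -(ler_pM2l N0) Nr mulr1.
by have : 1 <= N%:R :> R; [rewrite ler1n|lra].
Qed.

Let int_cst_cell i (k : R) : \int[leb]_(x in cell i) k = k / N%:R.
Proof. by rewrite Rintegral_cst//; congr (_ * _); exact: (congr1 fine (leb_cell i)). Qed.

(** The half-open cells are disjoint, and x lies in the one indexed by floor(Nx + 1/2), which the
    bound on |x| places in [-B, B]. *)
Lemma grid_cover (u : R -> R) x : `|x| * N%:R <= B%:R -> cell_weight cell u x = u x.
Proof.
move=> xB; set k := Num.floor (N%:R * x + 1 / 2).
have /andP[k1 k2] : k%:~R <= N%:R * x + 1 / 2 < (k + 1)%:~R by exact: floor_itv.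
have inE' i : cell i x <-> centered i = k.
  rewrite /cell /= in_itv/= /node.
  have e1 : (centered i)%:~R = N%:R * ((centered i)%:~R / N%:R) :> R.
    by rewrite mulrCA divff ?gt_eqF// mulr1.
  set c := _ / _ in e1 *; split => [/andP[h1 h2]|h].
    apply/esym/floor_def; rewrite intrD e1; apply/andP; split.
      by move: h1; rewrite -(ler_pM2l N0) mulrBr Nr; lra.
    by move: h2; rewrite -(ltr_pM2l N0) mulrDr Nr; lra.
  rewrite -h intrD e1 in k1 k2; apply/andP; split.
    by rewrite -(ler_pM2l N0) mulrBr Nr; lra.
  by rewrite -(ltr_pM2l N0) mulrDr Nr; lra.
have kB : `|k| <= B%:Z.
  move: xB; rewrite -[X in _ * X](ger0_norm (ltW N0)) -normrM mulrC ler_norml => /andP[h1 h2].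
  rewrite intrD in k2.
  have l1 : - B%:Z <= k.
    by rewrite -ltzD1 -(ltr_int R) intrD mulrNz -[B%:Z%:~R]/(B%:R); lra.
  have l2 : k <= B%:Z.
    by rewrite -ltzD1 -(ltr_int R) intrD -[B%:Z%:~R]/(B%:R); lra.
  by rewrite ler_norml l1 l2.
have [i iE] := centered_ex kB.
rewrite /cell_weight (bigD1 i)//= big1 ?addr0 => [|j ji].
  by rewrite /patch mem_set//; exact/inE'.
rewrite /patch memNset// => /inE' jE; move/eqP: ji; apply.
by apply: centered_inj; rewrite jE.
Qed.

Definition grid_supported m (h : m.-tuple R -> R) : Prop :=
  forall t, h t != 0 -> forall i, `|tnth t i| * N%:R <= B%:R.

Lemma wint_grid m (h : m.-tuple R -> R) (u : R -> R) : grid_supported h ->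
  wint (cell_weight cell u) h = \int[lebesgue_tuple R m]_t (h t * \prod_(i < m) u (tnth t i)).
Proof.
move=> hS; apply: eq_Rintegral => t _.
have [->|ht] := eqVneq (h t) 0; first by rewrite !mul0r.
congr (_ * _); apply: eq_bigr => i _; exact/grid_cover/hS.
Qed.

(** The quadrature with weight 1: a cell has mass 1/N and first moment at most [radius / N]. *)
Theorem riemann_sum m (h : m.-tuple R -> R) L C : 0 <= L -> lip L h ->
  (forall t, `|h t| <= C) -> grid_supported h ->
  `| \int[lebesgue_tuple R m]_t h t - N%:R^-1 ^+ m * \sum_(t : m.-tuple I) h (map_tuple node t)|
    <= L * (B.*2.+1%:R * (radius / N%:R)) * m%:R * (1 + N%:R^-1 * B.*2.+1%:R) ^+ m.
Proof.
move=> L0 hL hC hS.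
have m1 : measurable_fun setT ((fun=> 1) : RR -> R) by exact: measurable_cst.
have n1 (x : R) : `|1 : R| <= 1 by rewrite normr1.
have p1 (x : R) : 0 <= 1 :> R by [].
have Du i : \int[leb]_(x in cell i) 1 = N%:R^-1 :> R by rewrite int_cst_cell mul1r.
have Dd i : \int[leb]_(x in cell i) (`|x - node i| * 1) <= radius / N%:R.
  rewrite -(int_cst_cell i); apply: le_Rintegral => //.
  - apply: (bounded_integrable_cell mcell fin_cell (C := 1)).
      apply: measurable_funM => //; apply: measurableT_comp => //.
      exact: measurable_funB.
    by move=> x cx; rewrite mulr1 normr_id cell_dist1.
  - exact: (bounded_integrable_cell mcell fin_cell (C := `|radius|)).
  - by move=> x cx; rewrite mulr1 cell_dist.
have d0 : 0 <= B.*2.+1%:R * (radius / N%:R) :> R by rewrite mulr_ge0// divr_ge0// ltW.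
have := @quadrature R I (cell_weight cell (fun=> 1)) node N%:R^-1
  (B.*2.+1%:R * (radius / N%:R)) (cell_weight_ge0 cell p1) (measurable_cell_weight mcell m1)
  (integrable_cell_weight mcell fin_cell m1 n1) _ d0
  (cell_weight_total mcell fin_cell m1 n1 Du) _ m h L C L0 hL hC.
rewrite card_ord wint_grid// => H.
have -> : \int[lebesgue_tuple R m]_t h t =
    \int[lebesgue_tuple R m]_t (h t * \prod_(i < m) (fun=> 1 : R) (tnth t i)).
  by apply: eq_Rintegral => t _; rewrite big1 ?mulr1.
apply: H; first by rewrite invr_ge0 ltW.
move=> f L' C' L'0 fL fC.
have := cell_quadrature mcell fin_cell m1 p1 n1 cell_dist1 Du Dd L'0 fL fC.
by rewrite card_ord.
Qed.

(* Splitting |x - c| <= e + (x - c)^2 / e trades the first moment of the Fejer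
   kernel for its mass and its second moment, which is O(1 / M). *)
Theorem fejer_limit m (h : m.-tuple R -> R) L C : 0 <= L -> lip L h ->
  (forall t, `|h t| <= C) -> grid_supported h -> forall e : R, 0 < e -> forall M : nat,
  `| \int[lebesgue_tuple R m]_t (h t * \prod_(i < m) fejer M (N%:R * tnth t i)) -
     N%:R^-1 ^+ m * \sum_(t : m.-tuple I) h (map_tuple node t)|
    <= L * (B.*2.+1%:R * (e + e^-1 / M.+1%:R)) * m%:R * (1 + N%:R^-1 * B.*2.+1%:R) ^+ m.
Proof.
move=> L0 hL hC hS e e0 M.
pose u x := fejer M (N%:R * x : R).
have u0 x : 0 <= u x by exact: fejer_ge0.
have uC x : `|u x| <= M.*2.+1%:R by exact: fejer_le.
have mcos (k : R) : measurable_fun setT ((fun x => cos (k * x)) : RR -> R).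
  apply: continuous_measurable_fun => x; apply: continuous_comp.
    exact: mulrl_continuous.
  exact: continuous_cos.
pose fr (v : int) : R := 2 * pi * v%:~R * N%:R.
have uE x : u x = \sum_(j < M.*2.+1) fejer_coef M (centered j) * cos (fr (centered j) * x).
  by apply: eq_bigr => j _; congr (_ * cos _); rewrite /fr; ring.
have mu : measurable_fun setT (u : RR -> R).
  rewrite (_ : u = fun x => \sum_(j < M.*2.+1) fejer_coef M (centered j) * cos (fr (centered j) * x)).
    by apply: measurable_sum => j; apply: measurable_funM.
  by apply/funext => x; exact: uE.
have icos i (k : R) : leb.-integrable (cell i) (EFin \o (fun x => cos (k * x))).
  apply: (bounded_integrable_cell mcell fin_cell (C := 1)) => // x _.
  by rewrite ler_norml cos_geN1 cos_le1.
have sin_per (z : R) (v : int) : sin (z + 2 * pi * v%:~R) = sin z.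
  have pn (y : R) (l : nat) : sin (y + 2 * pi * l%:R) = sin y.
    elim: l => [|l ih]; first by rewrite mulr0 addr0.
    have -> : y + 2 * pi * l.+1%:R = y + 2 * pi * l%:R + pi *+ 2.
      by rewrite -natr1 -mulr_natl; ring.
    by rewrite sinD2pi.
  case: v => l; first exact: pn.
  by rewrite -(pn _ l.+1); congr sin; rewrite NegzE mulrNz mulrN subrK.
(* For v != 0 a cell holds |v| full periods of the cosine. Hence only frequency 0 survives and the
   Fejer weight has mass 1/N on each cell. *)
have icosE i (v : int) : \int[leb]_(x in cell i) cos (fr v * x) = (v == 0)%:R / N%:R.
  have [->|v0] := eqVneq v 0.
    rewrite -(int_cst_cell i); apply: eq_Rintegral => x _.
    by rewrite /fr mulr0 !mul0r cos0.
  rewrite mul0r /cell integral_cos_period//.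
    rewrite /fr mulf_neq0 ?(lt0r_neq0 N0)// mulf_neq0 ?intr_eq0//.
    by rewrite mulf_neq0 ?pnatr_eq0// (lt0r_neq0 (pi_gt0 R)).
  rewrite -(sin_per _ v); congr sin.
  rewrite (_ : 2 * pi * v%:~R = fr v * (2 * radius)); first by ring.
  by rewrite /fr /radius; field; rewrite lt0r_neq0.
have Du i : \int[leb]_(x in cell i) u x = N%:R^-1.
  transitivity (\sum_(j < M.*2.+1) fejer_coef M (centered j) *
      \int[leb]_(x in cell i) cos (fr (centered j) * x)).
    have : forall r : seq 'I_(M.*2.+1),
       leb.-integrable (cell i) (EFin \o (fun x => \sum_(j <- r) fejer_coef M (centered j) *
          cos (fr (centered j) * x))) /\
       \int[leb]_(x in cell i) (\sum_(j <- r) fejer_coef M (centered j) *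
          cos (fr (centered j) * x)) =
       \sum_(j <- r) fejer_coef M (centered j) *
         \int[leb]_(x in cell i) cos (fr (centered j) * x).
      elim=> [|j r [ih1 ih2]].
        split; first by apply: eq_integrable (integrable0 _ _) => //= x _; rewrite big_nil.
        rewrite big_nil -[RHS](mul0r (N%:R^-1)) -(int_cst_cell i).
        by apply: eq_Rintegral => x _; rewrite big_nil.
      have ij := integrableZl (mcell i) (fejer_coef M (centered j)) (icos i (fr (centered j))).
      split.
        apply: eq_integrable (integrableD (mcell i) ij ih1) => //= x _.
        by rewrite big_cons EFinD.
      rewrite big_cons -ih2 -(RintegralZl _ (mcell i) (icos i _)).
      rewrite -(RintegralD (mcell i) ij ih1).
      by apply: eq_Rintegral => x _; rewrite big_cons.
    move=> /(_ (index_enum _))[_ <-]; apply: eq_Rintegral => x _; exact: uE.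
  have [j0 j0E] : exists j : 'I_(M.*2.+1), centered j = 0 by exact: centered_ex.
  rewrite (bigD1 j0)//= big1 => [|j jj0].
    by rewrite addr0 icosE j0E eqxx /fejer_coef normr0 mul0r subr0 !mul1r.
  rewrite icosE (_ : (centered j == 0) = false) ?mul0r ?mulr0//.
  by apply/negbTE; apply: contraNneq jj0 => jE; apply/eqP/centered_inj; rewrite jE.
have Dd i : \int[leb]_(x in cell i) (`|x - node i| * u x) <= e + e^-1 / M.+1%:R.
  have key x : cell i x -> `|x - node i| * u x <= e * u x + e^-1 / M.+1%:R.
    move=> cx; have xr := cell_dist cx; set y := x - node i in xr *.
    have yN : `|N%:R * y| <= 1 / 2.
      by rewrite normrM (ger0_norm (ltW N0)) -Nr ler_pM2l.
    have NxE : N%:R * x = (centered i)%:~R + N%:R * y.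
      by rewrite /y mulrBr /node mulrCA divff ?gt_eqF// mulr1 addrC subrK.
    have := fejer_decay M NxE yN; rewrite -/(u x) => dec.
    have y2 : y ^+ 2 * u x <= M.+1%:R^-1.
      apply: le_trans dec; rewrite ler_wpM2r// exprMn ler_peMl ?sqr_ge0//.
      by rewrite exprn_ege1// ler1n.
    have am : `|y| <= e + e^-1 * y ^+ 2.
      rewrite -(ler_pM2l e0) mulrDr mulrA divff ?gt_eqF// mul1r -[y ^+ 2]real_normK ?num_real//.
      have := sqr_ge0 (`|y| - e); have := sqr_ge0 e; have := sqr_ge0 `|y|; nra.
    rewrite (le_trans (ler_wpM2r (u0 x) am))// mulrDl lerD2l -mulrA.
    by rewrite ler_wpM2l// invr_ge0 ltW.
  have i1 : leb.-integrable (cell i) (EFin \o u).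
    exact: (bounded_integrable_cell mcell fin_cell mu (fun x _ => uC x)).
  have i2 := integrableZl (mcell i) e i1.
  have i3 : leb.-integrable (cell i) (EFin \o (fun=> e^-1 / M.+1%:R)).
    exact: (bounded_integrable_cell mcell fin_cell (C := `|e^-1 / M.+1%:R|)).
  rewrite (@le_trans _ _ (\int[leb]_(x in cell i) (e * u x + e^-1 / M.+1%:R)))//.
    apply: le_Rintegral => //.
    - apply: (bounded_integrable_cell mcell fin_cell (C := M.*2.+1%:R)).
        apply: measurable_funM => //; apply: measurableT_comp => //.
        exact: measurable_funB.
      move=> x cx; rewrite normrM normr_id -[leRHS]mul1r ler_pM// cell_dist1//.
    - by apply: eq_integrable (integrableD (mcell i) i2 i3).
  rewrite (RintegralD (mcell i) i2 i3) (RintegralZl _ (mcell i) i1) Du int_cst_cell.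
  have N1 : N%:R^-1 <= 1 :> R by rewrite invf_le1 ?ler1n.
  apply: lerD; first by rewrite ler_piMr// ltW.
  by rewrite ler_piMr// divr_ge0// invr_ge0 ltW.
have ed0 : 0 <= e + e^-1 / M.+1%:R.
  by rewrite addr_ge0 ?divr_ge0 ?invr_ge0// ltW.
have d0 : 0 <= B.*2.+1%:R * (e + e^-1 / M.+1%:R) by rewrite mulr_ge0.
have := @quadrature R I (cell_weight cell u) node N%:R^-1
  (B.*2.+1%:R * (e + e^-1 / M.+1%:R)) (cell_weight_ge0 cell u0) (measurable_cell_weight mcell mu)
  (integrable_cell_weight mcell fin_cell mu uC) _ d0
  (cell_weight_total mcell fin_cell mu uC Du) _ m h L C L0 hL hC.
rewrite card_ord wint_grid//; apply; first by rewrite invr_ge0 ltW.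
move=> f L' C' L'0 fL fC.
have := cell_quadrature mcell fin_cell mu u0 uC cell_dist1 Du Dd L'0 fL fC.
by rewrite card_ord.
Qed.

End grid.

(** * Unordered lattice sums as limits of Cesaro means *)

Section box_sums.
Context {R : realType} {n : nat}.
Local Notation box M := (n.-tuple 'I_(M.*2.+1)).
Implicit Types (f : 'rV[int]_n -> R) (M : nat).

Definition box_point M (v : box M) : 'rV[int]_n := \row_i centered (tnth v i).

Lemma box_point_inj M : injective (@box_point M).
Proof.
move=> v w /rowP vw; apply: eq_from_tnth => i; have := vw i.
by rewrite !mxE => /centered_inj.
Qed.

Lemma box_point_ex M (u : 'rV[int]_n) : (forall i, `|u 0 i| <= M%:Z) ->
  exists v : box M, box_point v = u.
Proof.
move=> uM; have uE i : exists j : 'I_(M.*2.+1), centered j == u 0 i.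
  by have [j jE] := centered_ex (uM i); exists j; apply/eqP.
exists [tuple xchoose (uE i) | i < n]; apply/rowP => i; rewrite mxE tnth_mktuple.
exact/eqP/(xchooseP (uE i)).
Qed.

Definition box_sum f M : R := \sum_(v : box M) f (box_point v).

(** Cesaro means are used because the corresponding sums of characters are nonnegative kernels, as
    the weight in [quadrature] must be. *)
Definition fejer_sum f M : R :=
  \sum_(v : box M) (\prod_i fejer_coef M (centered (tnth v i))) * f (box_point v).

Lemma box_sumE f M : box_sum f M = \sum_(u <- [seq box_point v | v : box M]) f u.
Proof. by rewrite big_map big_enum. Qed.

Lemma sum_sub_box f M (s : seq 'rV[int]_n) : (forall u, 0 <= f u) -> uniq s ->
  (forall u, u \in s -> forall i, `|u 0 i| <= M%:Z) -> \sum_(u <- s) f u <= box_sum f M.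
Proof.
move=> f0 us sM; rewrite box_sumE.
have bu : uniq [seq box_point v | v : box M].
  by rewrite map_inj_uniq ?enum_uniq//; exact: box_point_inj.
rewrite [leRHS](bigID (fun u => u \in s))/= -[leLHS]addr0; apply: lerD; last exact: sumr_ge0.
rewrite -[leRHS]big_filter le_eqVlt; apply/orP; left; apply/eqP; apply: perm_big.
apply: uniq_perm => //; first exact: filter_uniq.
move=> u; rewrite mem_filter; have [us'|//] := boolP (u \in s).
have [v <-] := box_point_ex (sM u us').
by apply/esym/mapP; exists v; rewrite ?mem_enum.
Qed.

Lemma fejer_sum_le f M : (forall u, 0 <= f u) -> fejer_sum f M <= box_sum f M.
Proof.
move=> f0; apply: ler_sum => v _; rewrite ler_piMl//.
apply: prodr_ile1 => i _; rewrite fejer_coef_ge0 fejer_coef_le1//.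
Qed.

(** On the box of size M0 each of the n Fejer coefficients is at least 1 - M0/(M+1). *)
Lemma fejer_sum_ge f M0 M : (forall u, 0 <= f u) -> (M0 <= M)%N ->
  (1 - M0%:R / M.+1%:R) ^+ n * box_sum f M0 <= fejer_sum f M.
Proof.
move=> f0 M0M.
pose g (u : 'rV[int]_n) := (\prod_i fejer_coef M (u 0 i)) * f u.
have -> : fejer_sum f M = \sum_(u <- [seq box_point v | v : box M]) g u.
  rewrite big_map big_enum; apply: eq_bigr => v _; congr (_ * _).
  by apply: eq_bigr => i _; rewrite mxE.
have q0 : 0 <= 1 - M0%:R / M.+1%:R :> R.
  by rewrite subr_ge0 ler_pdivrMr ?ltr0n// mul1r ler_nat leqW.
pose P (u : 'rV[int]_n) := [forall i, `|u 0 i| <= M%:Z].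
have g0 u : P u -> 0 <= g u.
  move=> /forallP Pu; apply: mulr_ge0 => //; apply: prodr_ge0 => i _.
  have [j <-] := centered_ex (Pu i); exact: fejer_coef_ge0.
rewrite box_sumE mulr_sumr.
apply: (@le_trans _ _ (\sum_(u <- [seq box_point v | v : box M0]) g u)).
  rewrite big_map big_enum_cond [leRHS]big_map [leRHS]big_enum_cond.
  apply: ler_sum => v _; rewrite /g ler_wpM2r//.
  rewrite -[X in _ ^+ X]card_ord -prodr_const; apply: ler_prod => i _.
  rewrite q0 /fejer_coef lerD2l lerN2 ler_wpM2r// mxE -[M0%:R]/(M0%:Z%:~R) ler_int.
  exact: centered_le.
(* Outside the box of size M the product of coefficients can be negative, while [sum_sub_box] asks
   for a nonnegative function. *)
pose g' u := if P u then g u else 0.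
have gg' M1 : (M1 <= M)%N -> \sum_(u <- [seq box_point v | v : box M1]) g u = box_sum g' M1.
  move=> M1M; rewrite box_sumE !big_map; apply: eq_bigr => v _; rewrite /g' ifT//.
  by apply/forallP => i; rewrite mxE (le_trans (centered_le _)).
rewrite !gg'// [box_sum g' M0]box_sumE; apply: sum_sub_box.
- by move=> u; rewrite /g'; case: ifP => // /g0.
- by rewrite map_inj_uniq ?enum_uniq//; exact: box_point_inj.
- move=> _ /mapP[v _ ->] i; rewrite mxE (le_trans (centered_le _))//.
Qed.

(** Some box sum comes within e/2 of the supremum; [fejer_sum_ge] on that box and the upper bound by
    box sums squeeze the Cesaro means. *)
Lemma fejer_sum_cvg_ge0 f C : (forall u, 0 <= f u) -> (forall M, box_sum f M <= C) ->
  fejer_sum f @ \oo --> fine (\esum_(u in setT) (f u)%:E)%E.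
Proof.
move=> f0 fC; set S := (\esum_(u in setT) _)%E.
have seqS (s : seq 'rV[int]_n) : uniq s -> ((\sum_(u <- s) f u)%:E <= S)%E.
  move=> us; apply: ereal_sup_ubound; exists [set` s]; last first.
    by rewrite -fsbig_seq// sumEFin.
  by split => //; exact: finite_seq.
have bS M : ((box_sum f M)%:E <= S)%E.
  rewrite box_sumE; apply: seqS.
  by rewrite map_inj_uniq ?enum_uniq//; exact: box_point_inj.
have finite_box (F : set 'rV[int]_n) : finite_set F ->
    exists M, (\sum_(u \in F) (f u)%:E <= (box_sum f M)%:E)%E.
  move=> finF; pose s : seq 'rV[int]_n := finmap.enum_fset (fset_set F).
  exists (\max_(u <- s) \max_i `|u ord0 i|%N)%N.
  rewrite fsbig_finite//= sumEFin lee_fin; apply: sum_sub_box => //; first exact: finmap.fset_uniq.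
  move=> u us i; have : (`|u ord0 i|%N <= \max_(u <- s) \max_i `|u ord0 i|%N)%N.
    apply: (@leq_trans (\max_i `|u ord0 i|%N)).
      exact: (leq_bigmax (F := fun i => `|u ord0 i|%N)).
    by rewrite (big_rem u)//= leq_maxl.
  by move=> h; rewrite -abszE lez_nat.
have SC : (S <= C%:E)%E.
  apply: ub_ereal_sup => _ [F [finF _] <-].
  by have [M /le_trans] := finite_box F finF; apply; rewrite lee_fin.
have S0 : (0 <= S)%E by apply: esum_ge0 => u _; rewrite lee_fin.
have Sfin : S \is a fin_num by rewrite ge0_fin_numE// (le_lt_trans SC)// ltry.
have SE := fineK Sfin; set sg := fine S in SE *.
have bs M : box_sum f M <= sg by rewrite -lee_fin SE.
have sg0 : 0 <= sg by rewrite -lee_fin SE.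
apply/cvgrPdist_le => e e0.
have e2 : 0 < e / 2 by rewrite divr_gt0.
have [M0 M0e] : exists M0, sg - e / 2 <= box_sum f M0.
  have [y [F [finF _] <-] /ltW hF] := ub_ereal_sup_adherent e2 Sfin.
  have [M FM] := finite_box F finF; exists M.
  by rewrite -lee_fin EFinB SE (le_trans hF).
have cq : (fun M => (1 - M0%:R / M.+1%:R) ^+ n * box_sum f M0) @ \oo --> box_sum f M0.
  have c1 : (fun M => 1 - M0%:R / M.+1%:R) @ \oo --> (1 : R).
    rewrite -[X in _ --> X]subr0; apply: cvgB; first exact: cvg_cst.
    rewrite -[X in _ --> X](mulr0 M0%:R); apply: cvgMr; exact: cvg_harmonic.
  have cX k : (fun M => (1 - M0%:R / M.+1%:R) ^+ k) @ \oo --> (1 : R).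
    elim: k => [|k ih]; first by under eq_fun do rewrite expr0; exact: cvg_cst.
    rewrite (_ : (fun M => _) = (fun M => 1 - M0%:R / M.+1%:R) \*
      (fun M => (1 - M0%:R / M.+1%:R) ^+ k)); last by apply/funext => M; rewrite exprS.
    have H := cvgM c1 ih; rewrite mulr1 in H; exact: H.
  by rewrite -[X in _ --> X]mul1r; exact: cvgMl (cX n).
move/cvgrPdist_le : cq => /(_ _ e2) cq; near=> M.
have hM : box_sum f M0 - e / 2 <= (1 - M0%:R / M.+1%:R) ^+ n * box_sum f M0.
  have : `|box_sum f M0 - (1 - M0%:R / M.+1%:R) ^+ n * box_sum f M0| <= e / 2.
    by near: M; exact: cq.
  by rewrite ler_norml; lra.
have M0M : (M0 <= M)%N by near: M; exact: nbhs_infty_ge.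
have h1 := fejer_sum_ge f0 M0M; have h2 := fejer_sum_le M f0; have h3 := bs M.
by rewrite ler_norml; lra.
Unshelve. all: by end_near. Qed.

End box_sums.

Section rsum_limit.
Context {R : realType} {n : nat}.
Implicit Types (f : 'rV[int]_n -> R).

Lemma fejer_sum_cvg f C : (forall M, box_sum (fun u => `|f u|) M <= C) ->
  fejer_sum f @ \oo --> rsum f.
Proof.
move=> fC; rewrite /rsum.
have hp : fejer_sum f^\+ @ \oo --> fine (\esum_(u in setT) (f^\+ u)%:E)%E.
  apply: (@fejer_sum_cvg_ge0 _ _ _ C) => [u|M]; first exact: funrpos_ge0.
  apply: le_trans (fC M); apply: ler_sum => v _.
  by rewrite /funrpos ge_max ler_norm normr_ge0.
have hn : fejer_sum f^\- @ \oo --> fine (\esum_(u in setT) (f^\- u)%:E)%E.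
  apply: (@fejer_sum_cvg_ge0 _ _ _ C) => [u|M]; first exact: funrneg_ge0.
  apply: le_trans (fC M); apply: ler_sum => v _.
  by rewrite /funrneg ge_max normr_ge0 andbT -normrN ler_norm.
have -> : fejer_sum f = fun M => fejer_sum f^\+ M - fejer_sum f^\- M.
  apply/funext => M; rewrite /fejer_sum -sumrB; apply: eq_bigr => v _.
  by rewrite -mulrBr; congr (_ * _); rewrite -[in LHS](funrposBneg f).
rewrite (_ : esum _ (EFin \o f)^\+%E = (\esum_(u in setT) (f^\+ u)%:E)%E).
  rewrite (_ : esum _ (EFin \o f)^\-%E = (\esum_(u in setT) (f^\- u)%:E)%E).
    exact: cvgB hp hn.
  by apply: eq_esum => u _; rewrite funenegE /funrneg /= EFin_max EFinN.
by apply: eq_esum => u _; rewrite funeposE /funrpos /= EFin_max.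
Qed.

End rsum_limit.

(** * Schwartz functions are bounded and Lipschitz *)

Section schwartz_lipschitz.
Context {R : realType} {p : nat}.
Implicit Types (f : 'rV[R]_p -> R) (x y : 'rV[R]_p).

Lemma schwartzR_bounded f : schwartzR f -> exists M : R, forall x, `|f x| <= M.
Proof.
by move=> [_ /(_ 0%N [::])[M hM]]; exists M => x; have := hM x; rewrite expr0 mul1r.
Qed.

Lemma coordinate_increment f (j : 'I_p) M : schwartzR f ->
  (forall x, `|'D_(delta_mx 0 j) f x| <= M) ->
  forall x (t : R), `|f (x + t *: delta_mx 0 j) - f x| <= M * `|t|.
Proof.
move=> [smf _] hM.
have df x : derivable f x (delta_mx 0 j) by have [_ /(_ j x)] := smf [::].
have dg x (s : R) : is_derive s 1 (fun s => f (x + s *: delta_mx 0 j))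
    ('D_(delta_mx 0 j) f (x + s *: delta_mx 0 j)).
  have e : (fun h : R => h^-1 *: (((fun s => f (x + s *: delta_mx 0 j)) \o shift s) (h *: (1 : R)) -
       f (x + s *: delta_mx 0 j))) =
     (fun h : R => h^-1 *: ((f \o shift (x + s *: delta_mx 0 j)) (h *: delta_mx 0 j) -
       f (x + s *: delta_mx 0 j))).
    apply/funext => h /=; congr (_ *: (f _ - _)).
    by rewrite [h *: 1]mulr1 scalerDl addrCA addrC.
  by split; rewrite /derivable /derive e//; exact: df.
have pos x (t : R) : 0 <= t -> `|f (x + t *: delta_mx 0 j) - f x| <= M * t.
  move=> t0.
  have gc : {within `[0, t], continuous (fun s => f (x + s *: delta_mx 0 j))}.
    apply: continuous_subspaceT => s.
    by apply: differentiable_continuous; apply/derivable1_diffP; have [] := dg x s.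
  have [c _] := MVT_segment t0 (fun s _ => dg x s) gc.
  rewrite scale0r addr0 subr0 => ->.
  by rewrite normrM (ger0_norm t0) ler_wpM2r.
move=> x t; have [t0|t0] := leP 0 t; first by rewrite (ger0_norm t0); exact: pos.
have nt : 0 <= - t by rewrite oppr_ge0 ltW.
rewrite distrC (ltr0_norm t0); have := pos (x + t *: delta_mx 0 j) (- t) nt.
by rewrite scaleNr addrK.
Qed.

(** Move from y to x one coordinate at a time, with bounded partial derivatives. *)
Lemma schwartzR_lip f : schwartzR f -> exists2 M : R, 0 <= M &
  forall x y, `|f x - f y| <= M * \sum_i `|x 0 i - y 0 i|.
Proof.
move=> sf.
have exM (j : 'I_p) : exists M : R, forall x, `|'D_(delta_mx 0 j) f x| <= M.
  by have [_ /(_ 0%N [:: j])[M hM]] := sf; exists M => x; have := hM x; rewrite expr0 mul1r.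
have [Mf hMf] := choice exM.
exists (\sum_j `|Mf j|); first exact: sumr_ge0.
move=> x y.
have key (r : seq 'I_p) z : `|f (z + \sum_(j <- r) (x 0 j - y 0 j) *: delta_mx 0 j) - f z|
    <= \sum_(j <- r) (\sum_j `|Mf j|) * `|x 0 j - y 0 j|.
  elim: r z => [|j r ih] z; first by rewrite !big_nil addr0 subrr normr0.
  rewrite !big_cons addrA; set w := z + _.
  rewrite -[X in `|X|](subrKA (f w)) (le_trans (ler_normD _ _))// [leRHS]addrC lerD//.
  rewrite (le_trans (coordinate_increment sf (hMf j) _ _))// ler_wpM2r//.
  by rewrite (le_trans (ler_norm _))// (bigD1 j)//= lerDl sumr_ge0.
have := key (index_enum _) y; rewrite mulr_sumr (_ : y + _ = x)//.
rewrite -[RHS](subrKC y); congr (_ + _); rewrite [RHS]row_sum_delta.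
by apply: eq_bigr => j _; rewrite !mxE.
Qed.

End schwartz_lipschitz.

(** * The algebra of bounded Lipschitz functions *)

Section bounded_lipschitz.
Context {R : realType} {m : nat}.
Implicit Types h g : m.-tuple R -> R.

Definition BL h : Prop := exists L C : R,
  [/\ 0 <= L, lip L h & forall t, `|h t| <= C].

Lemma BL_cst c : BL (fun=> c).
Proof. by exists 0, `|c|; split => // s t; rewrite subrr normr0 mul0r. Qed.

Lemma BLD h g : BL h -> BL g -> BL (fun t => h t + g t).
Proof.
move=> [L [C [L0 hL hC]]] [L' [C' [L0' gL gC]]]; exists (L + L'), (C + C'); split.
- exact: addr_ge0.
- move=> s t; rewrite opprD addrACA mulrDl; apply: (le_trans (ler_normD _ _)).
  by apply: lerD; [exact: hL|exact: gL].
- by move=> t; rewrite (le_trans (ler_normD _ _))// lerD.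
Qed.

Lemma BLM h g : BL h -> BL g -> BL (fun t => h t * g t).
Proof.
move=> [L [C [L0 hL hC]]] [L' [C' [L0' gL gC]]]; exists (C * L' + L * C'), (C * C'); split.
- have C0 : 0 <= C := le_trans (normr_ge0 _) (hC (nseq_tuple m 0)).
  have C0' : 0 <= C' := le_trans (normr_ge0 _) (gC (nseq_tuple m 0)).
  by rewrite addr_ge0// mulr_ge0.
- move=> s t; rewrite (_ : _ - _ = h s * (g s - g t) + (h s - h t) * g t); last by ring.
  rewrite [leRHS]mulrDl; apply: (le_trans (ler_normD _ _)); rewrite !normrM; apply: lerD.
    by rewrite -mulrA ler_pM// gL.
  by rewrite mulrAC ler_pM// hL.
- by move=> t; rewrite normrM ler_pM.
Qed.

Lemma BLN h : BL h -> BL (fun t => - h t).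
Proof.
move=> bh; rewrite (_ : (fun t => _) = fun t => -1 * h t); last first.
  by apply/funext => t; rewrite mulN1r.
by apply: BLM => //; exact: BL_cst.
Qed.

Lemma BL_prod (I : Type) (r : seq I) (F : I -> m.-tuple R -> R) :
  (forall i, BL (F i)) -> BL (fun t => \prod_(i <- r) F i t).
Proof.
move=> bF; elim: r => [|i r ih].
  rewrite (_ : (fun t => _) = fun=> 1); first exact: BL_cst.
  by apply/funext => t; rewrite big_nil.
rewrite (_ : (fun t => _) = fun t => F i t * \prod_(i <- r) F i t); last first.
  by apply/funext => t; rewrite big_cons.
exact: BLM.
Qed.

Lemma BL_schwartz p (f : 'rV[R]_p -> R) (A : m.-tuple R -> 'rV[R]_p) (K : R) :
  schwartzR f -> 0 <= K -> (forall s t i, `|A s 0 i - A t 0 i| <= K * dist1 s t) ->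
  BL (fun t => f (A t)).
Proof.
move=> sf K0 hA; have [M M0 fM] := schwartzR_lip sf.
have [C fC] := schwartzR_bounded sf.
exists (M * (p%:R * K)), C; split => //; first by rewrite !mulr_ge0.
move=> s t; rewrite (le_trans (fM _ _))// -mulrA ler_wpM2l//.
rewrite -mulrA -[p in p%:R]card_ord -sumr_const mulr_suml; apply: ler_sum => i _.
by rewrite mul1r.
Qed.

Lemma BL_cos_sin (l : m.-tuple R -> R) (K : R) : 0 <= K ->
  (forall s t, `|l s - l t| <= K * dist1 s t) ->
  BL (fun t => cos (l t)) /\ BL (fun t => sin (l t)).
Proof.
move=> K0 hl.
have gen (f f' : R -> R) : (forall x : R, is_derive x 1 f (f' x)) -> (forall x, `|f' x| <= 1) ->
    (forall x, `|f x| <= 1) -> BL (fun t => f (l t)).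
  move=> df f'1 f1; exists K, 1; split => // s t.
  have lt x y : x <= y -> `|f y - f x| <= `|y - x|.
    move=> xy; have cf : {within `[x, y], continuous f}.
      apply: continuous_subspaceT => z.
      by apply: differentiable_continuous; apply/derivable1_diffP; have [] := df z.
    have [c _ ->] := MVT_segment xy (fun z _ => df z) cf.
    by rewrite normrM ler_piMl.
  rewrite (le_trans _ (hl s t))//; have [st|/ltW st] := leP (l t) (l s); first exact: lt.
  by rewrite distrC [leRHS]distrC; exact: lt.
have c1 (x : R) : `|cos x| <= 1 by rewrite ler_norml cos_geN1 cos_le1.
have s1 (x : R) : `|sin x| <= 1 by rewrite ler_norml sin_geN1 sin_le1.
split.
  by apply: (gen _ (fun x => - sin x)) => // x; rewrite normrN.
exact: (gen _ cos).
Qed.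

(** The factor |t_j| of the pairing integrals is unbounded; the truncation at 2 agrees with it on
    the support of [Phi]. *)
Lemma BL_min (j : 'I_m) : BL (fun t => Num.min `|tnth t j| 2).
Proof.
exists 1, 2; split => //.
- move=> s t; rewrite mul1r.
  apply: (@le_trans _ _ `|tnth s j - tnth t j|); last first.
    by rewrite /dist1 (bigD1 j)//= lerDl sumr_ge0.
  have := lerB_dist (tnth s j) (tnth t j); have := lerB_dist (tnth t j) (tnth s j).
  rewrite distrC; move: `|tnth s j| `|tnth t j| `|_ - _| => a b d.
  by rewrite ler_norml /Num.min; case: ifP; case: ifP; lra.
- move=> t; rewrite ger0_norm; first by rewrite ge_min lexx orbT.
  by rewrite le_min normr_ge0 ler0n.
Qed.

End bounded_lipschitz.

(** * Characters, hyperplane coordinates and products of sums *)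

Section expi.
Context {R : realType}.
Implicit Types (a b : R).

Lemma expiD a b : expi (a + b) = expi a * expi b.
Proof.
rewrite /expi mulrDr cosD sinD; apply: eq_ReIm; rewrite /=; ring.
Qed.

Lemma expi0 : expi (0 : R) = 1.
Proof. by rewrite /expi mulr0 cos0 sin0. Qed.

Lemma expi_sum (I : Type) (r : seq I) (F : I -> R) :
  expi (\sum_(i <- r) F i) = \prod_(i <- r) expi (F i).
Proof.
elim: r => [|i r ih]; first by rewrite !big_nil expi0.
by rewrite !big_cons expiD ih.
Qed.

(** The sine parts cancel under the reversal of the symmetric range. *)
Lemma expi_fejer M (s : R) :
  \sum_(i < M.*2.+1) (fejer_coef M (centered i) : R)%:C * expi (s * (centered i)%:~R) =
  (fejer M s)%:C.
Proof.
apply: eq_ReIm.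
  rewrite Re_sum; apply: eq_bigr => i _; rewrite Re_mulCl.
  by congr (_ * cos _); ring.
rewrite Im_sum [RHS]/=.
under eq_bigr do rewrite Im_mulCl.
set S := LHS.
suff : S = - S by move=> h; lra.
rewrite {1}/S (reindex_inj rev_ord_inj) /= /S -sumrN; apply: eq_bigr => i _.
rewrite centered_rev /fejer_coef normrN mulrNz -[RHS]mulrN; congr (_ * _).
by rewrite /expi /= -[RHS]sinN; congr sin; ring.
Qed.

End expi.

Section zero_sum_lemmas.
Context {n : nat}.

Lemma extend_row_lift (T : Type) (y : 'rV[T]_n) z i : extend_row y z 0 (lift ord_max i) = y 0 i.
Proof. by rewrite mxE liftK. Qed.

Lemma extend_row_max (T : Type) (y : 'rV[T]_n) z : extend_row y z 0 ord_max = z.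
Proof. by rewrite mxE unlift_none. Qed.

Variable R : realType.

Lemma zero_sum_dist (s t : n.-tuple R) j :
  `|zero_sum (row_of_tuple s) 0 j - zero_sum (row_of_tuple t) 0 j| <= 1 * dist1 s t.
Proof.
rewrite mul1r; case: (unliftP ord_max j) => [i ->|->].
  by rewrite !extend_row_lift !mxE /dist1 (bigD1 i)//= lerDl sumr_ge0.
rewrite !extend_row_max -opprD normrN -sumrB.
by rewrite (le_trans (ler_norm_sum _ _ _))//; apply: ler_sum => i _; rewrite !mxE.
Qed.

End zero_sum_lemmas.

Section tuple_distributivity.

Lemma prod_sum_tuple (K : comNzRingType) (I : finType) m (G : 'I_m -> I -> K) :
  \sum_(v : m.-tuple I) \prod_(i < m) G i (tnth v i) = \prod_(i < m) \sum_j G i j.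
Proof.
elim: m G => [|m ih] G.
  rewrite big_ord0 (big_pred1 [tuple]) ?big_ord0// => v.
  by rewrite (tuple0 v) /= eqxx.
rewrite sum_tupleS big_ord_recl mulr_suml; apply: eq_bigr => j _.
rewrite -ih mulr_sumr; apply: eq_bigr => v _.
rewrite big_ord_recl tnth0; congr (_ * _).
by apply: eq_bigr => i _; rewrite tnthS.
Qed.

End tuple_distributivity.

(** * Identifying the limit of the Cesaro means *)

Section integrability.
Context {R : realType} {m : nat} (N B : nat).
Hypothesis N_gt0 : (0 < N)%N.
Local Notation RT m := (m.-tuple (measurableTypeR R)).

Lemma BL_integrable (h : RT m -> R) : BL h -> grid_supported N B h ->
  (lebesgue_tuple R m).-integrable setT (EFin \o h).
Proof.
move=> [L [C [L0 hL hC]]] hS.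
have N0 : 0 < N%:R :> R by rewrite ltr0n.
have m1 : measurable_fun setT ((fun=> 1) : measurableTypeR R -> R) by exact: measurable_cst.
have n1 (x : R) : `|1 : R| <= 1 by rewrite normr1.
have p1 (x : R) : 0 <= 1 :> R by [].
have mcell (i : 'I_(B.*2.+1)) : measurable (@cell R N B i) by exact: measurable_itv.
have fin_cell i : (@lebesgue_measure R (@cell R N B i) < +oo)%E.
  by rewrite lebesgue_measure_itv/=; case: ifP; rewrite ?ltry// -EFinB ltry.
have := integrable_weighted (cell_weight_ge0 (@cell R N B) p1) (measurable_cell_weight mcell m1)
  (integrable_cell_weight mcell fin_cell m1 n1) (measurable_lip hL) hC.
apply: eq_integrable => //= t _; congr EFin.
have [->|ht] := eqVneq (h t) 0; first by rewrite mul0r.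
rewrite /prod_weight big1 ?mulr1// => i _.
by apply: grid_cover => //; exact: hS.
Qed.

End integrability.

Section fejer_limits.
Context {R : realType}.

(** First M goes to infinity, then e to 0. *)
Lemma cvg_fejer_error (a : nat -> R) (l c D : R) :
  a @ \oo --> l -> (forall e : R, 0 < e -> forall M, `|a M - c| <= D * (e + e^-1 / M.+1%:R)) ->
  l = c.
Proof.
move=> al ac.
have D0 : 0 <= D.
  have := ac 1 ltr01 0%N; rewrite invr1 mul1r => /(le_trans (normr_ge0 _)).
  by rewrite pmulr_lge0// addr_gt0.
have bound e : 0 < e -> `|l - c| <= D * e.
  move=> e0.
  have c1 : (fun M => `|a M - c|) @ \oo --> `|l - c|.
    by apply: cvg_norm; apply: cvgB => //; exact: cvg_cst.
  have c2 : (fun M => D * (e + e^-1 / M.+1%:R)) @ \oo --> D * e.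
    apply: cvgMr; rewrite -[X in _ --> X]addr0; apply: cvgD; first exact: cvg_cst.
    rewrite -[X in _ --> X](mulr0 e^-1); apply: cvgMr; exact: cvg_harmonic.
  rewrite -(cvg_lim _ c1)// -(cvg_lim _ c2)//; apply: ler_lim.
  - by apply/cvg_ex; exists `|l - c|.
  - by apply/cvg_ex; exists (D * e).
  - by near=> M; exact: ac.
apply/eqP; rewrite -subr_eq0 -normr_le0; apply/ler_addgt0Pr => e e0.
rewrite add0r (le_trans (bound (e / (D + 1)) _))//.
  by rewrite divr_gt0// ltr_wpDl.
rewrite mulrCA ler_piMr//; first exact: ltW.
by rewrite ler_pdivrMr ?ltr_wpDl// mul1r lerDl.
Unshelve. all: by end_near. Qed.

(** The Cesaro means tend to the unordered sum by [fejer_sum_cvg] and to the grid sum by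
    [fejer_limit]. *)
Lemma rsum_fejer n (N B : nat) (f : 'rV[int]_n -> R) (h : n.-tuple R -> R) (K : R) :
  (0 < N)%N -> (forall M, box_sum (fun u => `|f u|) M <= K) ->
  BL h -> grid_supported N B h ->
  (forall M, fejer_sum f M =
    \int[lebesgue_tuple R n]_t (h t * \prod_(i < n) fejer M (N%:R * tnth t i))) ->
  rsum f = N%:R^-1 ^+ n * \sum_t h (map_tuple (@node R N B) t).
Proof.
move=> N_gt0 fK [L [C [L0 hL hC]]] hS fE.
apply: (@cvg_fejer_error (fejer_sum f) _ _
  (L * B.*2.+1%:R * n%:R * (1 + N%:R^-1 * B.*2.+1%:R) ^+ n)); first exact: fejer_sum_cvg fK.
move=> e e0 M; rewrite fE; apply: (le_trans (fejer_limit N_gt0 L0 hL hC hS e0 M)).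
by rewrite le_eqVlt; apply/orP; left; apply/eqP; ring.
Qed.

End fejer_limits.

(** * Poisson summation for a band-limited function *)

Section band_limited.
Context {R : realType} {n : nat}.
Variable Phi : 'rV[R]_n.+1 -> R[i].
Hypothesis Phi_schwartz : schwartz Phi.
Hypothesis Phi_supp : forall xi, Phi xi != 0 -> \sum_j `|xi 0 j| < 2.
Local Notation RT m := (m.-tuple (measurableTypeR R)).
Implicit Types (theta : 'rV[R]_n.+1) (t : n.-tuple R).

Definition wave theta t : R[i] :=
  let xi := zero_sum (row_of_tuple t) in Phi xi * expi (\sum_j xi 0 j * theta 0 j).

Lemma wave_BL theta :
  BL (fun t => complex.Re (wave theta t)) /\ BL (fun t => complex.Im (wave theta t)).
Proof.
have [sR sI] := Phi_schwartz.
have bR := BL_schwartz sR ler01 (@zero_sum_dist n R).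
have bI := BL_schwartz sI ler01 (@zero_sum_dist n R).
pose l t : R := 2 * pi * \sum_j zero_sum (row_of_tuple t) 0 j * theta 0 j.
have [bc bs] : BL (fun t => cos (l t)) /\ BL (fun t => sin (l t)).
  apply: (@BL_cos_sin _ _ _ (2 * pi * \sum_j `|theta 0 j|)).
    by rewrite mulr_ge0 ?sumr_ge0// mulr_ge0 ?pi_ge0.
  move=> s t; rewrite -mulrBr normrM ger0_norm ?mulr_ge0 ?pi_ge0//.
  rewrite -[leRHS]mulrA ler_wpM2l ?mulr_ge0 ?pi_ge0//.
  rewrite -sumrB (le_trans (ler_norm_sum _ _ _))// mulr_suml; apply: ler_sum => j _.
  rewrite -mulrBl normrM mulrC ler_wpM2l//.
  by rewrite -[leRHS]mul1r zero_sum_dist.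
split.
  rewrite (_ : (fun t => _) = fun t => complex.Re (Phi (zero_sum (row_of_tuple t))) * cos (l t) +
      - (complex.Im (Phi (zero_sum (row_of_tuple t))) * sin (l t))).
    by apply: BLD; [exact: BLM|apply: BLN; exact: BLM].
  by apply/funext => t; rewrite /wave ReM.
rewrite (_ : (fun t => _) = fun t => complex.Re (Phi (zero_sum (row_of_tuple t))) * sin (l t) +
    (complex.Im (Phi (zero_sum (row_of_tuple t))) * cos (l t))).
  by apply: BLD; exact: BLM.
by apply/funext => t; rewrite /wave ImM.
Qed.

Lemma wave_supp N theta : (0 < N)%N -> forall t, wave theta t != 0 ->
  forall i, `|tnth t i| * N%:R <= N.*2%:R.
Proof.
move=> N_gt0 t; rewrite mulf_eq0 negb_or => /andP[/Phi_supp h _] i.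
rewrite -muln2 natrM mulrC ler_wpM2l// ltW// (le_lt_trans _ h)//.
rewrite (bigD1 (lift ord_max i))//= extend_row_lift mxE lerDl; exact: sumr_ge0.
Qed.

Lemma wave_grid N theta : (0 < N)%N ->
  grid_supported N N.*2 (fun t => complex.Re (wave theta t)) /\
  grid_supported N N.*2 (fun t => complex.Im (wave theta t)).
Proof.
move=> N_gt0; split => t; rewrite -/(is_true _) => ht; apply: (wave_supp (theta := theta)) => //;
  by apply: contraNneq ht => ->.
Qed.

Lemma wave_cintegrable theta : cintegrable (lebesgue_tuple R n) (wave theta).
Proof.
have [bR bI] := wave_BL theta; have [gR gI] := wave_grid theta (ltn0Sn 0).
by split; [exact: BL_integrable bR gR|exact: BL_integrable bI gI].
Qed.

Lemma wave_shift theta (a : 'rV[R]_n) t :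
  wave (theta + extend_row a 0) t = wave theta t * expi (\sum_i tnth t i * a 0 i).
Proof.
rewrite /wave -mulrA -expiD; congr (_ * expi _).
under eq_bigr => j _ do rewrite [(theta + _) 0 j]mxE mulrDr.
rewrite big_split /=; congr (_ + _).
rewrite (bigD1_ord ord_max)//= extend_row_max mulr0 add0r.
by apply: eq_bigr => i _; rewrite !extend_row_lift mxE.
Qed.

Variable phi : 'rV[R]_n.+1 -> R[i].
Hypothesis phiE : forall x, phi x = cintegral (lebesgue_tuple R n) (wave x).

Variables (N : nat) (x : 'rV[R]_n.+1).
Hypothesis N_gt0 : (0 < N)%N.
Let f (u : 'rV[int]_n) : R[i] := phi (N%:R *: (x + map_mx intr (extend_row u 0))).
Let H := wave (N%:R *: x).

(** A lattice shift multiplies the integrand by a character ([wave_shift]), and the Cesaro sum of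
    these characters factors into one Fejer kernel per coordinate. *)
Lemma fejer_wave M :
  \sum_(v : n.-tuple 'I_(M.*2.+1)) (\prod_i fejer_coef M (centered (tnth v i)) : R)%:C *
     f (box_point v) =
  cintegral (lebesgue_tuple R n) (fun t => (\prod_(i < n) fejer M (N%:R * tnth t i))%:C * H t).
Proof.
have fE u : f u = cintegral (lebesgue_tuple R n)
    (wave (N%:R *: x + extend_row (N%:R *: map_mx intr u) 0)).
  rewrite /f phiE; apply: (congr1 (fun th => cintegral (lebesgue_tuple R n) (wave th))).
  rewrite scalerDr; congr (_ + _); apply/rowP => j; rewrite !mxE.
  by case: unliftP => [i|]; rewrite ?mxE ?mulr0.
under eq_bigr => v _ do rewrite fE -(cintegralZ _ (wave_cintegrable _)).
rewrite -cintegral_sum; last first.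
  by move=> v _; apply: cintegrableZ; exact: wave_cintegrable.
congr cintegral; apply/funext => t.
under eq_bigr => v _ do rewrite wave_shift mulrCA -/H.
rewrite -mulr_sumr mulrC; congr (_ * _).
rewrite rmorph_prod /=; under [RHS]eq_bigr do rewrite -expi_fejer.
rewrite -prod_sum_tuple; apply: eq_bigr => v _.
rewrite rmorph_prod expi_sum -big_split /=; apply: eq_bigr => i _.
by rewrite !mxE mulrA [tnth t i * _]mulrC.
Qed.

Hypothesis f_box : exists K : R, forall M,
  box_sum (fun u => `|complex.Re (f u)|) M <= K /\ box_sum (fun u => `|complex.Im (f u)|) M <= K.

Lemma periodizeE : periodize N phi x =
  (N%:R^-1 ^+ n)%:C * \sum_(t : n.-tuple 'I_(N.*2.*2.+1)) H (map_tuple (@node R N N.*2) t).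
Proof.
have [K fK] := f_box.
have [bR bI] := wave_BL (N%:R *: x); have [gR gI] := wave_grid (N%:R *: x) N_gt0.
have fw M := fejer_wave M.
apply: eq_ReIm.
  rewrite Re_mulCl Re_sum; apply: rsum_fejer N_gt0 (fun M => (fK M).1) bR gR _ => M.
  have := congr1 (@complex.Re R) (fw M); rewrite Re_sum cintegralE /=.
  under eq_bigr do rewrite Re_mulCl; rewrite /fejer_sum => ->.
  by apply: eq_Rintegral => t _; rewrite Re_mulCl mulrC.
rewrite Im_mulCl Im_sum; apply: rsum_fejer N_gt0 (fun M => (fK M).2) bI gI _ => M.
have := congr1 (@complex.Im R) (fw M); rewrite Im_sum cintegralE /=.
under eq_bigr do rewrite Im_mulCl; rewrite /fejer_sum => ->.
by apply: eq_Rintegral => t _; rewrite Im_mulCl mulrC.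
Qed.

End band_limited.

(** * Absolute convergence of the periodisation *)

Section decay.
Context {R : realType} {n : nat}.

Lemma mx_entry_le_norm p q (A : 'M[R]_(p, q)) i j : `|A i j| <= `|A|.
Proof.
rewrite [X in _ <= X]mx_normrE.
exact: (le_bigmax _ (fun ij : 'I_p * 'I_q => `|A ij.1 ij.2|) (i, j)).
Qed.

(** The term 2/(M+1) makes the induction close: the two new summands are 1/(M+2)^2 each, at most
    1/(M+1) - 1/(M+2). *)
Lemma sum_inv_sq_le M :
  \sum_(i < M.*2.+1) ((1 + `|(centered i)%:~R|) ^+ 2)^-1 <= 3 - 2 / M.+1%:R :> R.
Proof.
elim: M => [|M ih].
  by rewrite big_ord1 /centered /= normr0 addr0 expr1n invr1 mulr1; lra.
pose G (c : int) : R := ((1 + `|c%:~R|) ^+ 2)^-1.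
rewrite (sum_centeredS G) /G rmorphN /= normrN ger0_norm//.
have -> : (M.+1%:~R : R) = M.+1%:R by [].
rewrite nat1r.
have h : (M.+2%:R ^+ 2)^-1 <= M.+1%:R^-1 - M.+2%:R^-1 :> R.
  have -> : M.+1%:R^-1 - M.+2%:R^-1 = (M.+1%:R * M.+2%:R)^-1 :> R.
    rewrite -[M.+2]addn1 -[M.+1]addn1 !natrD.
    have m0 : 0 <= M%:R :> R by exact: ler0n.
    by field; apply/andP; split; apply: lt0r_neq0; lra.
  rewrite lef_pV2 ?posrE ?exprn_gt0 ?mulr_gt0 ?ltr0n// expr2 ler_pM2r ?ltr0n//.
  by rewrite ler_nat.
by move: ih h; rewrite /G; move: (_^-1) (_^-1) (_^-1) (\sum_(_ < _) _) => a b c s; lra.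
Qed.

Lemma box_sum_decay (f : 'rV[int]_n -> R) K M : 0 <= K ->
  (forall u, `|f u| * \prod_i (1 + `|(u 0 i)%:~R|) ^+ 2 <= K) ->
  box_sum (fun u => `|f u|) M <= K * 3 ^+ n.
Proof.
move=> K0 fK.
apply: (@le_trans _ _ (\sum_(v : n.-tuple 'I_(M.*2.+1))
    K * \prod_i ((1 + `|(centered (tnth v i))%:~R|) ^+ 2)^-1)).
  apply: ler_sum => v _; have := fK (box_point v).
  under eq_bigr do rewrite mxE; rewrite prodfV -ler_pdivlMr//.
  by apply: prodr_gt0 => i _; rewrite exprn_gt0// ltr_pwDl.
rewrite -mulr_sumr ler_wpM2l//.
rewrite (prod_sum_tuple (fun _ c => ((1 + `|(centered c)%:~R|) ^+ 2)^-1 : R)).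
rewrite prodr_const card_ord lerXn2r ?nnegrE//.
  by apply: sumr_ge0 => c _; rewrite invr_ge0 exprn_ge0// addr_ge0.
by rewrite (le_trans (sum_inv_sq_le M))// gerBl.
Qed.

Lemma schwartzR_decay (f : 'rV[R]_n -> R) k : schwartzR f ->
  exists2 C : R, 0 <= C & forall y, `|f y| * (1 + `|y|) ^+ k <= C.
Proof.
move=> [_ sf]; have [A hA] := sf 0%N [::]; have [B hB] := sf k [::].
have A0 : 0 <= A by apply: le_trans (hA 0); rewrite mulr_ge0// exprn_ge0.
have B0 : 0 <= B by apply: le_trans (hB 0); rewrite mulr_ge0// exprn_ge0.
exists (2 ^+ k * (A + B)); first by rewrite mulr_ge0// addr_ge0.
move=> y; have {hA} := hA y; have {hB} := hB y; rewrite /= expr0 mul1r => hB hA.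
have [y1|y1] := leP `|y| 1.
  rewrite mulrC ler_pM// ?exprn_ge0 ?addr_ge0//; last by rewrite (le_trans hA)// lerDl.
  by rewrite lerXn2r ?nnegrE ?addr_ge0//; lra.
apply: (@le_trans _ _ (`|f y| * (2 * `|y|) ^+ k)).
  by rewrite ler_wpM2l// lerXn2r ?nnegrE ?addr_ge0// ?mulr_ge0//; lra.
rewrite exprMn mulrCA ler_wpM2l// mulrC (le_trans hB)// lerDr//.
Qed.

(** [m] is the mean of the coordinates. Subtracting it moves z into the hyperplane and keeps
    coordinate differences, which therefore y controls. *)
Lemma zero_sum_mean (z : 'rV[R]_n.+1) : exists y : 'rV[R]_n, exists m : R,
  z = zero_sum y + const_mx m /\
  forall i, `|z 0 (lift ord_max i) - z 0 ord_max| <= n.+1%:R * `|y|.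
Proof.
pose m : R := (\sum_j z 0 j) / n.+1%:R.
pose y : 'rV[R]_n := \row_i (z 0 (lift ord_max i) - m).
have nm : n.+1%:R * m = \sum_j z 0 j by rewrite mulrC divfK// pnatr_eq0.
have ys : \sum_i y 0 i = m - z 0 ord_max.
  have : \sum_i y 0 i = \sum_i z 0 (lift ord_max i) - n%:R * m.
    under eq_bigr do rewrite mxE; rewrite sumrB sumr_const card_ord; congr (_ - _).
    by rewrite mulr_natl.
  move: nm; rewrite (bigD1_ord ord_max)//= -(nat1r n) mulrDl mul1r.
  by move: (\sum_i y 0 i) (\sum_i _) (n%:R * m) => a b c; lra.
exists y, m; split.
  apply/rowP => j; rewrite !mxE; case: unliftP => [i ->|->]; first by rewrite mxE subrK.
  by rewrite ys; ring.
move=> i; have -> : z 0 (lift ord_max i) - z 0 ord_max = y 0 i + \sum_i y 0 i.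
  by rewrite ys mxE; ring.
rewrite -(nat1r n) mulrDl mul1r (le_trans (ler_normD _ _))// lerD ?mx_entry_le_norm//.
rewrite (le_trans (ler_norm_sum _ _ _))// mulr_natl.
rewrite (_ : `|y| *+ n = \sum_(i < n) `|y|); last by rewrite sumr_const card_ord.
by apply: ler_sum => j _; exact: mx_entry_le_norm.
Qed.

Variable f : 'rV[R]_n.+1 -> R.
Hypothesis f_invariant : forall x t, f (x + const_mx t) = f x.
Hypothesis f_schwartz : schwartzR (fun y : 'rV[R]_n => f (zero_sum y)).

(** The last variable is not shifted, so u_i is controlled by a difference of coordinates of the
    argument: 1 + |u_i| <= A (1 + |y|). Decay of order 2n in y then beats the product of the (1 +
    |u_i|)^2. *)
Lemma box_sum_periodize (N : nat) (x : 'rV[R]_n.+1) : (0 < N)%N -> exists K : R, forall M,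
  box_sum (fun u => `|f (N%:R *: (x + map_mx intr (extend_row u 0)))|) M <= K.
Proof.
move=> N_gt0; have [C C0 fC] := schwartzR_decay (n * 2) f_schwartz.
pose X := 2 * (N%:R * `|x|).
have X0 : 0 <= X by rewrite !mulr_ge0.
pose A := 1 + X + n.+1%:R.
have A0 : 0 <= A by rewrite !addr_ge0.
exists (A ^+ (n * 2) * C * 3 ^+ n) => M; apply: box_sum_decay.
  by rewrite mulr_ge0// exprn_ge0.
move=> u; set z := _ *: _.
have [y [m [zE zy]]] := zero_sum_mean z.
have fzE : f z = f (zero_sum y) by rewrite zE f_invariant.
have uy i : 1 + `|(u 0 i)%:~R| <= A * (1 + `|y|).
  have N1 : 1 <= N%:R :> R by rewrite ler1n.
  have zu : z 0 (lift ord_max i) - z 0 ord_max =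
      N%:R * (u 0 i)%:~R + N%:R * (x 0 (lift ord_max i) - x 0 ord_max).
    by rewrite !mxE liftK unlift_none; ring.
  have h1 := zy i; rewrite zu in h1.
  have h2 : `|N%:R * (x 0 (lift ord_max i) - x 0 ord_max)| <= X.
    rewrite normrM ger0_norm// /X mulrCA ler_wpM2l//.
    rewrite (le_trans (ler_normB _ _))// mulr_natl mulr2n lerD// mx_entry_le_norm//.
  have h3 : `|(u 0 i)%:~R| <= `|N%:R * (u 0 i)%:~R| :> R.
    by rewrite normrM (ger0_norm (ler0n _ N)) ler_peMl.
  have h4 := ler_normB (N%:R * (u 0 i)%:~R + N%:R * (x 0 (lift ord_max i) - x 0 ord_max))
    (N%:R * (x 0 (lift ord_max i) - x 0 ord_max)).
  rewrite addrK in h4.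
  have y0 : 0 <= `|y| by [].
  have ny : 0 <= X * `|y| by rewrite mulr_ge0.
  have n0 : 0 <= n.+1%:R :> R by [].
  rewrite /A; move: h1 h2 h3 h4 y0 ny n0; clear.
  move: `|y| `|_ * (u 0 i)%:~R| `|(u 0 i)%:~R| `|_ + _| `|_ * _| X n.+1%:R => r a b c d e g.
  by move=> *; lra.
rewrite fzE; apply: (@le_trans _ _ (`|f (zero_sum y)| * \prod_(i < n) (A * (1 + `|y|)) ^+ 2)).
  rewrite ler_wpM2l//; apply: ler_prod => i _.
  rewrite exprn_ge0 ?addr_ge0//= lerXn2r ?nnegrE ?addr_ge0 ?mulr_ge0//.
by rewrite prodr_const card_ord -exprM mulnC exprMn mulrCA ler_wpM2l ?exprn_ge0.
Qed.

End decay.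

Section poisson.
Context {R : realType} {n : nat} (phi Phi : 'rV[R]_n.+1 -> R[i]).
Hypotheses (phi_test : test_function phi) (Phi_phi : associated Phi phi).
Hypothesis Phi_supp : forall xi, Phi xi != 0 -> \sum_j `|xi 0 j| < 2.

Lemma poisson_periodize N (x : 'rV[R]_n.+1) : (0 < N)%N -> periodize N phi x =
  (N%:R^-1 ^+ n)%:C * \sum_(t : n.-tuple 'I_(N.*2.*2.+1))
    wave Phi (N%:R *: x) (map_tuple (@node R N N.*2) t).
Proof.
move=> N_gt0; have [Phi_sch phiE] := Phi_phi.
have [sR sI] := test_schwartz phi_test.
have iR y t : complex.Re (phi (y + const_mx t)) = complex.Re (phi y).
  by rewrite (test_invariant phi_test).
have iI y t : complex.Im (phi (y + const_mx t)) = complex.Im (phi y).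
  by rewrite (test_invariant phi_test).
apply: periodizeE => //.
have [K hK] := box_sum_periodize iR sR x N_gt0.
have [K' hK'] := box_sum_periodize iI sI x N_gt0.
exists (Num.max K K') => M; split.
  by apply: le_trans (hK M) _; rewrite le_max lexx.
by apply: le_trans (hK' M) _; rewrite le_max lexx orbT.
Qed.

End poisson.

(** * Power traces through eigenangles *)

Section polar.
Context {R : realType}.

Lemma expi_polar (z : R[i]) : z * conjc z = 1 -> exists t : R, z = expi t.
Proof.
case: z => x y h; have xy : x ^+ 2 + y ^+ 2 = 1.
  by have := congr1 (@complex.Re R) h; rewrite /=; lra.
have x1 : -1 <= x <= 1.
  have y0 : 0 <= y ^+ 2 by exact: sqr_ge0.
  by apply/andP; split; nra.
have pi0 : 2 * pi != 0 :> R by rewrite mulf_neq0// gt_eqF// pi_gt0.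
have s1 : sin (acos x) = `|y|.
  by rewrite sin_acos// (_ : 1 - x ^+ 2 = y ^+ 2) ?sqrtr_sqr//; lra.
have c1 : cos (acos x) = x by rewrite acosK// in_itv/=.
have [y0|y0] := leP 0 y.
  exists (acos x / (2 * pi)); rewrite /expi mulrC divfK// c1 s1 ger0_norm//.
exists (- (acos x / (2 * pi))); rewrite /expi mulrN mulrC divfK// cosN sinN c1 s1.
by rewrite ltr0_norm// opprK.
Qed.

Lemma expi_mulz (t : R) (k : int) : expi (t * k%:~R) = (expi t : Cplx R) ^ k.
Proof.
have nat_case m : expi (t * m%:R) = (expi t : Cplx R) ^+ m.
  elim: m => [|m ih]; first by rewrite mulr0 expi0.
  by rewrite -natr1 mulrDr mulr1 expiD ih exprSr.
case: k => m; first exact: nat_case.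
rewrite NegzE -exprnN -nat_case mulrNz mulrN.
have e : expi (- (t * m.+1%:R)) * expi (t * m.+1%:R) = 1 by rewrite -expiD addNr expi0.
have u : (expi (t * m.+1%:R) : Cplx R) != 0.
  by apply: contraTneq (oner_neq0 (Cplx R)) => z; rewrite -e z mulr0 eqxx.
by apply: (mulIf u); rewrite mulVf.
Qed.

End polar.

Section diagonal_powers.
Context {F : fieldType} {n : nat}.
Variables (P : 'M[F]_n.+1) (D : 'rV[F]_n.+1).
Hypothesis Pu : P \is a GRing.unit.
Let A : 'M[F]_n.+1 := P^-1 * diag_mx D * P.

Let conj_diagM (D1 D2 : 'rV[F]_n.+1) :
  (P^-1 * diag_mx D1 * P) * (P^-1 * diag_mx D2 * P) =
  P^-1 * diag_mx (\row_j (D1 0 j * D2 0 j)) * P.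
Proof.
rewrite !mulrA mulrK//; congr (_ * _); rewrite -!mulrA; congr (_ * _).
exact: mulmx_diag.
Qed.

Let conj_diag1 (D1 : 'rV[F]_n.+1) : (forall j, D1 0 j = 1) -> P^-1 * diag_mx D1 * P = 1.
Proof.
move=> D1E; rewrite (_ : diag_mx D1 = 1) ?mulr1 ?mulVr//.
by apply/matrixP => i j; rewrite !mxE D1E.
Qed.

Lemma mxtrace_conj_diag_exp (k : int) : (forall j, D 0 j != 0) ->
  \tr (A ^ k) = \sum_j D 0 j ^ k.
Proof.
move=> D0.
have pow (E : 'rV[F]_n.+1) m : (P^-1 * diag_mx E * P) ^+ m =
    P^-1 * diag_mx (\row_j (E 0 j ^+ m)) * P.
  elim: m => [|m ih]; first by rewrite expr0 conj_diag1// => j; rewrite mxE.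
  rewrite exprS ih conj_diagM; congr (_ * diag_mx _ * _).
  by apply/rowP => j; rewrite !mxE exprS.
have trE (E : 'rV[F]_n.+1) : \tr (P^-1 * diag_mx E * P) = \sum_j E 0 j.
  apply: (etrans (mxtrace_mulC (P^-1 * diag_mx E) P)).
  by rewrite (_ : P *m _ = diag_mx E) ?mxtrace_diag//; exact: (mulVKr Pu).
case: k => m.
  by rewrite -exprnP pow trE; apply: eq_bigr => j _; rewrite mxE.
rewrite NegzE -exprnN -exprVn.
have -> : A^-1 = P^-1 * diag_mx (\row_j (D 0 j)^-1) * P.
  have AB : A * (P^-1 * diag_mx (\row_j (D 0 j)^-1) * P) = 1.
    by rewrite conj_diagM conj_diag1// => j; rewrite !mxE mulfV.
  have Au : A \is a GRing.unit by apply: (mulmx1_unit AB).1.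
  by rewrite -[RHS](mulKr Au) AB mulr1.
rewrite pow trE; apply: eq_bigr => j _.
by rewrite !mxE exprVn.
Qed.

Lemma char_poly_conj_diag : char_poly A = \prod_j ('X - (D 0 j)%:P).
Proof.
pose p (B : 'M[F]_n.+1) : 'M[{poly F}]_n.+1 := map_mx polyC B.
have pM B1 B2 : p (B1 *m B2) = p B1 *m p B2.
  by apply/matrixP => i j; rewrite !mxE rmorph_sum; apply: eq_bigr => l _; rewrite !mxE rmorphM.
have p1 : p 1%:M = 1%:M.
  by apply/matrixP => i j; rewrite !mxE; case: (i == j).
have e : char_poly_mx A = p P^-1 *m char_poly_mx (diag_mx D) *m p P.
  have cE B : char_poly_mx B = 'X%:M - p B by [].
  rewrite !cE mulmxBr mulmxBl -!pM scalar_mxC -['X%:M *m _ *m _]mulmxA -pM.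
  by rewrite (_ : P^-1 *m P = 1%:M) ?p1 ?mulmx1//; exact: mulVr.
rewrite /char_poly e !det_mulmx mulrC mulrA -det_mulmx -pM.
rewrite (_ : P *m P^-1 = 1%:M) ?p1 ?det1 ?mul1r; last exact: mulrV.
rewrite -[LHS]/(char_poly (diag_mx D)) char_poly_trig; last exact: diag_mx_is_trig.
by apply: eq_bigr => j _; rewrite mxE eqxx.
Qed.

End diagonal_powers.

Section eigenangles.
Context {R : realType} {n : nat}.
Local Notation C := (Cplx R).
Implicit Types U : unitary R n.+1.

(** U is normal, hence unitarily diagonalisable. The angles chosen by [eigenangles] give the same
    characteristic polynomial, so they list the same eigenvalues up to order. *)
Lemma power_trace_eigenangles U (k : int) :
  \sum_j expi (eigenangles U 0 j * k%:~R) = power_trace k U.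
Proof.
set A := umx U; have AU : A \is unitarymx := umx_unitary U.
have Anormal : A \is normalmx.
  apply/normalmxP; rewrite (unitarymxP AU).
  apply/esym/mulmx1C; exact/unitarymxP.
have [[P D] /= Punitary AE'] := elimT (@orthomx_spectral_subproof _ _ A) Anormal.
have Pu : P \is a GRing.unit := unitarymx_unit Punitary.
have AE : A = P^-1 * diag_mx D * P by exact: AE'.
have PV : P^-1 = map_mx Num.conj P^T by exact: invmx_unitary.
have Dnorm j : D 0 j * conjc (D 0 j) = 1.
  have dU : diag_mx D \is unitarymx.
    have -> : diag_mx D = P *m A *m map_mx Num.conj P^T.
      rewrite -PV AE -[RHS]/(P * (P^-1 * diag_mx D * P) * P^-1).
      by rewrite !mulrA divrr// mul1r mulrK.
    apply: mul_unitarymx; first exact: mul_unitarymx.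
    by rewrite trmxC_unitary.
  have /unitarymxP/matrixP/(_ j j) := dU.
  rewrite tr_diag_mx map_diag_mx mulmx_diag !mxE eqxx !mulr1n => <-.
  by congr (_ * _).
have Dn0 j : D 0 j != 0.
  by apply: contraTneq (oner_neq0 C) => d; rewrite -(Dnorm j) d mul0r eqxx.
have [th thE] := choice (fun j => expi_polar (Dnorm j)).
have charA : char_poly A = \prod_j ('X - (D 0 j)%:P).
  by rewrite {1}AE char_poly_conj_diag.
(* The diagonalisation exhibits suitable angles, so [xget] does not return its default. *)
have [eE] : [set theta : 'rV[R]_n.+1 | char_poly (umx U) =
      \prod_(j < n.+1) ('X - (expi (theta 0 j) : C)%:P)] (eigenangles U).
  apply: xgetPex; exists (\row_j th j) => /=.
  by rewrite -/A charA; apply: eq_bigr => j _; rewrite mxE -thE.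
have pE : perm_eq [seq (expi (eigenangles U 0 j) : C) | j <- index_enum 'I_n.+1]
    [seq D 0 j | j <- index_enum 'I_n.+1].
  by apply: prod_XsubC_eq; rewrite !big_map -eE -charA.
rewrite /power_trace -/A AE mxtrace_conj_diag_exp//.
under eq_bigr do rewrite expi_mulz.
have : \sum_(z <- [seq (expi (eigenangles U 0 j) : C) | j <- index_enum 'I_n.+1]) z ^ k =
    \sum_(z <- [seq D 0 j | j <- index_enum 'I_n.+1]) z ^ k by exact: perm_big.
by rewrite !big_map.
Qed.

End eigenangles.

(** * Linear statistics as sums of trace monomials *)

Section linear_statistics.
Context {R : realType} {n : nat} (phi Phi : 'rV[R]_n.+1 -> R[i]).
Hypotheses (phi_test : test_function phi) (Phi_phi : associated Phi phi).
Hypothesis Phi_supp : forall xi, Phi xi != 0 -> \sum_j `|xi 0 j| < 2.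
Context (m : nat).
Local Notation N := m.+1.
Local Notation I := 'I_(N.*2.*2.+1).
Local Notation C := (Cplx R).
Implicit Types (t : n.-tuple I) (U : unitary R N).

(* N times a grid point of the hyperplane, as an integer vector *)
Definition frequency t (j : 'I_n.+1) : int :=
  if unlift ord_max j is Some i then centered (tnth t i) else - \sum_i centered (tnth t i).

Lemma sum_frequency t : \sum_j frequency t j = 0.
Proof.
rewrite (bigD1_ord ord_max)//= /frequency unlift_none.
by under eq_bigr do rewrite liftK; rewrite addNr.
Qed.

Definition frequency_row t : 'rV[R]_n.+1 := \row_j ((frequency t j)%:~R / N%:R).

Lemma zero_sum_node t :
  zero_sum (row_of_tuple (map_tuple (@node R N N.*2) t)) = frequency_row t.
Proof.
apply/rowP => j; rewrite !mxE /frequency; case: unliftP => [i _|_].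
  by rewrite mxE tnth_map.
rewrite rmorphN /= rmorph_sum mulNr mulr_suml; congr (- _).
by apply: eq_bigr => i _; rewrite mxE tnth_map.
Qed.

Lemma linear_statE U : linear_stat phi U = (N%:R^-1 ^+ n.+1)%:C *
  \sum_t Phi (frequency_row t) * trace_monomial [seq frequency t j | j <- index_enum 'I_n.+1] U.
Proof.
have N0 : N%:R != 0 :> R by rewrite pnatr_eq0.
rewrite /linear_stat exprS rmorphM -mulrA; congr (_ * _).
  by rewrite fmorphV rmorph_nat.
under eq_bigr => j _ do rewrite (poisson_periodize phi_test Phi_phi Phi_supp)//.
rewrite -mulr_sumr exchange_big; congr (_ * _); apply: eq_bigr => t _.
rewrite /wave zero_sum_node -mulr_sumr; congr (_ * _).
under eq_bigr => j _.
  rewrite (_ : \sum_i _ = \sum_i eigenangles U 0 (j i) * (frequency t i)%:~R); last first.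
    by apply: eq_bigr => i _; rewrite !mxE; field.
  rewrite expi_sum.
  over.
(* The sum over all maps from variables to eigenvalues is a product of sums, one power trace per
   variable. *)
transitivity (\prod_i \sum_l (expi (eigenangles U 0 l * (frequency t i)%:~R) : R[i])).
  by rewrite bigA_distr_bigA.
rewrite (eq_bigr (fun i => power_trace (frequency t i) U : R[i])); last first.
  by move=> i _; exact: power_trace_eigenangles.
by rewrite /trace_monomial big_map.
Qed.

Variable mu : probability (borel_unitary R N) R.

Lemma cintegral_linear_stat : cintegral mu (linear_stat phi) = (N%:R^-1 ^+ n.+1)%:C *
  \sum_t Phi (frequency_row t) * moment mu [seq frequency t j | j <- index_enum 'I_n.+1].
Proof.
have ic s : cintegrable mu (trace_monomial s) by apply: bmeas_cintegrable; exact: bmeas_trace_monomial.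
transitivity (cintegral mu (fun U => (N%:R^-1 ^+ n.+1)%:C * \sum_t Phi (frequency_row t) *
    (trace_monomial [seq frequency t j | j <- index_enum 'I_n.+1] U : R[i]))).
  by apply: eq_cintegral => U; exact: linear_statE.
rewrite cintegralZ; last first.
  by apply: cintegrable_sum => t _; exact: cintegrableZ.
rewrite cintegral_sum; last by move=> t _; exact: cintegrableZ.
by congr (_ * _); apply: eq_bigr => t _; rewrite cintegralZ.
Qed.

End linear_statistics.

(** * Moments with zero exponents *)

Section moments_with_zeros.
Context {R : realType} {m : nat}.
Local Notation N := m.+1.
Variable mu : probability (borel_unitary R N) R.
Hypothesis haar : haar_measure mu.

Lemma moment_zeros s :
  moment mu s = N%:R ^+ count_mem 0 s * moment mu [seq x <- s | x != 0].
Proof.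
rewrite (@perm_moment _ _ _ _ (nseq (count_mem 0 s) 0 ++ [seq x <- s | x != 0])).
  elim: (count_mem 0 s) => [|c ih] /=; first by rewrite mul1r.
  by rewrite moment_0 ih exprS mulrA.
rewrite -(perm_filterC (pred1 0) s) perm_cat2r.
have /all_pred1P -> : all (pred1 0) [seq x <- s | pred1 0 x] by exact: filter_all.
by rewrite size_filter.
Qed.

(* Since k sums to 0, the hypothesis on \sum_i `|k i| says that the positive k i
   add up to less than N. *)
Lemma moment_pairing p (k : 'I_p -> int) : \sum_i k i = 0 -> \sum_i `|k i| <= 2 * N%:Z ->
  moment mu [seq k i | i <- index_enum 'I_p] =
  N%:R ^+ #|[set i | k i == 0]%SET| * pairing_sum k (Cplx R) [set i | k i != 0]%SET.
Proof.
move=> k0 kN; pose s := [seq k i | i <- enum [set i | k i != 0]%SET].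
have fE : [seq x <- [seq k i | i <- index_enum 'I_p] | x != 0] = s.
  rewrite filter_map /s; congr map.
  rewrite deprecated_filter_index_enum.
  by apply: eq_enum => i; rewrite !inE.
rewrite moment_zeros fE; congr (_ ^+ _ * _).
  rewrite count_map cardE -deprecated_filter_index_enum size_filter.
  by apply: eq_count => i /=; rewrite [RHS]inE.
have tot : total s = 0.
  rewrite -k0 /total -fE big_filter big_map [RHS](bigID (fun i => k i != 0)) /=.
  by rewrite [X in _ = _ + X]big1 ?addr0// => i; rewrite negbK => /eqP.
have pos : pos_sum s <= N%:Z.
  have : 2 * pos_sum s <= 2 * N%:Z.
    apply: le_trans kN.
    have pE : pos_sum s = \sum_(i | 0 < k i) k i.
      rewrite /pos_sum -fE big_filter_cond big_map; apply: eq_bigl => i.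
      by rewrite andb_idl// => /gt_eqF ->.
    have nE : \sum_i `|k i| = \sum_(i | 0 < k i) k i - \sum_(i | ~~ (0 < k i)) k i.
      rewrite (bigID (fun i => 0 < k i)) /= -sumrN; congr (_ + _); apply: eq_bigr => i ki.
        by rewrite gtr0_norm.
      by rewrite ler0_norm// leNgt.
    move: k0; rewrite (bigID (fun i => 0 < k i)) /= nE pE.
    move: (\sum_(i | _) _) (\sum_(i | _) _) => a b; lia.
  by lia.
have s0 : 0 \notin s by rewrite -fE mem_filter eqxx.
rewrite moment_wick// wick_pairing//.
  by move=> i; rewrite inE.
move=> i iA; have is_ : k i \in s by apply: map_f; rewrite mem_enum.
have := zero_sum_entry tot is_; lia.
Qed.

End moments_with_zeros.

(** * Integer vectors supported on a pairing *)

Section lattice.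
Context {p B : nat}.
Local Notation I := 'I_(B.*2.+1).
Implicit Types (S : {set 'I_p * 'I_p}) (q : 'I_p * 'I_p).

(** Inverts [centered] on [-B, B] only. *)
Definition uncenter (c : int) : I := inord `|(c + B%:Z)%R|%N.

Lemma uncenterK c : `|c| <= B%:Z -> centered (uncenter c) = c.
Proof. by move=> cB; rewrite /centered inordK; lia. Qed.

Lemma centeredK i : uncenter (centered i) = i.
Proof. exact/centered_inj/uncenterK/centered_le. Qed.

Lemma mem_supp1 S q : q \in S -> q.1 \in supp S.
Proof. by move=> qS; apply/suppP; exists q => //; rewrite eqxx. Qed.

Lemma mem_supp2 S q : q \in S -> q.2 \in supp S.
Proof. by move=> qS; apply/suppP; exists q => //; rewrite eqxx orbT. Qed.

Lemma card_supp S : pairing S -> #|supp S| = (2 * #|S|)%N.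
Proof.
move=> /andP[_ /card_uniqP]; rewrite size_cat !size_map -cardE mul2n -addnn => <-.
apply: eq_card => i; rewrite mem_cat; apply/suppP/orP => [[q qS /orP[]/eqP ->]|].
- by left; apply: map_f; rewrite mem_enum.
- by right; apply: map_f; rewrite mem_enum.
- by case=> /mapP[q]; rewrite mem_enum => qS ->; exists q; rewrite ?eqxx ?orbT.
Qed.

Variable S : {set 'I_p * 'I_p}.
Hypothesis pS : pairing S.
Implicit Types l : #|S|.-tuple I.

(** The coordinates of sum_j x_j e_(alpha_j, beta_j), over any ring: integers for frequencies, reals
    for the integrand. *)
Definition pair_vector (V : pzRingType) (x : 'I_#|S| -> V) (i : 'I_p) : V :=
  \sum_(j < #|S|) x j * ((i == (enum_val j).1)%:R - (i == (enum_val j).2)%:R).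

Let disjoint_pairs (j j' : 'I_#|S|) : j' != j ->
  [/\ (enum_val j).1 != (enum_val j').1, (enum_val j).1 != (enum_val j').2,
      (enum_val j).2 != (enum_val j').1 & (enum_val j).2 != (enum_val j').2].
Proof.
move=> jj'; have [_ h1 h2 _] := pairingD1 (enum_valP j) pS.
have j'S : enum_val j' \in S :\ enum_val j.
  by rewrite in_setD1 enum_valP andbT (inj_eq enum_val_inj).
split; [apply: contraNneq h1|apply: contraNneq h1|apply: contraNneq h2|apply: contraNneq h2] => ->;
  by [exact: mem_supp1|exact: mem_supp2].
Qed.

Let ordered_pair (j : 'I_#|S|) : ((enum_val j).1 == (enum_val j).2) = false.
Proof. by have [/ltn_eqF] := pairingD1 (enum_valP j) pS. Qed.

Lemma pair_vector1 (V : pzRingType) (x : 'I_#|S| -> V) j : pair_vector x (enum_val j).1 = x j.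
Proof.
rewrite /pair_vector (bigD1 j)//= eqxx ordered_pair subr0 mulr1 big1 ?addr0// => j' jj'.
by have [/negbTE -> /negbTE -> _ _] := disjoint_pairs jj'; rewrite subrr mulr0.
Qed.

Lemma pair_vector2 (V : pzRingType) (x : 'I_#|S| -> V) j : pair_vector x (enum_val j).2 = - x j.
Proof.
rewrite /pair_vector (bigD1 j)//= eqxx eq_sym ordered_pair sub0r mulrN1.
rewrite big1 ?addr0// => j' jj'.
by have [_ _ /negbTE -> /negbTE ->] := disjoint_pairs jj'; rewrite subrr mulr0.
Qed.

Lemma pair_vector0 (V : pzRingType) (x : 'I_#|S| -> V) i : i \notin supp S -> pair_vector x i = 0.
Proof.
move=> iS; rewrite /pair_vector big1// => j _.
have [-> ->] : (i == (enum_val j).1) = false /\ (i == (enum_val j).2) = false.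
  split; apply/negbTE; apply: contraNneq iS => ->.
    exact/mem_supp1/enum_valP.
  exact/mem_supp2/enum_valP.
by rewrite subrr mulr0.
Qed.

Definition lattice_vector l : 'I_p -> int := pair_vector (fun j => centered (tnth l j)).

Lemma lattice_vector1 l j : lattice_vector l (enum_val j).1 = centered (tnth l j).
Proof. exact: pair_vector1. Qed.

Lemma lattice_vector2 l j : lattice_vector l (enum_val j).2 = - centered (tnth l j).
Proof. exact: pair_vector2. Qed.

Lemma lattice_vector0 l i : i \notin supp S -> lattice_vector l i = 0.
Proof. exact: pair_vector0. Qed.

Lemma suppE i : i \in supp S -> exists j : 'I_#|S|, i = (enum_val j).1 \/ i = (enum_val j).2.
Proof.
move=> /suppP[q qS /orP[]/eqP ->]; exists (enum_rank_in qS q); rewrite enum_rankK_in//.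
  by left.
by right.
Qed.

Lemma lattice_vector_le l i : `|lattice_vector l i| <= B%:Z.
Proof.
have [/suppE[j [->|->]]|/lattice_vector0 ->] := boolP (i \in supp S).
- by rewrite lattice_vector1 centered_le.
- by rewrite lattice_vector2 normrN centered_le.
- by rewrite normr0.
Qed.

Lemma sum_lattice_vector l : \sum_i lattice_vector l i = 0.
Proof.
rewrite exchange_big big1// => j _; rewrite -mulr_sumr sumrB.
have h (a : 'I_p) : \sum_i (i == a)%:R = 1 :> int.
  by rewrite (bigD1 a)//= eqxx big1 ?addr0// => i /negbTE ->.
by rewrite !h subrr mulr0.
Qed.

End lattice.

Section encoding.
Context {n m : nat} (S : {set 'I_n.+1 * 'I_n.+1}).
Hypothesis pS : pairing S.
Local Notation N := m.+1.
Local Notation I := 'I_(N.*2.*2.+1).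
Implicit Types (t : n.-tuple I) (l : #|S|.-tuple I).

Definition encode l : n.-tuple I :=
  [tuple uncenter (lattice_vector l (lift ord_max i)) | i < n].

Definition decode t : #|S|.-tuple I :=
  [tuple uncenter (frequency t (enum_val j).1) | j < #|S|].

(** Frequencies on [supp S] may vanish: such vectors get weight 0 later, and admitting them lets
    [encode] parametrise the supported vectors by a full box. *)
Definition supported t : bool :=
  matched (frequency t) S && [forall i, (i \notin supp S) ==> (frequency t i == 0)].

Lemma frequency_encode l j : frequency (encode l) j = lattice_vector l j.
Proof.
have h i : centered (tnth (encode l) i) = lattice_vector l (lift ord_max i).
  by rewrite tnth_mktuple uncenterK// lattice_vector_le.
rewrite /frequency; case: unliftP => [i ->|->]; first exact: h.
have := sum_lattice_vector l; rewrite (bigD1_ord ord_max)//= => /eqP.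
by rewrite addr_eq0 => /eqP ->; congr (- _); apply: eq_bigr => i _.
Qed.

Lemma supported_encode l : supported (encode l).
Proof.
apply/andP; split; last first.
  by apply/forallP => i; apply/implyP => iS; rewrite frequency_encode lattice_vector0.
apply/forall_inP => q qS; rewrite !frequency_encode.
rewrite -(enum_rankK_in qS qS); set j := enum_rank_in _ _.
by rewrite lattice_vector1// lattice_vector2.
Qed.

Lemma encodeK l : decode (encode l) = l.
Proof.
apply: eq_from_tnth => j.
by rewrite tnth_mktuple frequency_encode lattice_vector1// centeredK.
Qed.

Lemma decodeK t : supported t -> encode (decode t) = t.
Proof.
move=> /andP[/forall_inP mt /forallP st].
have h1 j : centered (tnth (decode t) j) = frequency t (enum_val j).1.
  rewrite tnth_mktuple uncenterK// /frequency.
  (* A first entry is smaller than its partner, hence not the last index, the only one whose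
     frequency may leave the range of [I]. *)
  have [q12 _ _ _] := pairingD1 (enum_valP j) pS.
  case: unliftP => [i _|e]; first exact: centered_le.
  by move: q12; rewrite e ltnNge leq_ord.
have h i : lattice_vector (decode t) i = frequency t i.
  have [/suppE[j [->|->]]|iS] := boolP (i \in supp S).
  - by rewrite lattice_vector1.
  - by rewrite lattice_vector2// h1 (eqP (mt _ (enum_valP j))).
  - by rewrite lattice_vector0//; have /implyP/(_ iS)/eqP -> := st i.
apply: eq_from_tnth => i; apply: centered_inj.
rewrite tnth_mktuple uncenterK ?lattice_vector_le// h.
by rewrite /frequency liftK.
Qed.

Lemma sum_supported (V : nmodType) (F : n.-tuple I -> V) :
  \sum_(t | supported t) F t = \sum_l F (encode l).
Proof.
rewrite (reindex_onto encode decode) /=; last by move=> t; exact: decodeK.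
by apply: eq_bigl => l; rewrite supported_encode encodeK eqxx.
Qed.

Lemma frequency_row_encode (R : realType) l :
  (frequency_row (encode l) : 'rV[R]_n.+1) =
  \sum_(j < #|S|) tnth (map_tuple (@node R N N.*2) l) j *: e_pair R (enum_val j).
Proof.
apply/rowP => i; rewrite summxE mxE frequency_encode rmorph_sum mulr_suml.
apply: eq_bigr => j _; rewrite tnth_map /node !mxE eqxx !andTb rmorphM.
by case: eqP; case: eqP => * /=; rewrite !(subrr, subr0, sub0r) ?mulrNz ?mulr0z ?mulr1z; ring.
Qed.

End encoding.

(** * The expectation as an exact sum of Riemann sums *)

Section expectation.
Context {R : realType} {n : nat} (phi Phi : 'rV[R]_n.+1 -> R[i]).
Hypotheses (phi_test : test_function phi) (Phi_phi : associated Phi phi).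
Hypothesis Phi_supp : forall xi, Phi xi != 0 -> \sum_j `|xi 0 j| < 2.
Context {m : nat}.
Local Notation N := m.+1.
Local Notation I := 'I_(N.*2.*2.+1).
Implicit Types (t : n.-tuple I) (S : {set 'I_n.+1 * 'I_n.+1}).
Variable mu : probability (borel_unitary R N) R.
Hypothesis haar : haar_measure mu.

Definition pair_fun S (t : #|S|.-tuple R) : R[i] :=
  Phi (\sum_(j < #|S|) tnth t j *: e_pair R (enum_val j)) *
  (\prod_(j < #|S|) `|tnth t j|)%:C.

Lemma frequency_bound t : Phi (frequency_row t) != 0 -> \sum_j `|frequency t j| <= 2 * N%:Z.
Proof.
move=> /Phi_supp h; rewrite -(ler_int R) rmorph_sum.
have N0 : 0 < N%:R :> R by rewrite ltr0n.
have e : \sum_j `|frequency_row t 0 j| = (\sum_j `|(frequency t j)%:~R|) / N%:R :> R.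
  rewrite mulr_suml; apply: eq_bigr => j _.
  by rewrite mxE normrM normfV (ger0_norm (ltW N0)).
move: h; rewrite e ltr_pdivrMr// => /ltW; under eq_bigr do rewrite -intr_norm.
by rewrite rmorphM.
Qed.

(** If S matches the nonzero frequencies, there are n + 1 - 2|S| zero ones, each giving a factor N;
    the power N^(-2|S|) is left. *)
Lemma moment_frequency t : \sum_j `|frequency t j| <= 2 * N%:Z ->
  (N%:R^-1 ^+ n.+1)%:C * moment mu [seq frequency t j | j <- index_enum 'I_n.+1] =
  \sum_(S | pairing S && supported S t)
    (N%:R^-1 ^+ (2 * #|S|))%:C * \prod_(q in S) (`|frequency t q.1|%N)%:R :> R[i].
Proof.
move=> tN; pose A : {set 'I_n.+1} := [set i | frequency t i != 0]%SET.
have mE : moment mu [seq frequency t j | j <- index_enum 'I_n.+1] =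
    N%:R ^+ #|[set i | frequency t i == 0]%SET| * pairing_sum (frequency t) R[i] A :> R[i].
  exact: (moment_pairing haar (sum_frequency t) tN).
have N0 : (N%:R : R[i]) != 0 by rewrite pnatr_eq0.
rewrite mE mulrA /pairing_sum mulr_sumr.
(* The remaining S have support strictly larger than A, so one of their pairs has frequency 0 and
   kills the product. *)
rewrite [RHS](bigID (fun S => supp S == A)) /= [X in _ = _ + X]big1 ?addr0; last first.
  move=> S /andP[/andP[pS /andP[/forall_inP mt /forallP st]] SA].
  have sub : A \subset supp S.
    apply/fintype.subsetP => i; rewrite inE; apply: contraR => iS.
    by have /implyP/(_ iS) := st i.
  have [i iS iA] : exists2 i, i \in supp S & i \notin A.
    by apply/fintype.subsetPn; move: SA; rewrite finset.eqEsubset sub andbT.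
  have ki : frequency t i = 0 by move: iA; rewrite inE negbK => /eqP.
  have [q qS qi] := suppP _ _ iS.
  rewrite (bigD1 q)//= (_ : frequency t q.1 = 0) ?mul0r ?mulr0//.
  case/orP: qi => /eqP iq; first by rewrite -iq.
  by have := mt q qS; rewrite -iq ki eq_sym oppr_eq0 => /eqP.
apply: eq_big => [S|S /and3P[pS /eqP SA _]].
  rewrite -andbA; congr (_ && _); rewrite [LHS]andbC.
  have [SA|_] := eqVneq (supp S) A; rewrite /= /supported; last by rewrite !andbF.
  have F : [forall i, (i \notin supp S) ==> (frequency t i == 0)].
    by apply/forallP => i; apply/implyP; rewrite SA inE negbK.
  by rewrite F !andbT.
congr (_ * _).
have Z : (#|[set i | frequency t i == 0]%SET| + 2 * #|S|)%N = n.+1.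
  rewrite -(card_supp pS) SA -[RHS]card_ord -(cardC A) addnC; congr (_ + _)%N.
  by apply: eq_card => i; rewrite !inE negbK.
rewrite -[X in _ ^+ X]Z; set z := #|_|.
rewrite exprD !rmorphM !rmorphXn fmorphV rmorph_nat mulrAC -exprMn mulVf//.
by rewrite expr1n mul1r.
Qed.

(** Where [Phi] is nonzero the moment formula applies. Half of N^(-2|S|) rescales each |k| to |k/N|,
    the other half is the volume of a grid cell. *)
Lemma expectation_pairings : cintegral mu (linear_stat phi) =
  \sum_(S : {set 'I_n.+1 * 'I_n.+1} | pairing S) (N%:R^-1 ^+ #|S|)%:C *
    \sum_(l : #|S|.-tuple I) pair_fun (map_tuple (@node R N N.*2) l).
Proof.
rewrite (cintegral_linear_stat phi_test Phi_phi Phi_supp) mulr_sumr.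
transitivity (\sum_(t : n.-tuple I) \sum_(S | pairing S && supported S t) Phi (frequency_row t) *
    ((N%:R^-1 ^+ (2 * #|S|))%:C * \prod_(q in S) (`|frequency t q.1|%N)%:R)).
  apply: eq_bigr => t _; have [Phi0|Phi0] := eqVneq (Phi (frequency_row t)) 0.
    by rewrite Phi0 mul0r mulr0 big1// => S _; rewrite mul0r.
  by rewrite mulrCA moment_frequency ?frequency_bound// mulr_sumr.
rewrite (exchange_big_dep (fun S => pairing S)) /=; last by move=> t S _ /andP[].
apply: eq_bigr => S pS; under eq_bigl do rewrite pS.
rewrite (sum_supported pS) mulr_sumr; apply: eq_bigr => l _.
rewrite frequency_row_encode// /pair_fun [RHS]mulrCA; congr (_ * _).
rewrite mul2n -addnn exprD rmorphM -mulrA; congr (_ * _).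
rewrite (big_enum_val (fun q => (`|frequency (encode l) q.1|%N)%:R)) /=.
rewrite -[X in _ ^+ X]card_ord -prodr_const !rmorph_prod -big_split; apply: eq_bigr => j _.
rewrite frequency_encode// lattice_vector1// tnth_map /node normrM normfV.
rewrite [`|N%:R|]ger0_norm// mulrC rmorphM; congr (_ * _).
by rewrite -intr_norm -abszE rmorph_nat.
Qed.

End expectation.

(** * Convergence of the Riemann sums *)

Section riemann_pairings.
Context {R : realType} {n : nat} (Phi : 'rV[R]_n.+1 -> R[i]).
Hypothesis Phi_schwartz : schwartz Phi.
Hypothesis Phi_supp : forall xi, Phi xi != 0 -> \sum_j `|xi 0 j| < 2.
Variable S : {set 'I_n.+1 * 'I_n.+1}.
Hypothesis pS : pairing S.
Local Notation RT m := (m.-tuple (measurableTypeR R)).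
Implicit Types t : #|S|.-tuple R.

Let A t : 'rV[R]_n.+1 := \sum_(j < #|S|) tnth t j *: e_pair R (enum_val j).

Let AE t i : A t 0 i = pair_vector (fun j => tnth t j) i.
Proof.
by rewrite /A /pair_vector summxE; apply: eq_bigr => j _; rewrite !mxE eqxx !andTb.
Qed.

Let A_lip s t i : `|A s 0 i - A t 0 i| <= 1 * dist1 s t.
Proof.
rewrite mul1r !AE /pair_vector -sumrB (le_trans (ler_norm_sum _ _ _))//.
apply: ler_sum => j _; rewrite -mulrBl normrM ler_piMr//.
by case: eqP; case: eqP => *; rewrite ?subrr ?subr0 ?sub0r ?normrN ?normr1 ?normr0.
Qed.

Lemma pair_fun_supp t : Phi (A t) != 0 -> forall j, `|tnth t j| < 2.
Proof.
move=> /Phi_supp h j; apply: le_lt_trans h.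
rewrite (bigD1 (enum_val j).1)//= AE pair_vector1// lerDl; exact: sumr_ge0.
Qed.

Lemma riemann_pairing_real (f : 'rV[R]_n.+1 -> R) : schwartzR f ->
  (forall xi, f xi != 0 -> Phi xi != 0) ->
  exists K : R, forall N : nat, (0 < N)%N ->
    `|\int[lebesgue_tuple R #|S|]_t (f (A t) * \prod_(j < #|S|) `|tnth t j|) -
      N%:R^-1 ^+ #|S| * \sum_(l : #|S|.-tuple 'I_(N.*2.*2.+1))
        (let t := map_tuple (@node R N N.*2) l in f (A t) * \prod_(j < #|S|) `|tnth t j|)|
    <= K / N%:R.
Proof.
move=> sf fPhi; pose h t := f (A t) * \prod_(j < #|S|) `|tnth t j|.
have hE : h = fun t => f (A t) * \prod_(j < #|S|) Num.min `|tnth t j| 2.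
  apply/funext => t; rewrite /h; have [->|ft] := eqVneq (f (A t)) 0; first by rewrite !mul0r.
  congr (_ * _); apply: eq_bigr => j _; rewrite min_l// ltW//.
  by apply: pair_fun_supp; exact: fPhi.
have [L [C [L0 hL hC]]] : BL h.
  rewrite hE; apply: BLM; first exact: (BL_schwartz sf ler01 A_lip).
  by apply: BL_prod => j; exact: BL_min.
(* There are 4N + 1 nodes per axis: (4N + 1)/(2N) <= 3 and 1 + (4N + 1)/N <= 6. *)
exists (L * 3 * #|S|%:R * 6 ^+ #|S|) => N N_gt0.
have hS : grid_supported N N.*2 h.
  move=> t ht j; have ft : f (A t) != 0.
    by apply: contraNneq ht => e; rewrite /h e mul0r.
  rewrite -muln2 natrM mulrC ler_wpM2l// ltW//.
  by apply: pair_fun_supp; exact: fPhi.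
apply: (le_trans (riemann_sum N_gt0 L0 hL hC hS)).
have N1 : 1 <= N%:R :> R by rewrite ler1n.
have N0 : 0 < N%:R :> R by rewrite ltr0n.
have BE : N.*2.*2.+1%:R = 4 * N%:R + 1 :> R.
  by rewrite -addn1 natrD -!muln2 !natrM -mulrA mulrC -natrM.
have h1 : N.*2.*2.+1%:R * (radius N / N%:R) <= 3 / N%:R :> R.
  rewrite BE /radius mulrA ler_wpM2r ?invr_ge0 ?(ltW N0)// ler_pdivrMr ?mulr_gt0//; lra.
have h2 : (1 + N%:R^-1 * N.*2.*2.+1%:R) ^+ #|S| <= 6 ^+ #|S| :> R.
  rewrite lerXn2r ?nnegrE ?addr_ge0 ?mulr_ge0 ?invr_ge0//.
  rewrite BE mulrDr mulr1 mulrCA mulVf ?gt_eqF// mulr1.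
  have : N%:R^-1 <= 1 :> R by rewrite invf_le1.
  lra.
rewrite [leRHS](_ : _ = L * (3 / N%:R) * #|S|%:R * 6 ^+ #|S|); last by ring.
rewrite ler_pM// ?mulr_ge0 ?exprn_ge0 ?addr_ge0 ?mulr_ge0 ?invr_ge0//.
by rewrite ler_wpM2r// ler_wpM2l.
Qed.

Lemma riemann_pairing : exists K : R, forall N : nat, (0 < N)%N ->
  `|(N%:R^-1 ^+ #|S|)%:C * (\sum_(l : #|S|.-tuple 'I_(N.*2.*2.+1))
      pair_fun Phi (map_tuple (@node R N N.*2) l)) - pairing_integral Phi S| <= (K / N%:R)%:C.
Proof.
have [sR sI] := Phi_schwartz.
have [K hK] : exists K : R, forall N : nat, (0 < N)%N ->
    `|\int[lebesgue_tuple R #|S|]_t (complex.Re (Phi (A t)) * \prod_(j < #|S|) `|tnth t j|) -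
      N%:R^-1 ^+ #|S| * \sum_(l : #|S|.-tuple 'I_(N.*2.*2.+1))
        (let t := map_tuple (@node R N N.*2) l in
         complex.Re (Phi (A t)) * \prod_(j < #|S|) `|tnth t j|)| <= K / N%:R.
  by apply: (riemann_pairing_real sR) => xi; apply: contraNneq => ->.
have [K' hK'] : exists K : R, forall N : nat, (0 < N)%N ->
    `|\int[lebesgue_tuple R #|S|]_t (complex.Im (Phi (A t)) * \prod_(j < #|S|) `|tnth t j|) -
      N%:R^-1 ^+ #|S| * \sum_(l : #|S|.-tuple 'I_(N.*2.*2.+1))
        (let t := map_tuple (@node R N N.*2) l in
         complex.Im (Phi (A t)) * \prod_(j < #|S|) `|tnth t j|)| <= K / N%:R.
  by apply: (riemann_pairing_real sI) => xi; apply: contraNneq => ->.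
have reE t : complex.Re (Phi (A t) * (\prod_(j < #|S|) `|tnth t j|)%:C) =
    complex.Re (Phi (A t)) * \prod_(j < #|S|) `|tnth t j|.
  by rewrite mulrC Re_mulCl mulrC.
have imE t : complex.Im (Phi (A t) * (\prod_(j < #|S|) `|tnth t j|)%:C) =
    complex.Im (Phi (A t)) * \prod_(j < #|S|) `|tnth t j|.
  by rewrite mulrC Im_mulCl mulrC.
exists (K + K') => N N_gt0; rewrite mulrDl.
apply: (le_trans (normC_le_ReIm _)); rewrite lecR.
rewrite /pairing_integral cintegralE ReB ImB Re_mulCl Im_mulCl Re_sum Im_sum.
rewrite distrC [X in _ + X]distrC; apply: lerD.
  apply: le_trans (hK N N_gt0); rewrite le_eqVlt; apply/orP; left; apply/eqP.
  congr (`|_ - _ * _|); first by apply: eq_Rintegral => t _; exact: reE.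
  by apply: eq_bigr => l _; exact: reE.
apply: le_trans (hK' N N_gt0); rewrite le_eqVlt; apply/orP; left; apply/eqP.
congr (`|_ - _ * _|); first by apply: eq_Rintegral => t _; exact: imE.
by apply: eq_bigr => l _; exact: imE.
Qed.

End riemann_pairings.

(** * Grouping the pairings by size *)

Section main_term.
Context {R : realType} {n : nat}.
Implicit Types (Phi : 'rV[R]_n.+1 -> R[i]) (S : {set 'I_n.+1 * 'I_n.+1}).

(** On 0-tuples [lebesgue_tuple] is a point mass, and the empty sum and product are 0 and 1. *)
Lemma pairing_integral0 Phi S : #|S| = 0%N -> pairing_integral Phi S = Phi 0.
Proof.
move=> c0; rewrite /pairing_integral cintegralE.
have e (t : #|S|.-tuple R) : Phi (\sum_(j < #|S|) tnth t j *: e_pair R (enum_val j)) *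
    (\prod_(j < #|S|) `|tnth t j|)%:C = Phi 0.
  by rewrite !big1 ?mulr1// => j _; have := ltn_ord j; rewrite [X in (_ < X)%N]c0.
have cst (c : R) k : (k = 0)%N -> \int[lebesgue_tuple R k]_t c = c.
  move=> ->; rewrite Rintegral_cst//.
  by rewrite [X in fine X](_ : _ = 1%E) ?mulr1//= diracT.
by apply: eq_ReIm => /=; rewrite -[RHS](cst _ _ c0); apply: eq_Rintegral => t _; rewrite e.
Qed.

(** A pairing uses 2|S| <= n + 1 indices, and only the empty one has size 0. *)
Lemma sum_pairings_by_size (F : {set 'I_n.+1 * 'I_n.+1} -> R[i]) :
  \sum_(S | pairing S) F S = F finset.set0 +
    \sum_(1 <= k < (n.+1)./2.+1) \sum_(S | pairing S && (#|S| == k)) F S.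
Proof.
have sizeS S : pairing S -> (#|S| < (n.+1)./2.+1)%N.
  move=> pS; have := max_card (mem (supp S)); rewrite card_supp// card_ord => h.
  by rewrite ltnS; lia.
transitivity (\sum_(0 <= k < (n.+1)./2.+1) \sum_(S | pairing S && (#|S| == k)) F S).
  rewrite (exchange_big_dep (fun S => pairing S)) /=; last by move=> k S _ /andP[].
  apply: eq_bigr => S pS; rewrite big_mkord (big_pred1 (Ordinal (sizeS S pS)))// => k /=.
  by rewrite pS eq_sym.
rewrite big_ltn//; congr (_ + _); apply: big_pred1 => S /=; rewrite cards_eq0.
by apply/andP/eqP => [[_ /eqP]//|->]; rewrite pairing0 eqxx.
Qed.

End main_term.

Theorem theorem1 (R : realType) (n : nat) (phi Phi : 'rV[R]_n.+1 -> R[i])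
  (phi_test : test_function phi) (Phi_phi : associated Phi phi)
  (Phi_supp : forall xi : 'rV[R]_n.+1, Phi xi != 0 -> \sum_j `|xi 0 j| < 2)
  (haar : forall N : nat, probability (borel_unitary R N) R)
  (haarP : forall N : nat, haar_measure (haar N)) :
  exists K : R, \forall N \near \oo,
    `| cintegral (haar N) (fun U : unitary R N => linear_stat phi U) -
       (Phi 0 +
        \sum_(1 <= m < (n.+1)./2.+1)
          \sum_(S : {set 'I_n.+1 * 'I_n.+1} | pairing S && (#|S| == m))
            pairing_integral Phi S) |
    <= (K / N%:R)%:C.
Proof.
have [Phi_schwartz _] := Phi_phi.
have /choice[K hK] : forall S : {set 'I_n.+1 * 'I_n.+1}, exists K : R, pairing S ->
    forall N : nat, (0 < N)%N -> `|(N%:R^-1 ^+ #|S|)%:C *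
      (\sum_(l : #|S|.-tuple 'I_(N.*2.*2.+1)) pair_fun Phi (map_tuple (@node R N N.*2) l)) -
      pairing_integral Phi S| <= (K / N%:R)%:C.
  move=> S; have [pS|_] := boolP (pairing S); last by exists 0.
  by have [K hK] := riemann_pairing Phi_schwartz Phi_supp pS; exists K.
(* The bound holds for every N >= 1, since [expectation_pairings] is exact there and the finitely
   many Riemann errors add up. *)
exists (\sum_(S | pairing S) K S); exists 1%N => // -[//|N] _.
rewrite -(pairing_integral0 Phi (@cards0 _)) -(sum_pairings_by_size (pairing_integral Phi)).
rewrite (expectation_pairings phi_test Phi_phi Phi_supp (haarP N.+1)) -sumrB.
rewrite (le_trans (ler_norm_sum _ _ _))// mulr_suml rmorph_sum.
by apply: ler_sum => S pS; exact: hK.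
Qed.
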